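(* Let $\boldsymbol\nu=(\nu,\lambda,\rho,\nu^\infty)\in\mathbf Y^2(\Omega;E)$ be an $\mathcal A$-free two-scale* Young measure. Then at $(\mathscr L^d+\lambda^s)$-almost every $x_0\in\Omega$ the second-scale barycenter satisfies $$\mathcal A_\xi[\![\boldsymbol\nu]\!]_{x_0}=0\quad\text{in the sense of distributions on }Z.$$
   Context: $\Omega\subset\mathbb R^d$ is open and bounded with $\mathscr L^d(\partial\Omega)=0$; $Z=\mathbb T^d=\mathbb R^d/\mathbb Z^d$; $E,F$ are finite-dimensional Euclidean spaces; $\mathbb B_E$ is the open unit ball of $E$. $\mathcal A=\sum_{|\alpha|=k}A_\alpha\partial^\alpha$, $A_\alpha\in\mathrm{Lin}(E;F)$, is a homogeneous constant-coefficient operator of order $k$ on $\mathbb R^d$; $\mathcal A_\xi$ denotes its action on $\mathcal D'(Z;E)$. A two-scale* Young measure is a four-tuple $\boldsymbol\nu=(\nu,\lambda,\rho,\nu^\infty)$ where: (i) $(x,\xi)\mapsto\nu_{x,\xi}$ is a weak-* measurable (w.r.t. Lebesgue measure) map from $\overline\Omega\times Z$ to $\mathrm{Prob}(E)$ with $(x,\xi)\mapsto\int_E|z|\,d\nu_{x,\xi}(z)$ integrable; (ii) $\lambda$ is a bounded positive measure on $\overline\Omega$; (iii) $x\mapsto\rho_x$ is a weak-* $\lambda$-measurable map from $\overline\Omega$ to $\mathrm{Prob}(Z)$; (iv) $(x,\xi)\mapsto\nu^\infty_{x,\xi}$ is a weak-* $(\lambda\otimes\rho_x)$-measurable map to $\mathrm{Prob}(\partial\mathbb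 B_E)$. The set of these is $\mathbf Y^2(\Omega;E)$. Generation: $\mathbf E^2(\Omega;E)$ is the set of $f\in C(\Omega\times Z\times E)$ such that $(Tf)(x,\xi,\hat z)=(1-|\hat z|)f(x,\xi,\hat z/(1-|\hat z|))$ extends continuously to $\overline{\Omega\times Z\times\mathbb B_E}$; then $f^\infty(x,\xi,z)=\lim_{x'\to x,\xi'\to\xi,t\to\infty}f(x',\xi',tz)/t$ exists. $(\mu_\varepsilon)\subset\mathcal M(\Omega;E)$, $\varepsilon\searrow0$, generates $\boldsymbol\nu$ if for all $f\in\mathbf E^2(\Omega;E)$ $$\int_\Omega f(x,x/\varepsilon,\mu_\varepsilon^{ac})\,dx+\int_\Omega f^\infty(x,x/\varepsilon,(\mu_\varepsilon)_s)\,d|\mu_\varepsilon^s|\to\int_\Omega\int_Z\langle f(x,\xi,\cdot),\nu_{x,\xi}\rangle d\xi dx+\int_{\overline\Omega}\int_Z\langle f^\infty(x,\xi,\cdot),\nu^\infty_{x,\xi}\rangle d\rho_x(\xi)d\lambda(x),$$ where $\mu=\mu^{ac}\mathscr L^d+\mu_s|\mu^s|$ is the Lebesgue–polar decomposition and $\langle h,\sigma\rangle=\int h\,d\sigma$. $\boldsymbol\nu$ is $\mathcal A$-free (for a fixed $1<p<\frac d{d-1}$) if there are $\varepsilon\searrow0$ and $(\mu_\varepsilon)\subset\mathcal M(\Omega;E)$ generating $\boldsymbol\nu$ with $\mathcal A\mu_\varepsilon\to0$ strongly in $W^{-k,p}(\Omega)$. Second-scale barycenter: write $\lambda=\lambda^{ac}\mathscr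 L^d+\lambda^s$ and let $\overline\Omega=\mathrm{Reg}\cup\mathrm{Sing}$ be a Borel partition with $\mathscr L^d(\mathrm{Sing})=\lambda^s(\mathrm{Reg})=0$. $[\![\boldsymbol\nu]\!]_x\in\mathcal M(Z;E)$ is defined for Borel $V\subset Z$ by $[\![\boldsymbol\nu]\!]_x(V)=\int_V\langle\mathrm{id}_E,\nu_{x,\xi}\rangle d\xi+\lambda^{ac}(x)\int_V\langle\mathrm{id}_{\partial\mathbb B_E},\nu^\infty_{x,\xi}\rangle d\rho_x(\xi)$ if $x\in\mathrm{Reg}$, and $[\![\boldsymbol\nu]\!]_x(V)=\int_V\langle\mathrm{id}_{\partial\mathbb B_E},\nu^\infty_{x,\xi}\rangle d\rho_x(\xi)$ if $x\in\mathrm{Sing}$. *)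

(* Defs.v *)
From HB Require Import structures.
From mathcomp Require Import all_boot all_order all_algebra.
From mathcomp Require Import generic_quotient.
From mathcomp Require Import all_classical all_reals all_analysis.
From mathcomp Require Import measurable_realfun.

Set Implicit Arguments.
Unset Strict Implicit.
Unset Printing Implicit Defensive.

Import Order.TTheory GRing.Theory Num.Theory.
Import numFieldNormedType.Exports.

Local Open Scope classical_set_scope.
Local Open Scope ring_scope.

(* Euclidean spaces are row vectors ['rV[R]_n]: the topology is the one of the
   library, the sigma-algebra is generated by the open sets, and the Euclidean
   norm is [enorm] below, since [`|x|] is the sup norm. *)

Definition borel_display : measure_display.
Proof. exact: default_measure_display. Qed.

Section borel_matrix.
Context (R : realType) (m n : nat).
Let G := @open 'M[R]_(m, n).
HB.instance Definition _ := @isMeasurable.Build borel_display 'M[R]_(m, n)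
  <<s G >> (@sigma_algebra0 _ setT G) (@sigma_algebraC _ G)
  (@sigma_algebra_bigcup _ setT G).
End borel_matrix.

Section lebesgue_rV.
Context (R : realType).
Implicit Types n : nat.

Lemma open_measurable_mx m n (U : set 'M[R]_(m, n)) : open U -> measurable U.
Proof. by move=> oU; apply: sub_sigma_algebra. Qed.

Definition rV_cons n (p : R * 'rV[R]_n) : 'rV[R]_n.+1 :=
  row_mx (p.1%:M : 'rV_1) p.2.
Definition rV_uncons n (x : 'rV[R]_n.+1) : R * 'rV[R]_n :=
  (x 0 0, @rsubmx _ 1 1 n x).

Arguments rV_cons {n}.
Arguments rV_uncons {n}.

Lemma rV_consK n : cancel (@rV_cons n) (@rV_uncons n).
Proof.
move=> [a v]; rewrite /rV_uncons /rV_cons row_mxKr /=; congr pair.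
have -> : (0 : 'I_n.+1) = lshift n (0 : 'I_1) by apply/val_inj.
by rewrite (@row_mxEl _ 1 1 n) mxE eqxx mulr1n.
Qed.

Lemma rV_unconsK n : cancel (@rV_uncons n) (@rV_cons n).
Proof.
move=> x; rewrite /rV_uncons /rV_cons /=.
rewrite -[RHS](@hsubmxK _ 1 1 n); congr (@row_mx _ 1 1 n _ _).
by apply/matrixP => i j; rewrite !ord1 !mxE eqxx mulr1n; congr (x _ _); apply/val_inj.
Qed.

Lemma measurable_rV_cons n : measurable_fun setT (@rV_cons n).
Proof.
apply: (@measurability _ _ _ _ _ _ (@open 'rV[R]_n.+1)) => //.
move=> _ [U oU <-]; rewrite setTI.
pose c (i : 'rV[rat]_n.+1 * nat) : 'rV[R]_n.+1 := map_mx ratr i.1.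
pose r (i : 'rV[rat]_n.+1 * nat) : R := i.2.+1%:R^-1.
pose B i := ball (c i) (r i).
pose C i := ball (rV_uncons (c i)).1 (r i) `*` ball (rV_uncons (c i)).2 (r i).
have -> : rV_cons @^-1` U = \bigcup_i (if pselect (B i `<=` U) then C i else set0).
  have BE i p : B i (rV_cons p) <->
    C i p.
    rewrite /B /C -[X in ball X _ (rV_cons _)](rV_unconsK (c i)).
    move: (rV_uncons _) => q.
    have i0 : 0 < r i by rewrite invr_gt0.
    split.
      move=> [_ h]; split.
        have := h 0 (@lshift 1 n 0).
        by rewrite /rV_cons !(@row_mxEl _ 1 1 n) !mxE eqxx !mulr1n.
      split => // a b; have := h a (@rshift 1 n b).
      by rewrite /rV_cons !(@row_mxEr _ 1 1 n).
    move=> [h1 [_ h2]]; split => // a b; rewrite /rV_cons.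
    case: (@split_ordP 1 n b) => b' ->.
      by rewrite !(@row_mxEl _ 1 1 n) !ord1 !mxE eqxx !mulr1n.
    by rewrite !(@row_mxEr _ 1 1 n).
  apply/seteqP; split => [p Up|p [i _]]; last by case: pselect => // BU /BE/BU.
  have [e /= e0 eU] : exists2 e : R, 0 < e & ball (rV_cons p) e `<=` U.
    by have /nbhs_ballP[e e0 eU] := open_nbhs_nbhs (conj oU Up); exists e.
  have [k ke] : exists k : nat, k.+1%:R^-1 < e / 2.
    have e20 : 0 < e / 2 by rewrite divr_gt0.
    by have [k _ /(_ _ (leqnn k))] := near_infty_natSinv_lt (PosNum e20); exists k.
  have [q qp] : exists q : 'rV[rat]_n.+1, B (q, k) (rV_cons p).
    have h (i : 'I_n.+1) : {q : rat | ball (ratr q : R) (k.+1%:R^-1) (rV_cons p 0 i)}.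
      apply: cid.
      have [|q] := @rat_in_itvoo R (rV_cons p 0 i - k.+1%:R^-1) (rV_cons p 0 i + k.+1%:R^-1).
        by rewrite ltrD2l gtrN.
      rewrite in_itv/= => /andP[h1 h2]; exists q.
      by rewrite /ball/= ltr_distl h1 h2.
    exists (\row_i projT1 (h i)); split => [|a b]; first by rewrite invr_gt0.
    by rewrite !mxE ord1; exact: (projT2 (h b)).
  have BU : B (q, k) `<=` U.
    move=> y /= By; apply: eU.
    rewrite (splitr e); apply: (@ball_triangle _ _ (c (q, k))).
      apply: le_ball; first exact: ltW ke.
      exact/ball_sym/qp.
    by apply: le_ball By; exact: ltW.
  by exists (q, k) => //; case: pselect => //= ?; exact/BE.
apply: countable_bigcupT_measurable => // i; case: pselect => //= ?.
apply: measurableX; first exact: measurable_ball.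
by apply: open_measurable_mx; apply: ball_open; rewrite invr_gt0.
Qed.

Lemma continuous_measurable_mx m n (f : 'M[R]_(m, n) -> R) :
  continuous f -> measurable_fun setT f.
Proof.
move=> /continuousP cf; apply: (measurability _ (RGenOpens.measurableE R)).
move=> _ [_ [a [b ->] <-]]; rewrite setTI; apply: open_measurable_mx.
exact/cf/interval_open.
Qed.

Lemma measurable_rV_uncons n : measurable_fun setT (@rV_uncons n).
Proof.
apply: measurable_fun_pair => /=.
  by apply: continuous_measurable_mx => x; exact: coord_continuous.
apply: (@measurability _ _ _ _ _ _ (@open 'rV[R]_n)) => //.
move=> _ [U oU <-]; rewrite setTI; apply: open_measurable_mx.
rewrite openE => x /= Ux.
have /nbhs_ballP[e /= e0 eU] := open_nbhs_nbhs (conj oU Ux).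
apply/nbhs_ballP; exists e => //= y [_ xy]; apply: eU; split => // i j.
by rewrite !mxE; exact: xy.
Qed.


Section step.
Variables (n : nat) (mu : {sigma_finite_measure set 'rV[R]_n -> \bar R}).

Let P := pushforward (lebesgue_measure \x mu)%E (@rV_cons n).
Definition rV_lebesgue_step : set 'rV[R]_n.+1 -> \bar R := P.
Let PM := measure_function_pushforward__canonical__measure_function_Measure
  (lebesgue_measure \x mu)%E (@measurable_rV_cons n).

Let step0 : rV_lebesgue_step set0 = 0%E.
Proof. exact: (measure0 PM). Qed.
Let step_ge0 A : (0 <= rV_lebesgue_step A)%E.
Proof. exact: (measure_ge0 PM). Qed.
Let step_sigma : semi_sigma_additive rV_lebesgue_step.
Proof. exact: (@measure_semi_sigma_additive _ _ _ PM). Qed.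
HB.instance Definition _ := isMeasure.Build _ _ _ rV_lebesgue_step
  step0 step_ge0 step_sigma.

Let step_sigma_finite : sigma_finite setT rV_lebesgue_step.
Proof.
have [F FT Fm] : sigma_finite setT (lebesgue_measure \x mu)%E.
  have /sigma_finiteP[F [TF ndF Foo]] := sigma_finiteT (@lebesgue_measure R).
  have /sigma_finiteP[G [TG ndG Goo]] := sigma_finiteT mu.
  exists (fun k => F k `*` G k).
    rewrite -setXTT TF TG predeqE => -[x y]; split.
      move=> [/= [i _ Fnx] [k _ Gky]]; exists (maxn i k) => //; split.
      - by move: x Fnx; exact/subsetPset/ndF/leq_maxl.
      - by move: y Gky; exact/subsetPset/ndG/leq_maxr.
    by move=> [i _ []/= ? ?]; split; exists i.
  move=> k; have [? ?] := Foo k; have [? ?] := Goo k.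
  split; first exact: measurableX.
  by rewrite product_measure1E// lte_mul_pinfty// ge0_fin_numE.
exists (fun k => rV_uncons @^-1` (F k)).
  by rewrite -preimage_bigcup -FT preimage_setT.
move=> k; split.
  by rewrite -[X in measurable X]setTI; apply: measurable_rV_uncons => //; exact: (Fm k).1.
rewrite /rV_lebesgue_step /P /pushforward -comp_preimage.
have -> : rV_uncons \o rV_cons = @id (R * 'rV[R]_n) by apply/funext => x; exact: rV_consK.
by rewrite preimage_id; exact: (Fm k).2.
Qed.
HB.instance Definition _ := @Measure_isSigmaFinite.Build _ _ _ rV_lebesgue_step step_sigma_finite.

End step.

(* [Leb_(n+1) = Leb_1 x Leb_n], transported along R * 'rV_n = 'rV_n.+1. *)
Fixpoint lebesgue_rV n : {sigma_finite_measure set 'rV[R]_n -> \bar R} :=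
  if n is n'.+1 then rV_lebesgue_step (lebesgue_rV n')
  else dirac (0 : 'rV[R]_0).

Definition unit_cube n : set 'rV[R]_n := [set x | forall i, 0 <= x 0 i < 1].

Lemma measurable_unit_cube n : measurable (@unit_cube n).
Proof.
rewrite (_ : @unit_cube n = \bigcap_(i in [set: 'I_n]) ((fun x : 'rV[R]_n => x 0 i) @^-1` `[0, 1[)).
  apply: fin_bigcap_measurable => // i _; rewrite -[X in measurable X]setTI.
  apply: continuous_measurable_mx => //; first by move=> x; exact: coord_continuous.
apply/seteqP; split => x /= h i.
  by move=> _ /=; rewrite in_itv/=; exact: h.
by have := h i Logic.I; rewrite /= in_itv.
Qed.

Lemma lebesgue_unit_cube n : lebesgue_rV n (@unit_cube n) = 1%E.
Proof.
elim: n => [|n IH] /=; first by rewrite diracE mem_set//= => -[].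
rewrite /rV_lebesgue_step /pushforward.
rewrite (_ : _ @^-1` _ = `[0, 1[%classic `*` @unit_cube n).
  rewrite product_measure1E//; last exact: measurable_unit_cube.
  rewrite [X in (X * _)%E](lebesgue_measure_itv `[0, 1[).
  by rewrite /= lte_fin ltr01 sube0 mul1e IH.
apply/seteqP; split => p /=.
  move=> h; split; first by have := h (@lshift 1 n 0);
    rewrite /rV_cons (@row_mxEl _ 1 1 n) !mxE eqxx in_itv.
  by move=> i; have := h (@rshift 1 n i); rewrite /rV_cons (@row_mxEr _ 1 1 n).
move=> [h1 h2] i; rewrite /rV_cons.
case: (@split_ordP 1 n i) => j ->.
  by rewrite !(@row_mxEl _ 1 1 n) !ord1 !mxE eqxx !mulr1n; rewrite in_itv in h1.
by rewrite !(@row_mxEr _ 1 1 n).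
Qed.
End lebesgue_rV.

Section torus.
Local Open Scope quotient_scope.
Context (R : realType) (d : nat).

Definition torus_rel : rel 'rV[R]_d :=
  fun x y => [forall i, x 0 i - y 0 i \is a Num.int].

Lemma torus_rel_equiv : equiv_class_of torus_rel.
Proof.
split=> [x|x y|y x z].
- by apply/forallP => i; rewrite subrr int_num0.
- by apply/forallP/forallP => h i; rewrite -opprB rpredN.
- move=> /forallP xy /forallP yz; apply/forallP => i.
  by rewrite -(subrK (y 0 i) (x 0 i)) -addrA rpredD.
Qed.

Canonical torus_equiv := EquivRelPack torus_rel_equiv.

Definition torus := quotient_topology {eq_quot torus_equiv}.

HB.instance Definition _ :=
  PointedTopological.copy torus (quotient_topology {eq_quot torus_equiv}).

Let G := @open torus.

HB.instance Definition _ := @isMeasurable.Build borel_display torus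
  <<s G >> (@sigma_algebra0 _ setT G) (@sigma_algebraC _ G)
  (@sigma_algebra_bigcup _ setT G).

Definition torus_pi (x : 'rV[R]_d) : torus :=
  \pi_(quotient_topology {eq_quot torus_equiv}) x.

Definition torus_repr (z : torus) : 'rV[R]_d :=
  repr (z : quotient_topology {eq_quot torus_equiv}).

Lemma measurable_torus_pi : measurable_fun setT torus_pi.
Proof.
apply: (@measurability _ _ _ _ _ _ (@open torus)) => //.
by move=> _ [U oU <-]; rewrite setTI; apply: open_measurable_mx.
Qed.

(* The Lebesgue measure [d xi] of the torus, seen on the unit cube. *)
Definition torus_lebesgue : set torus -> \bar R :=
  pushforward (mrestr (lebesgue_rV R d) (@measurable_unit_cube R d)) torus_pi.

Let M := measure_function_pushforward__canonical__measure_function_Measure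
  (mrestr (lebesgue_rV R d) (@measurable_unit_cube R d)) measurable_torus_pi.

Let torus_lebesgue0 : torus_lebesgue set0 = 0%E.
Proof. exact: (measure0 M). Qed.

Let torus_lebesgue_ge0 A : (0 <= torus_lebesgue A)%E.
Proof. exact: (measure_ge0 M). Qed.

Let torus_lebesgue_sigma_additive : semi_sigma_additive torus_lebesgue.
Proof. exact: (@measure_semi_sigma_additive _ _ _ M). Qed.

HB.instance Definition _ := isMeasure.Build _ _ _ torus_lebesgue
  torus_lebesgue0 torus_lebesgue_ge0 torus_lebesgue_sigma_additive.

Let torus_lebesgueT : torus_lebesgue setT = 1%E.
Proof.
rewrite /torus_lebesgue /pushforward /mrestr preimage_setT setTI.
exact: lebesgue_unit_cube.
Qed.

HB.instance Definition _ := Measure_isProbability.Build _ _ _ torus_lebesgue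
  torus_lebesgueT.

End torus.
Arguments torus_lebesgue R d _ : clear implicits.

Section vectors.
Context (R : realType).

Definition enorm m (z : 'rV[R]_m) : R := Num.sqrt (\sum_i z 0 i ^+ 2).

Definition unit_ball m : set 'rV[R]_m := [set z | enorm z < 1].

Definition unit_sphere m : set 'rV[R]_m := [set z | enorm z = 1].

Definition vintegral t (T : measurableType t) m
    (mu : {measure set T -> \bar R}) (D : set T) (f : T -> 'rV[R]_m) :
    'rV[R]_m :=
  \row_i \int[mu]_(x in D) f x 0 i.

(* Bounded E-valued measures, E = 'rV[R]_m, given by their components. *)
Definition vmeasure t (T : measurableType t) (m : nat) :=
  'I_m -> {charge set T -> \bar R}.

Definition vmeasure_val t (T : measurableType t) m (mu : vmeasure T m)
    (B : set T) : 'rV[R]_m :=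
  \row_i fine (mu i B).

Definition charge_integral t (T : measurableType t)
    (nu : {charge set T -> \bar R}) (f : T -> R) : R :=
  let nuPN := projT2 (cid (projT2 (cid (Hahn_decomposition nu)))) in
  \int[jordan_pos nuPN]_x f x - \int[jordan_neg nuPN]_x f x.

Definition vtotal_variation t (T : measurableType t) m
    (mu : set T -> 'rV[R]_m) (B : set T) : \bar R :=
  ereal_sup [set (\sum_(0 <= i <oo) (enorm (mu (F i)))%:E)%E
            | F in [set F : (set T)^nat | [/\ forall i, measurable (F i),
                      trivIset setT F & \bigcup_i F i = B]]].

End vectors.

Section distributions.
Context (R : realType) (d : nat).

Definition partial (W : normedModType R) (i : 'I_d) (f : 'rV[R]_d -> W) :
    'rV[R]_d -> W :=
  fun x => 'D_(delta_mx 0 i) f x.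

Definition partials (W : normedModType R) (s : seq 'I_d) (f : 'rV[R]_d -> W) :=
  foldr (@partial W) f s.

Definition smooth (W : normedModType R) (f : 'rV[R]_d -> W) :=
  forall s x, differentiable (partials s f) x.

(* Multi-indices with entries at most k, so that they form a finite type;
   it contains all the multi-indices of degree at most k. *)
Definition mindex (k : nat) := {ffun 'I_d -> 'I_k.+1}.

Definition mdegree k (a : mindex k) : nat := (\sum_i a i)%N.

Definition mpartial (W : normedModType R) k (a : mindex k) (f : 'rV[R]_d -> W) :
    'rV[R]_d -> W :=
  partials (flatten [seq nseq (a i) i | i <- enum 'I_d]) f.

Definition torus_smooth (phi : torus R d -> R) :=
  smooth (phi \o @torus_pi R d : 'rV[R]_d -> R^o).

Definition torus_mpartial k (a : mindex k) (phi : torus R d -> R) :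
    torus R d -> R :=
  fun xi => mpartial a (phi \o @torus_pi R d : 'rV[R]_d -> R^o) (torus_repr xi).

Definition test_function (W : normedModType R) (Omega : set 'rV[R]_d)
    (phi : 'rV[R]_d -> W) :=
  smooth phi /\
  exists K, [/\ compact K, K `<=` Omega & forall x, ~ K x -> phi x = 0].

(* An E-valued distribution is identified with the E-valued linear map it
   induces on scalar test functions. *)
Definition distribution_of t (T : measurableType t) m (mu : vmeasure R T m) :
    (T -> R) -> 'rV[R]_m :=
  fun phi => \row_i charge_integral (mu i) phi.

(* The coefficient [A a] of [d^a] acts on E = 'rV[R]_m by [z |-> z *m A a];
   only the coefficients with [mdegree a = k] are used. *)
Definition operator (m n k : nat) := mindex k -> 'M[R]_(m, n).

(* [(A T)(phi) = (-1)^k sum_(|a| = k) A_a T(d^a phi)], where [D a] is the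
   derivative [d^a] on the test functions over X. *)
Definition operator_distribution m n k (A : operator m n k) (X : Type)
    (D : mindex k -> (X -> R) -> X -> R) (T : (X -> R) -> 'rV[R]_m) :
    (X -> R) -> 'rV[R]_n :=
  fun phi => (-1) ^+ k *: \sum_(a | mdegree a == k) T (D a phi) *m A a.

Definition sobolev_norm n (k : nat) (q : R) (Omega : set 'rV[R]_d)
    (phi : 'rV[R]_d -> 'rV[R]_n) : R :=
  (\sum_(a : mindex k | (mdegree a <= k)%N)
     \int[lebesgue_rV R d]_(x in Omega) (enorm (mpartial a phi x) `^ q)) `^ q^-1.

(* The norm of [W^{-k,p}(Omega; F)], F = 'rV[R]_n, as the dual of
   [W_0^{k,p'}(Omega; F)], the closure of the test functions; p' = p / (p - 1). *)
Definition neg_sobolev_norm n (k : nat) (p : R) (Omega : set 'rV[R]_d)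
    (T : ('rV[R]_d -> R) -> 'rV[R]_n) : \bar R :=
  ereal_sup [set (`|\sum_j T (fun x => phi x 0 j) 0 j|)%:E
            | phi in [set phi : 'rV[R]_d -> 'rV[R]_n | test_function Omega phi
                       /\ sobolev_norm k (p / (p - 1)) Omega phi <= 1]].

End distributions.

Section young_measures.
Context (R : realType) (d m : nat).
Local Notation Rd := 'rV[R]_d.
Local Notation Z := (torus R d).
Local Notation E := 'rV[R]_m.
Local Notation Leb := (lebesgue_rV R d).

(* The maps are total; only their values over the closure of Omega matter. *)
Record young_data := YoungData {
  y_nu : Rd -> Z -> probability E R ;
  y_lambda : {finite_measure set Rd -> \bar R} ;
  y_rho : Rd -> probability Z R ;
  y_nuinf : Rd -> Z -> probability E R }.

(* Measurability on D with respect to the completion of mu. *)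
Definition ae_measurable t (T : measurableType t) (mu : set T -> \bar R)
    (D : set T) (f : T -> R) :=
  exists2 g, measurable_fun D g & {ae mu, forall x, D x -> f x = g x}.

Definition C0 (T : topologicalType) (S : set T) (h : T -> R) :=
  {within S, continuous h} /\
  forall e, 0 < e -> exists K,
    [/\ compact K, K `<=` S & forall x, S x -> ~ K x -> `|h x| < e].

(* Weak-* measurability of a map into Prob(S), tested against C = C_0(S). *)
Definition weakstar_measurable t t' (T : measurableType t)
    (T' : measurableType t') (mu : set T -> \bar R) (D : set T) (S : set T')
    (C : set (T' -> R)) (kappa : T -> probability T' R) :=
  forall h, C h -> ae_measurable mu D (fun x => \int[kappa x]_(z in S) h z).

(* lambda (x) rho_x *)
Definition semiproduct (lambda : {finite_measure set Rd -> \bar R})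
    (rho : Rd -> probability Z R) (B : set (Rd * Z)) : \bar R :=
  (\int[lambda]_x rho x (xsection B x))%E.

Definition two_scale_young (Omega : set Rd) (nu : young_data) :=
  let D := closure Omega `*` [set: Z] in
  let LZ := (Leb \x torus_lebesgue R d)%E in
  [/\ weakstar_measurable LZ D setT (C0 [set: E])
        (fun q => y_nu nu q.1 q.2)
      /\ (\int[LZ]_(q in D) \int[y_nu nu q.1 q.2]_z (enorm z)%:E < +oo)%E,
      y_lambda nu (~` closure Omega) = 0%E,
      weakstar_measurable (y_lambda nu) (closure Omega) setT (C0 [set: Z])
        (y_rho nu),
      (forall x xi, closure Omega x -> y_nuinf nu x xi (@unit_sphere R m) = 1%E)
    & weakstar_measurable (semiproduct (y_lambda nu) (y_rho nu)) D
        (@unit_sphere R m) (C0 (@unit_sphere R m))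
        (fun q => y_nuinf nu q.1 q.2)].

Definition Ttransform (f : Rd * Z * E -> R) (q : Rd * Z * E) : R :=
  (1 - enorm q.2) * f (q.1, (1 - enorm q.2)^-1 *: q.2).

Definition E2 (Omega : set Rd) (f : Rd * Z * E -> R) :=
  {within Omega `*` setT `*` setT, continuous f} /\
  exists2 g : Rd * Z * E -> R,
    {within closure (Omega `*` setT `*` @unit_ball R m), continuous g}
    & {in Omega `*` setT `*` @unit_ball R m, g =1 Ttransform f}.

Definition recession (Omega : set Rd) (f : Rd * Z * E -> R)
    (x : Rd) (xi : Z) (z : E) : R :=
  lim ((fun q : Rd * Z * R => f (q.1.1, q.1.2, q.2 *: z) / q.2) @
    filter_prod (filter_prod (within Omega (nbhs x)) (nbhs xi)) (pinfty_nbhs R)).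

(* [mu = g Leb + h sigma] is the Lebesgue-polar decomposition: [g = mu^ac],
   [sigma = |mu^s|] and [h = mu_s]. *)
Definition lebesgue_polar (mu : vmeasure R Rd m) (g : Rd -> E)
    (sigma : {finite_measure set Rd -> \bar R}) (h : Rd -> E) :=
  [/\ measurable_fun setT g /\
        Leb.-integrable setT (fun x => (enorm (g x))%:E),
      measurable_fun setT h /\ {ae sigma, forall x, enorm (h x) = 1},
      exists N, [/\ measurable N, Leb N = 0%E & sigma (~` N) = 0%E],
      (forall B, measurable B ->
        vmeasure_val mu B = vintegral Leb B g + vintegral sigma B h)
    & (forall B, measurable B -> sigma B =
        vtotal_variation (fun C => vmeasure_val mu C - vintegral Leb C g) B)].

Definition generates (Omega : set Rd) (eps : nat -> R)
    (mu : nat -> vmeasure R Rd m) (nu : young_data) :=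
  exists (g : nat -> Rd -> E) (sigma : nat -> {finite_measure set Rd -> \bar R})
    (h : nat -> Rd -> E),
    (forall j, lebesgue_polar (mu j) (g j) (sigma j) (h j)) /\
    forall f, E2 Omega f ->
      (fun j =>
        \int[Leb]_(x in Omega) f (x, torus_pi ((eps j)^-1 *: x), g j x) +
        \int[sigma j]_(x in Omega)
          recession Omega f x (torus_pi ((eps j)^-1 *: x)) (h j x)) @ \oo -->
      \int[Leb]_(x in Omega) (\int[torus_lebesgue R d]_xi
        (\int[y_nu nu x xi]_z f (x, xi, z))) +
      \int[y_lambda nu]_(x in closure Omega) (\int[y_rho nu x]_xi
        (\int[y_nuinf nu x xi]_(z in @unit_sphere R m)
          recession Omega f x xi z)).

(* Elements of M(Omega; E) are the E-valued measures on R^d carried by Omega. *)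
Definition carried_by (Omega : set Rd) (mu : vmeasure R Rd m) :=
  forall i B, measurable B -> B `&` Omega = set0 -> mu i B = 0%E.

Definition A_free n k (A : operator R d m n k) (p : R) (Omega : set Rd)
    (nu : young_data) :=
  exists (eps : nat -> R) (mu : nat -> vmeasure R Rd m),
    [/\ [/\ forall j, 0 < eps j, nonincreasing_seq eps & eps @ \oo --> 0],
        forall j, carried_by Omega (mu j),
        generates Omega eps mu nu
      & (fun j => neg_sobolev_norm k p Omega (operator_distribution A
           (fun a (phi : Rd -> R) => mpartial a (phi : Rd -> R^o))
           (distribution_of (mu j)))) @ \oo --> 0%E].

Definition reg_sing_decomposition (Omega : set Rd)
    (lambda : {finite_measure set Rd -> \bar R}) (lac : Rd -> R)
    (lams : {finite_measure set Rd -> \bar R}) (Reg Sing : set Rd) :=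
  [/\ Leb.-integrable setT (EFin \o lac) /\ {ae Leb, forall x, 0 <= lac x},
      (forall B, measurable B ->
        lambda B = (\int[Leb]_(x in B) (lac x)%:E + lams B)%E),
      measurable Reg /\ measurable Sing,
      Reg `|` Sing = closure Omega /\ Reg `&` Sing = set0
    & Leb Sing = 0%E /\ lams Reg = 0%E].

(* For x in the closure of Omega, [x \notin Reg] means [x \in Sing]. *)
Definition barycenter (nu : young_data) (lac : Rd -> R) (Reg : set Rd)
    (x : Rd) (V : set Z) : E :=
  let conc := vintegral (y_rho nu x) V
    (fun xi => vintegral (y_nuinf nu x xi) (@unit_sphere R m) id) in
  if x \in Reg then
    vintegral (torus_lebesgue R d) V (fun xi => vintegral (y_nu nu x xi) setT id)
    + lac x *: conc
  else conc.

End young_measures.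

(* Main.v *)
Require Import Defs.
From HB Require Import structures.
From mathcomp Require Import all_boot all_order all_algebra.
From mathcomp Require Import all_classical all_reals all_analysis.
From mathcomp Require Import finmap measurable_realfun ring lra.

Set Implicit Arguments.
Unset Strict Implicit.
Unset Printing Implicit Defensive.

Import Order.TTheory GRing.Theory Num.Theory.
Import numFieldNormedType.Exports.

Local Open Scope classical_set_scope.
Local Open Scope ring_scope.

(**
Test the W^{-k,p}-smallness of A mu_eps against eps^k psi(x) phi(x/eps), with
psi a test function on Omega and phi smooth on the torus. These functions are
bounded in W_0^{k,p'}, uniformly in eps. By the Leibniz rule d^a of such a
function is psi(x) (d^a phi)(x/eps) plus terms with a positive power of eps,
whose pairings with the bounded measures mu_eps vanish in the limit. Generation
then gives, for every psi and phi,
  sum_(|a| = k) A_a (int psi <d^a phi, nu> dx + int psi <d^a phi, nu^inf> d lambda) = 0.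
Smooth bumps increasing to indicators of boxes localise this in x: the integrand
vanishes Lebesgue-a.e. on Reg and lams-a.e. on Sing. The exceptional set is made
independent of phi by letting phi run through a sequence that is dense for the
uniform convergence of all derivatives of order at most k. Since the Young
measure is only weak-* measurable for completed measures, its moments and rho
are first replaced by Borel versions.
*)

(** Two obstacles shape the proof. The integral used here is defined for every integrand, and weak-*
    measurability only speaks of completed measures; so the integrals over nu, rho and nu^inf in the
    hypotheses may have non-Borel integrands, and [semiproduct lambda rho] is not known to be
    additive. Each of these integrals is rewritten, through null sets, with Borel moments and a
    Borel kernel before Fubini, dominated convergence or additivity is applied. Moreover, what holds
    lambda-almost everywhere holds Lebesgue-almost everywhere only where lac is nonzero; on the rest
    of Reg the concentration part of the barycenter carries the factor lac = 0, so nothing has to be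
    known about it there. The factor eps^k compensates the k factors 1/eps of the chain rule. The
    remainders vanish because each is a positive power of eps times a pairing that converges by
    generation; this is the form in which the boundedness of mu_eps enters. *)

(** * Integrals and null sets, without measurability *)

Section ae_integral.
Context d (T : measurableType d) (R : realType).
Context (mu : {measure set T -> \bar R}).
Import HBNNSimple.

Let nnintegral (f : T -> \bar R) := ereal_sup [set sintegral mu h |
  h in [set h : {nnsfun T >-> R} | forall x, ((h x)%:E <= f x)%E]].

(** A simple function below f, multiplied by the indicator of the complement of N, keeps its
    integral and lies below g everywhere. *)
Let nnintegral_ae_le (f g : T -> \bar R) (N : set T) :
  measurable N -> mu N = 0%E -> (forall x, (0 <= g x)%E) ->
  (forall x, ~ N x -> (f x <= g x)%E) -> (nnintegral f <= nnintegral g)%E.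
Proof.
move=> mN N0 g0 fg; apply: ge_ereal_sup => _ [h /= hf <-].
apply: ereal_sup_ubound; exists (proj_nnsfun h (measurableC mN)) => /=.
  move=> x; rewrite mindicE; have [xN|xN] := pselect (N x).
    by rewrite memNset ?mulr0//= => /(_ xN).
  by rewrite mem_set// mulr1; apply: le_trans (hf x) (fg _ xN).
rewrite -!integralT_nnsfun; apply: ae_eq_integral => //.
- by apply/measurable_EFinP; exact: measurable_funPT.
- by apply/measurable_EFinP; exact: measurable_funPT.
- exists N; split => // x /= /not_implyP[_]; apply: contra_notP => xN.
  by rewrite mindicE mem_set// mulr1.
Qed.

(* No measurability is needed: the integral of the library is a supremum over
   the simple functions below the positive and negative parts. *)
Lemma ae_eq_integral_nonmeasurable (D : set T) (f g : T -> \bar R) :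
  {ae mu, forall x, D x -> f x = g x} ->
  (\int[mu]_(x in D) f x = \int[mu]_(x in D) g x)%E.
Proof.
move=> [N [mN N0 fgN]].
have fg x : ~ N x -> (f \_ D) x = (g \_ D) x.
  move=> Nx; rewrite !patchE; case: ifPn => // /set_mem Dx.
  by apply: contra_notP Nx => fgx; apply: fgN => /= /(_ Dx).
have E h1 h2 : (forall x, 0 <= h1 x)%E -> (forall x, 0 <= h2 x)%E ->
    (forall x, ~ N x -> h1 x = h2 x) -> nnintegral h1 = nnintegral h2.
  move=> h10 h20 h12; apply/eqP; rewrite eq_le; apply/andP; split;
  by apply: (nnintegral_ae_le mN) => // x Nx; rewrite h12.
rewrite /integral; congr (_ - _)%E; apply: E => // x Nx.
  by rewrite !funeposE fg.
by rewrite !funenegE fg.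
Qed.

Lemma ae_eq_Rintegral (D : set T) (f g : T -> R) :
  {ae mu, forall x, D x -> f x = g x} ->
  \int[mu]_(x in D) f x = \int[mu]_(x in D) g x.
Proof.
move=> [N [mN N0 fgN]]; congr fine; apply: ae_eq_integral_nonmeasurable.
exists N; split => // x /= h; apply: fgN => /= h'; apply: h => Dx.
by rewrite h'.
Qed.

End ae_integral.

Lemma cvg_sumr (R : realType) (I : Type) (s : seq I) (P : pred I) (u : I -> nat -> R) (l : I -> R) :
  (forall i, u i n @[n --> \oo] --> l i) ->
  \sum_(i <- s | P i) u i n @[n --> \oo] --> \sum_(i <- s | P i) l i.
Proof.
move=> ul; apply: cvg_big => // x; exact: add_continuous.
Qed.

(** * Bounded functions integrated against signed measures with densities *)

Section bounded_test.
Context d (T : measurableType d) (R : realType).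
Import HBNNSimple.

Lemma integrable_bounded_mul (mu : {measure set T -> \bar R}) (f g : T -> R) (C : R) :
  measurable_fun setT f -> (forall x, `|f x| <= C) ->
  mu.-integrable setT (EFin \o g) ->
  mu.-integrable setT (EFin \o (fun x => f x * g x)).
Proof.
move=> mf fC ig.
have mg : measurable_fun setT g by apply/measurable_EFinP; exact: measurable_int ig.
apply: (@le_integrable _ _ _ mu setT measurableT _ (fun x => `|C|%:E * (EFin \o g) x)%E).
- by apply/measurable_EFinP; exact: measurable_funM.
- move=> x _; rewrite /= lee_fin !normrM normr_id.
  by apply: ler_wpM2r => //; apply: le_trans (fC x) (ler_norm _).
- exact: integrableZl.
Qed.

Lemma bounded_integrable (mu : {finite_measure set T -> \bar R}) (f : T -> R) (C : R) :
  measurable_fun setT f -> (forall x, `|f x| <= C) ->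
  mu.-integrable setT (EFin \o f).
Proof.
move=> mf fC.
have /= := @integrable_bounded_mul mu f (cst 1) C mf fC (finite_measure_integrable_cst mu 1 measurableT).
by apply: eq_integrable => // x _ /=; rewrite mulr1.
Qed.

Lemma cvg_Rintegral_dominated (mu : {measure set T -> \bar R}) (f_ : nat -> T -> R)
    (f g : T -> R) :
  (forall n, measurable_fun setT (f_ n)) ->
  (forall x, f_ ^~ x @ \oo --> f x) -> mu.-integrable setT (EFin \o g) ->
  (forall n x, `|f_ n x| <= g x) ->
  \int[mu]_x f_ n x @[n --> \oo] --> \int[mu]_x f x.
Proof.
move=> mf_ cf ig fg.
have mf : measurable_fun setT f by apply: (@measurable_fun_cvg _ _ _ _ f_) => // x _; exact: cf.
have [//| | | | |i1 _ h] := @dominated_convergence _ _ _ mu setT measurableT (fun n x => (f_ n x)%:E)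
   (EFin \o f) (EFin \o g).
- by move=> n; exact/measurable_EFinP.
- exact/measurable_EFinP.
- by apply: aeW => x _; apply/fine_cvgP; split; [exact: nearW|exact: cf].
- by [].
- by apply: aeW => x n _; rewrite lee_fin.
by apply: fine_cvg; rewrite fineK//; exact: integrable_fin_num.
Qed.

Lemma Rintegral_sum (mu : {measure set T -> \bar R}) (I : Type) (s : seq I)
    (f : I -> T -> R) : (forall i, mu.-integrable setT (EFin \o f i)) ->
  \int[mu]_x (\sum_(i <- s) f i x) = \sum_(i <- s) \int[mu]_x f i x.
Proof.
move=> fi; elim: s => [|i s IH].
  rewrite big_nil; under eq_Rintegral do rewrite big_nil.
  by rewrite Rintegral_cst// mul0r.
rewrite big_cons -IH -RintegralD//.
  by under eq_Rintegral do rewrite big_cons.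
have h := integrable_sum measurableT s (fun i _ => fi i).
move: (h predT); apply: eq_integrable => // x _.
by rewrite /= sumEFin.
Qed.

(** An equality of signed measures is phrased as the vanishing of a finite combination, so that no
    difference of measures has to be formed. It passes from indicators to simple functions, then to
    bounded nonnegative functions by monotone approximation and dominated convergence, and to all
    bounded functions by a shift. *)
Lemma sum_integral_bounded_eq0 (I : finType) (mu : I -> {measure set T -> \bar R})
    (g : I -> T -> R) (f : T -> R) (C : R) :
  (forall i, (mu i).-integrable setT (EFin \o g i)) ->
  (forall B, measurable B -> \sum_i \int[mu i]_(x in B) g i x = 0) ->
  measurable_fun setT f -> (forall x, `|f x| <= C) ->
  \sum_i \int[mu i]_x (f x * g i x) = 0.
Proof.
move=> ig gB mf fC.
have simple (h : {nnsfun T >-> R}) : \sum_i \int[mu i]_x (h x * g i x) = 0.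
  pose s := fset_set (range h).
  pose u y i x := y * (g i \_ (h @^-1` [set y])) x.
  have mhy y : measurable (h @^-1` [set y]) by rewrite -[X in measurable X]setTI; exact: measurable_funPT.
  have hE i x : h x * g i x = \sum_(y <- s) u y i x.
    rewrite (bigD1_seq (h x))/= ?fset_uniq//; last first.
      by rewrite in_fset_set//; apply/mem_set; exists x.
    rewrite /u patchE mem_set//= big1 ?addr0// => y yx.
    by rewrite patchE memNset ?mulr0//= => /eqP; rewrite eq_sym (negbTE yx).
  have iu y i : (mu i).-integrable setT (EFin \o (g i \_ (h @^-1` [set y]))).
    have := integrableS measurableT (mhy y) (@subsetT _ _) (ig i).
    rewrite (integrable_mkcond _ (mhy y)).
    by apply: eq_integrable => // x _; rewrite restrict_EFin.
  transitivity (\sum_(y <- s) \sum_i \int[mu i]_x u y i x).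
    rewrite exchange_big/=; apply: eq_bigr => i _.
    rewrite -Rintegral_sum; first by under eq_Rintegral do rewrite hE.
    move=> y; have := integrableZl measurableT y (iu y i).
    exact: eq_integrable.
  apply: big1 => y _.
  under eq_bigr do rewrite RintegralZl//.
  by rewrite -mulr_sumr; under eq_bigr do rewrite -Rintegral_mkcond; rewrite gB// mulr0.
have nonneg (h : T -> R) D : measurable_fun setT h -> (forall x, 0 <= h x <= D) ->
    \sum_i \int[mu i]_x (h x * g i x) = 0.
  move=> mh h0D.
  have meh : measurable_fun setT (EFin \o h) by exact/measurable_EFinP.
  pose h_ := nnsfun_approx measurableT meh.
  have ndh : nondecreasing_seq (h_ : (T -> R)^nat) by exact: nd_nnsfun_approx.
  have ch x : h_ ^~ x @ \oo --> h x.
    have h0 y : setT y -> (0 <= (EFin \o h) y)%E.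
      by move=> _; rewrite lee_fin; have /andP[] := h0D y.
    exact: fine_cvg (cvg_nnsfun_approx measurableT meh h0 (Logic.I : setT x)).
  have hD n0 x : `|h_ n0 x| <= D.
    rewrite ger0_norm//; apply: le_trans (proj2 (andP (h0D x))).
    have <- := cvg_lim (@Rhausdorff R) (ch x).
    apply: nondecreasing_cvgn_le; last by apply/cvg_ex; eexists; exact: ch.
    by move=> a b ab; have /asboolP := ndh _ _ ab; apply.
  suff : \sum_i \int[mu i]_x (h_ n0 x * g i x) @[n0 --> \oo] -->
      \sum_i \int[mu i]_x (h x * g i x).
    under eq_fun do rewrite simple.
    by move=> /(cvg_lim (@Rhausdorff R)) <-; rewrite lim_cst.
  apply: cvg_sumr => i.
  have mg : measurable_fun setT (g i) by apply/measurable_EFinP; exact: measurable_int (ig i).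
  apply: (@cvg_Rintegral_dominated _ _ _ (fun x => D * `|g i x|)).
  - by move=> n0; exact: measurable_funM.
  - by move=> x; apply: cvgMl.
  - apply: (@integrable_bounded_mul _ (cst D) (fun x => `|g i x|) `|D|) => //.
    exact: (integrable_abse (ig i)).
  - by move=> n0 x; rewrite normrM ler_wpM2r.
have icst i : (mu i).-integrable setT (EFin \o (fun x => C * g i x)).
  exact: (@integrable_bounded_mul _ (cst C) _ `|C|).
have ifg i := integrable_bounded_mul mf fC (ig i).
(* The shift by C makes f nonnegative and at most 2C; the term it adds vanishes by the hypothesis at
   [B = setT]. *)
have := nonneg (fun x => f x + C) (C + C) _ _.
under eq_bigr do under eq_Rintegral do rewrite mulrDl.
under eq_bigr do rewrite RintegralD// RintegralZl//.
rewrite big_split/= -mulr_sumr gB// mulr0 addr0; apply.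
  by apply: measurable_funD.
by move=> x; have := fC x; rewrite ler_norml => /andP[h1 h2]; apply/andP; split; lra.
Qed.


(** The Jordan parts of [nu] come from a chosen Hahn decomposition, and only their difference is
    known. Together with [mu1] and [mu2] they form a vanishing family of four measures with
    densities 1, -1, -g1, -g2. *)
Lemma charge_integralE (nu : {charge set T -> \bar R})
    (mu1 mu2 : {measure set T -> \bar R}) (g1 g2 f : T -> R) (C : R) :
  mu1.-integrable setT (EFin \o g1) -> mu2.-integrable setT (EFin \o g2) ->
  (forall B, measurable B ->
    fine (nu B) = \int[mu1]_(x in B) g1 x + \int[mu2]_(x in B) g2 x) ->
  measurable_fun setT f -> (forall x, `|f x| <= C) ->
  charge_integral nu f = \int[mu1]_x (f x * g1 x) + \int[mu2]_x (f x * g2 x).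
Proof.
move=> i1 i2 nuE mf fC; rewrite /charge_integral.
pose nuPN := projT2 (cid (projT2 (cid (Hahn_decomposition nu)))); rewrite -/nuPN.
pose mu (i : 'I_4) : {measure set T -> \bar R} := match val i with
  0 => jordan_pos nuPN | 1 => jordan_neg nuPN | 2 => mu1 | _ => mu2 end.
pose g (i : 'I_4) : T -> R := match val i with
  0 => cst 1 | 1 => cst (-1) | 2 => \- g1 | _ => \- g2 end.
have ig i : (mu i).-integrable setT (EFin \o g i).
  case: i => -[|[|[|[|//]]]] i4; rewrite /mu /g /=.
  - exact: finite_measure_integrable_cst.
  - exact: finite_measure_integrable_cst.
  - exact: (integrableN i1).
  - exact: (integrableN i2).
have iN h (m : {measure set T -> \bar R}) (u : T -> R) B : measurable B ->
    m.-integrable setT (EFin \o (fun x => u x * h x)) ->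
    \int[m]_(x in B) (u x * - h x) = - \int[m]_(x in B) (u x * h x).
  move=> mB ih; rewrite -mulN1r -RintegralZl//; last exact: integrableS ih.
  by apply: eq_Rintegral => x _; rewrite mulN1r mulrN.
have gB B : measurable B -> \sum_i \int[mu i]_(x in B) g i x = 0.
  move=> mB; rewrite !big_ord_recl big_ord0 /mu /g /= addr0.
  rewrite !Rintegral_cst//.
  have h1 (m : {measure set T -> \bar R}) h : m.-integrable setT (EFin \o h) ->
      \int[m]_(x in B) (- h x) = - \int[m]_(x in B) h x.
    move=> ih; rewrite -mulN1r -RintegralZl//; last exact: integrableS ih.
    by apply: eq_Rintegral => x _; rewrite mulN1r.
  rewrite !h1// mul1r mulN1r; apply/eqP; rewrite !addrA -addrA -opprD -nuE// subr_eq0.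
  rewrite (jordan_decomp nuPN mB) /cadd/= cscaleN1 fineB//; exact: fin_num_measure.
have := @sum_integral_bounded_eq0 _ mu g f C ig gB mf fC.
rewrite !big_ord_recl big_ord0 /mu /g /= !addr0.
have E (m : {measure set T -> \bar R}) : \int[m]_x (f x * 1) = \int[m]_x f x.
  by apply: eq_Rintegral => x _; rewrite mulr1.
have e1 := iN g1 mu1 f setT measurableT (integrable_bounded_mul mf fC i1).
have e2 := iN g2 mu2 f setT measurableT (integrable_bounded_mul mf fC i2).
have e3 := iN (cst 1) (jordan_neg nuPN) f setT measurableT
  (integrable_bounded_mul mf fC (finite_measure_integrable_cst (jordan_neg nuPN) 1 measurableT)).
rewrite /= in e3; rewrite e1 e2 e3 !E => h.
by apply/eqP; rewrite -subr_eq0 opprD -h !addrA.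
Qed.

End bounded_test.

(** * Calculus of smooth functions *)

Section smooth_calculus.
Context (R : realType) (d : nat).
Local Notation Rd := 'rV[R]_d.

Lemma partials_rcons (W : normedModType R) (s : seq 'I_d) i (f : Rd -> W) :
  partials (rcons s i) f = partials s (partial i f).
Proof. by rewrite /partials foldr_rcons. Qed.

Lemma smooth_differentiable (W : normedModType R) (f : Rd -> W) :
  smooth f -> forall x, differentiable f x.
Proof. by move=> sf x; exact: (sf [::]). Qed.

Lemma smooth_continuous (W : normedModType R) (f : Rd -> W) : smooth f -> continuous f.
Proof. by move=> sf x; exact/differentiable_continuous/smooth_differentiable. Qed.

Lemma smooth_partials (W : normedModType R) (f : Rd -> W) s :
  smooth f -> smooth (partials s f).
Proof. by move=> sf t x; rewrite /partials -foldr_cat; exact: sf. Qed.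

Lemma smooth_partial (W : normedModType R) (f : Rd -> W) i :
  smooth f -> smooth (partial i f).
Proof. exact: (@smooth_partials _ _ [:: i]). Qed.

(** Derivatives are peeled off from the innermost one, so stability under a single partial
    derivative suffices. Constants, products, dilations and flat functions are shown smooth by
    exhibiting such a class. *)
Lemma smooth_coind (W : normedModType R) (P : (Rd -> W) -> Prop) :
  (forall f, P f -> (forall x, differentiable f x) /\ forall i, P (partial i f)) ->
  forall f, P f -> smooth f.
Proof.
move=> Pstep f Pf s; elim/last_ind: s f Pf => [|s i IH] f Pf x.
  by have [/(_ x)] := Pstep _ Pf.
by rewrite partials_rcons; apply: IH; have [_] := Pstep _ Pf.
Qed.

Lemma partial_cst (W : normedModType R) i (c : W) : partial i (cst c : Rd -> W) = cst 0.
Proof. by apply/funext => x; rewrite /partial derive_cst. Qed.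

Lemma smooth_cst (W : normedModType R) (c : W) : smooth (cst c : Rd -> W).
Proof.
apply: (@smooth_coind W (fun f => exists c, f = cst c)); last by exists c.
move=> _ [c' ->]; split => [x|i]; first exact: differentiable_cst.
by exists 0; rewrite partial_cst.
Qed.

Lemma partialD i (f g : Rd -> R^o) : (forall x, differentiable f x) ->
  (forall x, differentiable g x) ->
  partial i (fun x => f x + g x : R^o) = (fun x => partial i f x + partial i g x).
Proof.
by move=> df dg; apply/funext => x; rewrite /partial -deriveD//; exact: diff_derivable.
Qed.

Lemma partialM i (f g : Rd -> R^o) : (forall x, differentiable f x) ->
  (forall x, differentiable g x) ->
  partial i (fun x => f x * g x : R^o) =
  (fun x => partial i f x * g x + f x * partial i g x).
Proof.
move=> df dg; apply/funext => x; rewrite /partial.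
rewrite (_ : (fun x => f x * g x) = f * g)//.
rewrite deriveM; [|exact: diff_derivable..].
by rewrite /GRing.scale/= addrC mulrC; congr (_ + _); rewrite mulrC.
Qed.

(** Products are not stable under [partial], but finite sums of products are: this is the class that
    [smooth_coind] needs. *)
Let pairs_fun (s : seq ((Rd -> R^o) * (Rd -> R^o))) : Rd -> R^o :=
  fun x => \sum_(p <- s) p.1 x * p.2 x.

Let pairs_sm (s : seq ((Rd -> R^o) * (Rd -> R^o))) :=
  forall j, (j < size s)%N -> smooth (nth (cst 0, cst 0) s j).1 /\
     smooth (nth (cst 0, cst 0) s j).2.

Let smooth_pairs s : pairs_sm s -> smooth (pairs_fun s).
Proof.
move=> ss; apply: (@smooth_coind _ (fun f => exists2 s, pairs_sm s & f = pairs_fun s)); last by exists s.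
move=> _ {ss} [{}s ss ->].
elim: s ss => [|p s IH] ss.
  have -> : pairs_fun [::] = cst 0 by apply/funext => x; rewrite /pairs_fun big_nil.
  split => [x|i]; first exact: differentiable_cst.
  by exists [::] => //; apply/funext => x; rewrite partial_cst /pairs_fun big_nil.
have [sp1 sp2] := ss 0%N isT.
have [|dtl ptl] := IH; first by move=> j js; have := ss j.+1; apply.
have -> : pairs_fun (p :: s) = fun x => p.1 x * p.2 x + pairs_fun s x.
  by apply/funext => x; rewrite /pairs_fun big_cons.
have dp x : differentiable (fun x => p.1 x * p.2 x : R^o) x.
  apply: (@differentiableM _ _ p.1 p.2); exact: smooth_differentiable.
split => [x|i]; first exact: (@differentiableD _ _ _ (fun x => p.1 x * p.2 x : R^o)).
rewrite partialD//.
have [t st ->] := ptl i; rewrite partialM; [|exact: smooth_differentiable..].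
exists [:: (partial i p.1, p.2), (p.1, partial i p.2) & t].
  case=> [|[|j]] js /=; [split => //; exact: smooth_partial..|].
  by apply: st.
by apply/funext => x; rewrite /pairs_fun !big_cons addrA.
Qed.

Lemma smoothM (f g : Rd -> R^o) : smooth f -> smooth g ->
  smooth (fun x => f x * g x : R^o).
Proof.
move=> sf sg; have -> : (fun x => f x * g x : R^o) = pairs_fun [:: (f, g)].
  by apply/funext => x; rewrite /pairs_fun big_seq1.
by apply: smooth_pairs => -[].
Qed.

Lemma smoothZ c (f : Rd -> R^o) : smooth f -> smooth (fun x => c * f x : R^o).
Proof. by move=> sf; apply: smoothM => //; exact: smooth_cst. Qed.

Lemma smoothD (f g : Rd -> R^o) : smooth f -> smooth g ->
  smooth (fun x => f x + g x : R^o).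
Proof.
move=> sf sg; have -> : (fun x => f x + g x : R^o) = pairs_fun [:: (f, cst 1); (g, cst 1)].
  by apply/funext => x; rewrite /pairs_fun big_cons big_seq1 /= !mulr1.
by apply: smooth_pairs => -[|[]]//= _; split => //; exact: smooth_cst.
Qed.

Lemma smooth_prod (I : Type) (s : seq I) (f : I -> Rd -> R^o) :
  (forall i, smooth (f i)) -> smooth (fun x => \prod_(i <- s) f i x : R^o).
Proof.
move=> sf; elim: s => [|i s IH].
  by have := @smooth_cst R^o 1; congr smooth; apply/funext => x; rewrite big_nil.
by have := smoothM (sf i) IH; congr smooth; apply/funext => x; rewrite big_cons.
Qed.

Lemma partialZ i c (f : Rd -> R^o) : (forall x, differentiable f x) ->
  partial i (fun x => c * f x : R^o) = (fun x => c * partial i f x).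
Proof.
move=> df; have := @partialM i (cst c) f (fun x => differentiable_cst _ _) df.
move=> /= ->; apply/funext => x.
by rewrite partial_cst /= mul0r add0r.
Qed.

Lemma partialsZ s c (f : Rd -> R^o) : smooth f ->
  partials s (fun x => c * f x : R^o) = (fun x => c * partials s f x).
Proof.
elim/last_ind: s f => [//|s i IH] f sf.
rewrite !partials_rcons partialZ; last exact: smooth_differentiable.
by rewrite IH//; exact: smooth_partial.
Qed.

Lemma partial_scale i c (f : Rd -> R^o) : (forall x, differentiable f x) ->
  partial i (fun x => f (c *: x)) = (fun x => c * partial i f (c *: x)).
Proof.
move=> df; apply/funext => x; rewrite /partial.
have dc : differentiable ( *:%R c : Rd -> Rd) x by [].
rewrite (_ : (fun x => f (c *: x)) = f \o ( *:%R c))// deriveE; last exact: differentiable_comp.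
rewrite diff_comp//= (@diff_val _ _ _ _ _ ( *:%R c)).
by rewrite linearZ/= deriveE.
Qed.

Lemma differentiable_scale c (f : Rd -> R^o) : (forall x, differentiable f x) ->
  forall x, differentiable (fun x => f (c *: x)) x.
Proof.
move=> df x; rewrite (_ : (fun x => f (c *: x)) = f \o ( *:%R c))//.
exact: differentiable_comp.
Qed.

Lemma smooth_scale c (f : Rd -> R^o) : smooth f -> smooth (fun x => f (c *: x)).
Proof.
move=> sf; apply: (@smooth_coind _ (fun g => exists a (f : Rd -> R^o), smooth f /\ g = fun x => a * f (c *: x) : R^o)).
  move=> _ [a [g [sg ->]]].
  have dg x : differentiable (fun x => g (c *: x)) x.
    by apply: differentiable_scale; exact: smooth_differentiable.
  split => [x|i].
    by apply: (@differentiableM _ _ (cst a)) => //; exact: differentiable_cst.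
  exists (a * c), (partial i g); split; first exact: smooth_partial.
  rewrite partialZ// partial_scale; last exact: smooth_differentiable.
  by apply/funext => x; rewrite mulrA.
by exists 1, f; split => //; apply/funext => x; rewrite mul1r.
Qed.

Lemma partial_vec n i (f : Rd -> R^o) (v : 'rV[R]_n) : (forall x, differentiable f x) ->
  partial i (fun x => f x *: v) = (fun x => partial i f x *: v).
Proof.
move=> df; apply/funext => x; rewrite /partial deriveE; last exact: differentiableZl.
by rewrite diffZl// deriveE.
Qed.

Lemma partials_vec n s (f : Rd -> R^o) (v : 'rV[R]_n) : smooth f ->
  partials s (fun x => f x *: v) = (fun x => partials s f x *: v).
Proof.
elim/last_ind: s f => [//|s i IH] f sf.
rewrite !partials_rcons partial_vec; last exact: smooth_differentiable.
by rewrite IH//; exact: smooth_partial.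
Qed.

Lemma smooth_vec n (f : Rd -> R^o) (v : 'rV[R]_n) : smooth f -> smooth (fun x => f x *: v).
Proof.
move=> sf s x; rewrite partials_vec//; apply: differentiableZl.
exact: smooth_differentiable (smooth_partials _ sf) _.
Qed.

Lemma partial_eq0 i (f : Rd -> R^o) (K : set Rd) : closed K ->
  (forall x, ~ K x -> f x = 0) -> forall x, ~ K x -> partial i f x = 0.
Proof.
move=> cK f0 x Kx; rewrite /partial.
rewrite (@near_eq_derive _ _ _ f (cst 0)) ?derive_cst//.
have oK : open (~` K) by exact: closed_openC.
by near=> y; apply: f0; near: y; exact: open_nbhs_nbhs.
Unshelve. all: by end_near. Qed.

Lemma test_function_partial (Omega : set Rd) i (f : Rd -> R^o) :
  test_function Omega f -> test_function Omega (partial i f).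
Proof.
move=> [sf [K [cK KO f0]]]; split; first exact: smooth_partial.
exists K; split => //; apply: partial_eq0 => //.
exact: (compact_closed (@norm_hausdorff _ _)).
Qed.

End smooth_calculus.

(** * Flat functions and smooth bumps on boxes *)

Section bump.
Context (R : realType).

(* The derivatives of [t |-> exp (-c / t)] are [P(1/t) exp (-c / t)], P a polynomial. *)
Definition flat (c : R) (P : {poly R}) (t : R) : R :=
  if 0 < t then P.[t^-1] * expR (- c / t) else 0.

(** With y = 1/t, d/dt acts as -y^2 d/dy, which turns P(y) exp(-c y) into y^2 (c P - P')(y) exp(-c
    y). *)
Definition flat_deriv c (P : {poly R}) : {poly R} := 'X^2 * (c *: P - P^`()).

(** The exponential series gives exp(c/t) >= (c/t)^(i+2) / (i+2)!, so t^-i exp(-c/t) is at most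
    (i+2)! / c^(i+2) times t^2; K sums these constants over the monomials of P. The exponent 2 is
    what gives derivative 0 at the origin. *)
Lemma flat_bound c (P : {poly R}) : 0 < c ->
  exists2 K : R, 0 <= K & forall t, `|flat c P t| <= K * t ^+ 2.
Proof.
move=> c0; pose K := \sum_(i < size P) `|P`_i| * ((i.+2)`!%:R / c ^+ i.+2).
have K0 : 0 <= K.
  by apply: sumr_ge0 => i _; rewrite mulr_ge0// divr_ge0// exprn_ge0// ltW.
exists K => // t; rewrite /flat; case: ifPn => t0; last first.
  by rewrite normr0 mulr_ge0// sqr_ge0.
rewrite normrM (ger0_norm (expR_ge0 _)) horner_coef.
have y0 : 0 < t^-1 by rewrite invr_gt0.
apply: (@le_trans _ _ (\sum_(i < size P) `|P`_i| * t^-1 ^+ i * expR (- c / t))).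
  rewrite -mulr_suml; apply: ler_wpM2r; first exact: expR_ge0.
  apply: le_trans (ler_norm_sum _ _ _) _; apply: ler_sum => i _.
  by rewrite normrM (ger0_norm (exprn_ge0 _ (ltW y0))).
rewrite mulr_suml; apply: ler_sum => i _.
rewrite -!mulrA ler_wpM2l//.
rewrite mulNr expRN ler_pdivrMr ?expR_gt0//.
have := @expR_ge1Dxn _ (c / t) i.+1 (ltW (divr_gt0 c0 t0)).
move=> h; have {}h : (c / t) ^+ i.+2 / (i.+2)`!%:R <= expR (c / t).
  by apply: le_trans h; rewrite lerDr.
have a0 : 0 <= ((i.+2)`!%:R / c ^+ i.+2) * t ^+ 2.
  by rewrite mulr_ge0// ?sqr_ge0// divr_ge0// exprn_ge0// ltW.
rewrite mulrA.
apply: le_trans (ler_wpM2l a0 h).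
rewrite expr_div_n.
have tn0 : t != 0 by rewrite gt_eqF.
have cn0 : c ^+ i.+2 != 0 by rewrite expf_neq0// gt_eqF.
have fn0 : (i.+2)`!%:R != 0 :> R by rewrite pnatr_eq0 -lt0n fact_gt0.
rewrite (_ : t ^+ i.+2 = t ^+ i * t ^+ 2); last by rewrite -exprD addn2.
rewrite exprVn le_eqVlt; apply/orP; left; apply/eqP.
have tin0 : t ^+ i != 0 by rewrite expf_neq0.
by field; rewrite fn0 cn0 tn0 tin0.
Qed.

Lemma is_derive_flat (c : R) P (t : R) : 0 < c ->
  is_derive t 1 (flat c P : R -> R^o) (flat c (flat_deriv c P) t).
Proof.
move=> c0; have [t0|t0|->] := ltgtP t 0.
- apply: (@near_eq_is_derive _ _ _ (cst 0)).
    near=> y; rewrite /flat ltNge (_ : y <= 0)//.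
    by apply: ltW; near: y; exact: lt_nbhsl.
  by rewrite /flat ltNge (ltW t0)/=; exact: is_derive_cst.
- pose g (y : R) : R^o := P.[y^-1] * expR (- c / y).
  apply: (@near_eq_is_derive _ _ _ g).
    near=> y; rewrite /flat (_ : 0 < y)//; near: y; exact: lt_nbhsr.
  rewrite /flat t0 /flat_deriv.
  have tn0 : t != 0 by rewrite gt_eqF.
  have dinv : is_derive t (1 : R) (fun y : R => y^-1 : R) (- t ^- 2).
    apply: DeriveDef; first by apply: (@derivableV _ _ id) => //.
    by rewrite (@deriveV _ _ id)// derive_id /GRing.scale/= mulr1.
  have dP : is_derive t (1 : R) (horner P \o (fun y : R => y^-1)) ((P^`()).[t^-1] * (- t ^- 2)).
    exact: (@is_derive1_comp R (horner P) (fun y : R => y^-1) t _ _ (is_derive_poly P _) dinv).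
  have dE : is_derive t (1 : R) (expR \o (fun y : R => - c * y^-1)) (expR (- c / t) * (- c * (- t ^- 2))).
    exact: (@is_derive1_comp R expR (fun y : R => - c * y^-1) t _ _ (is_derive_expR _)).
  have H := is_deriveM dP dE.
  rewrite (_ : _.[_] * _ = ((horner P \o [eta GRing.inv]) t *: (expR (- c / t) * (- c * - t ^- 2)) +
     (expR \o (fun y : R => - c / y)) t *: (P^`().[t^-1] * - t ^- 2))); first exact: H.
  rewrite hornerM hornerXn hornerD hornerN hornerZ /GRing.scale/=.
  field.
  by [].
(* By the bound K t^2 the difference quotient at 0 is at most K |h|. Since K may be 0, the radius is
   e / (K + 1). *)
- have cv : h^-1 *: ((flat c P : R -> R^o) (h *: 1 + 0) - flat c P 0) @[h --> (0:R)^'] --> (0 : R^o).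
    have [K K0 hK] := flat_bound P c0.
    apply/cvgrPdist_le => e e0.
    have eK : 0 < e / (K + 1) by rewrite divr_gt0//; lra.
    near=> h.
    rewrite sub0r normrN addr0 /GRing.scale/= mulr1 {2}/flat ltxx subr0 normrM.
    apply: (@le_trans _ _ (K * `|h|)).
      rewrite normfV ler_pdivrMl; last first.
        by rewrite normr_gt0; near: h; exact: nbhs_dnbhs_neq.
      apply: le_trans (hK _) _.
      by rewrite [leRHS]mulrCA -expr2 real_normK// num_real.
    rewrite mulrC; apply: (@le_trans _ _ (`|h| * (K + 1))); first by rewrite ler_wpM2l// lerDl.
    rewrite -ler_pdivlMr; last lra.
    near: h; apply: nbhs_dnbhs; apply/nbhs_ballP; exists (e / (K + 1)) => //= y.
    by rewrite /ball/= sub0r normrN; exact: ltW.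
  apply: DeriveDef; first by apply/cvg_ex; exists (0 : R^o).
  rewrite {2}/flat ltxx.
  exact: (cvg_lim (@Rhausdorff R)) cv.
Unshelve. all: by end_near. Qed.


(** This limit is the reason for the parameter c: as c tends to 0, exp(-c/t) tends to 1 at every t >
    0 while the values at t <= 0 stay 0. *)
Lemma flat1_cvg (t : R) : flat n.+1%:R^-1 1 t @[n --> \oo] --> ((0 < t)%R%:R : R).
Proof.
have [t0|/negbTE t0] := boolP (0 < t); last first.
  rewrite (_ : (fun n => _) = cst 0); first exact: cvg_cst.
  by apply/funext => n; rewrite /flat t0.
rewrite (_ : (fun n => _) = (@expR R) \o (fun n => - n.+1%:R^-1 / t)); last first.
  by apply/funext => n; rewrite /flat t0 hornerC mul1r.
have h : (- n.+1%:R^-1 / t : R) @[n --> \oo] --> - 0 / t.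
  by apply: cvgMr_tmp; apply: cvgN; exact: cvg_harmonic.
rewrite (_ : true%:R = expR (- 0 / t)); last by rewrite oppr0 mul0r expR0.
by apply: cvg_comp; [exact: h|exact: continuous_expR].
Qed.

Lemma flat1_01 (c t : R) : 0 < c -> 0 <= flat c 1 t <= 1.
Proof.
move=> c0; rewrite /flat; case: ifPn => t0; last by rewrite lexx ler01.
rewrite hornerC mul1r expR_ge0/= expR_le1 mulNr oppr_le0.
by rewrite divr_ge0// ltW.
Qed.

End bump.

Section box_function.
Context (R : realType) (d : nat).
Local Notation Rd := 'rV[R]_d.

Lemma partial_flat_affine (c al be : R) P i j : 0 < c ->
  (forall x : Rd, differentiable (fun x : Rd => flat c P (al + be * x 0 i) : R^o) x) /\
  partial j (fun x : Rd => flat c P (al + be * x 0 i) : R^o) =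
  fun x => be * (i == j)%:R * flat c (flat_deriv c P) (al + be * x 0 i).
Proof.
move=> c0; pose l (x : Rd) : R^o := al + be * x 0 i.
have lE : l = cst al + (be *: (fun x : Rd => x 0 i : R^o)) by [].
have dl x : differentiable l x.
  rewrite lE; apply: differentiableD => //; apply: differentiableZ.
  exact: differentiable_coord.
have df y : differentiable (flat c P : R -> R^o) y.
  by apply/derivable1_diffP; have [] := is_derive_flat P y c0.
have dfl x : differentiable ((flat c P : R -> R^o) \o l) x.
  exact: differentiable_comp.
split => //; apply/funext => x; rewrite /partial.
rewrite (_ : (fun _ => _) = (flat c P : R -> R^o) \o l)//.
rewrite deriveE// diff_comp//=.
have -> : 'd l x (delta_mx 0 j) = be * (i == j)%:R.
  rewrite -deriveE// lE deriveD; [|exact: derivable_cst|]; last first.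
    by apply: derivableZ; apply: diff_derivable; exact: differentiable_coord.
  rewrite derive_cst add0r deriveZ; last by apply: diff_derivable; exact: differentiable_coord.
  rewrite /GRing.scale/=; congr (_ * _).
  rewrite /derive; apply: (cvg_lim (@Rhausdorff R)).
  apply: cvg_near_cst.
  near=> h; rewrite /= !mxE eqxx/= addrK /GRing.scale/= mulrA mulVf ?mul1r ?eqxx//.
  by near: h; exact: nbhs_dnbhs_neq.
rewrite diff1E// derive1E; have [_ ->] := is_derive_flat P (l x) c0.
by rewrite /GRing.scale/=.
Unshelve. all: by end_near. Qed.

Lemma smooth_flat_affine (c al be : R) P i : 0 < c ->
  smooth (fun x : Rd => flat c P (al + be * x 0 i) : R^o).
Proof.
move=> c0; apply: (@smooth_coind _ _ _ (fun f : Rd -> R^o => exists a Q,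
   f = fun x => a * flat c Q (al + be * x 0 i) : R^o)).
  move=> _ [a [Q ->]]; split => [x|j].
    apply: (@differentiableM _ _ (cst a)) => //.
    by have [+ _] := @partial_flat_affine c al be Q i i c0; apply.
  exists (a * (be * (i == j)%:R)), (flat_deriv c Q).
  have [h1 h2] := @partial_flat_affine c al be Q i j c0.
  by rewrite partialZ// h2; apply/funext => x; rewrite !mulrA.
by exists 1, P; apply/funext => x; rewrite mul1r.
Qed.

Definition box (a b : Rd) : set Rd := [set x | forall i, a 0 i < x 0 i < b 0 i].

Definition cbox (a b : Rd) : set Rd := [set x | forall i, a 0 i <= x 0 i <= b 0 i].

(** One factor for each face. The function vanishes off the compact [cbox a b] and converges to the
    indicator of the open [box a b], so it serves both as a test function and as an approximation of
    a set. The coefficients 1 and -1 keep the affine form of [smooth_flat_affine]. *)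
Definition box_fun (a b : Rd) (n : nat) (x : Rd) : R :=
  \prod_(i < d) (flat n.+1%:R^-1 1 (- a 0 i + 1 * x 0 i) *
                flat n.+1%:R^-1 1 (b 0 i + (-1) * x 0 i)).

Lemma smooth_box_fun a b n : smooth (box_fun a b n : Rd -> R^o).
Proof.
apply: smooth_prod => i.
by apply: smoothM; apply: smooth_flat_affine.
Qed.

Lemma box_fun_01 a b n x : 0 <= box_fun a b n x <= 1.
Proof.
have n0 : 0 < n.+1%:R^-1 :> R by rewrite invr_gt0.
have h i : 0 <= flat n.+1%:R^-1 1 (- a 0 i + 1 * x 0 i) *
                flat n.+1%:R^-1 1 (b 0 i + (-1) * x 0 i) <= 1.
  have /andP[h1 h2] := flat1_01 (- a 0 i + 1 * x 0 i) n0.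
  have /andP[h3 h4] := flat1_01 (b 0 i + (-1) * x 0 i) n0.
  by rewrite mulr_ge0// mulr_ile1.
apply/andP; split; first by apply: prodr_ge0 => i _; have /andP[] := h i.
by apply: prodr_ile1 => i _; exact: h.
Qed.

Lemma box_fun_eq0 a b n x : ~ cbox a b x -> box_fun a b n x = 0.
Proof.
move=> /existsNP[i] /negP; rewrite negb_and -!ltNge => h.
rewrite /box_fun (bigD1 i)//= [X in X * _](_ : _ = 0) ?mul0r//.
case/orP: h => h.
  by rewrite {1}/flat mul1r addrC subr_gt0 ltNge (ltW h)/= mul0r.
by rewrite {2}/flat mulN1r subr_gt0 ltNge (ltW h)/= mulr0.
Qed.

Lemma box_fun_cvg a b x : box_fun a b n x @[n --> \oo] --> (\1_(box a b) x : R).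
Proof.
have -> : \1_(box a b) x = \prod_(i < d) ((0 < - a 0 i + 1 * x 0 i)%R%:R *
                (0 < b 0 i + (-1) * x 0 i)%R%:R) :> R.
  rewrite indicE; have [xab|xab] := pselect (box a b x).
    rewrite mem_set// big1// => i _; have /andP[h1 h2] := xab i.
    by rewrite mul1r mulN1r addrC !subr_gt0 h1 h2 mulr1.
  rewrite memNset//; move: xab => /existsNP[i] /negP; rewrite negb_and => h.
  rewrite (bigD1 i)//= [X in X * _](_ : _ = 0) ?mul0r//.
  rewrite mul1r mulN1r addrC !subr_gt0; case/orP: h => /negbTE ->.
    by rewrite mul0r.
  by rewrite mulr0.
apply: cvg_big => //; first by move=> p; exact: mul_continuous.
by move=> i _; apply: cvgM; exact: flat1_cvg.
Qed.

Lemma compact_cbox a b : compact (cbox a b).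
Proof.
have := @rV_compact R d (fun i => `[a 0 i, b 0 i]%classic) (fun i => @segment_compact R _ _).
by congr compact; apply/seteqP; split => x /= h i; have := h i; rewrite in_itv.
Qed.

Lemma test_function_box_fun (Omega : set Rd) a b n : cbox a b `<=` Omega ->
  test_function Omega (box_fun a b n : Rd -> R^o).
Proof.
move=> abO; split; first exact: smooth_box_fun.
exists (cbox a b); split => //; [exact: compact_cbox|exact: box_fun_eq0].
Qed.

End box_function.

(** * Functions on the torus as periodic functions, and a countable dense family *)

Section torus_functions.
Context (R : realType) (d : nat).
Local Notation Rd := 'rV[R]_d.
Local Notation Z := (torus R d).
Local Notation pi := (@torus_pi R d).

Lemma torus_reprK (z : Z) : pi (torus_repr z) = z.
Proof. exact: generic_quotient.reprK. Qed.

Lemma torus_piP (x y : Rd) :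
  pi x = pi y <-> forall i, x 0 i - y 0 i \is a Num.int.
Proof.
split => [|h].
  by move/generic_quotient.eqquotP => /forallP.
by apply/generic_quotient.eqquotP; apply/forallP.
Qed.

Lemma torus_pi_continuous : continuous pi.
Proof. exact: pi_continuous. Qed.

Lemma torus_continuousP (T : topologicalType) (f : Z -> T) :
  continuous f <-> continuous (f \o pi).
Proof. exact: quotient_continuous. Qed.

Definition frac_part (x : Rd) : Rd := \row_i (x 0 i - (Num.floor (x 0 i))%:~R).

Lemma frac_part_cube x : @unit_cube R d (frac_part x).
Proof.
move=> i; rewrite mxE subr_ge0 ge_floor/= ltrBlDl.
by have := floorD1_gt (x 0 i); rewrite intrD addrC.
Qed.

Lemma torus_pi_frac_part x : pi (frac_part x) = pi x.
Proof. by apply/torus_piP => i; rewrite mxE addrAC subrr sub0r rpredN intr_int. Qed.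

Lemma torus_cube (z : Z) : exists2 x, @unit_cube R d x & pi x = z.
Proof.
exists (frac_part (torus_repr z)); first exact: frac_part_cube.
by rewrite torus_pi_frac_part torus_reprK.
Qed.

Lemma torus_compact : compact [set: Z].
Proof.
have -> : [set: Z] = pi @` cbox 0 (const_mx 1).
  apply/seteqP; split => // z _; have [x xc <-] := torus_cube z.
  exists x => // i; rewrite !mxE.
  by have /andP[-> /ltW] := xc i.
apply: continuous_compact; last exact: compact_cbox.
exact/continuous_subspaceT/torus_pi_continuous.
Qed.

Lemma continuous_measurable_torus (f : Z -> R) : continuous f -> measurable_fun setT f.
Proof.
move=> /continuousP cf; apply: (measurability _ (RGenOpens.measurableE R)).
move=> _ [_ [a [b ->] <-]]; rewrite setTI; apply: sub_sigma_algebra.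
exact/cf/interval_open.
Qed.

Lemma compact_bounded_fun (T : topologicalType) (K : set T) (f : T -> R) : compact K ->
  {within K, continuous f} -> exists2 C : R, 0 <= C & forall x, K x -> `|f x| <= C.
Proof.
move=> cK cf; have := continuous_compact cf cK.
move=> /compact_bounded/= [M [_ hM]]; exists (`|M| + 1) => // x Kx.
by apply: (hM (`|M| + 1)); [rewrite (le_lt_trans (ler_norm M))// ltrDl|exists x].
Qed.

Lemma continuous_torus_bounded (f : Z -> R) : continuous f ->
  exists2 C : R, 0 <= C & forall x, `|f x| <= C.
Proof.
move=> cf; have [||C C0 fC] := @compact_bounded_fun Z setT f; last by exists C => // x; exact: fC.
- exact: torus_compact.
- exact: continuous_subspaceT.
Qed.

Definition Zperiodic (T : Type) (f : Rd -> T) :=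
  forall x y, pi x = pi y -> f x = f y.

Lemma partial_periodic i (f : Rd -> R^o) : Zperiodic f -> Zperiodic (partial i f).
Proof.
move=> pf x y xy; rewrite /partial /derive.
suff -> : (fun h : R => h^-1 *: ((f \o shift x) (h *: delta_mx 0 i) - f x)) =
  (fun h : R => h^-1 *: ((f \o shift y) (h *: delta_mx 0 i) - f y)) by [].
apply/funext => h /=; congr (_ *: (_ - _)); last exact: pf.
apply: pf; apply/torus_piP => j; rewrite !mxE.
by rewrite opprD addrACA subrr add0r; move/torus_piP: xy; apply.
Qed.

Lemma partials_periodic s (f : Rd -> R^o) : Zperiodic f -> Zperiodic (partials s f).
Proof. by move=> pf; elim: s => //= i s IH; exact: partial_periodic. Qed.

Lemma periodic_comp (T : Type) (f : Z -> T) : Zperiodic (f \o pi).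
Proof. by move=> x y /= ->. Qed.

(** [torus_mpartial] is the case of the list that a multi-index unfolds to; lists are what an
    induction on the number of derivatives needs. *)
Definition torus_partials (s : seq 'I_d) (phi : Z -> R) : Z -> R :=
  fun z => partials s (phi \o pi : Rd -> R^o) (torus_repr z).

Lemma torus_partials_pi s phi :
  torus_partials s phi \o pi = partials s (phi \o pi : Rd -> R^o).
Proof.
apply/funext => x; rewrite /torus_partials/=.
by apply: partials_periodic; [exact: periodic_comp|rewrite torus_reprK].
Qed.

Lemma torus_smooth_partials s phi : torus_smooth phi -> torus_smooth (torus_partials s phi).
Proof. by move=> sphi; rewrite /torus_smooth torus_partials_pi; exact: smooth_partials. Qed.

Lemma torus_smooth_continuous (phi : Z -> R) : torus_smooth phi -> continuous phi.
Proof. by move=> sphi; apply/torus_continuousP; exact: (smooth_continuous sphi). Qed.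

Lemma torus_smooth_cst c : torus_smooth (cst c : Z -> R).
Proof. exact: smooth_cst. Qed.

End torus_functions.

Section torus_density.
Context (R : realType) (d : nat).
Local Notation Rd := 'rV[R]_d.
Local Notation Z := (torus R d).
Local Notation pi := (@torus_pi R d).

Lemma compact_unif_continuous (K : set Rd) (u : Rd -> R) (e : R) : compact K ->
  continuous u -> 0 < e ->
  \forall N \near \oo, forall x, K x -> forall y, ball x N.+1%:R^-1 y -> `|u x - u y| < e.
Proof.
move=> /compact_near_coveringP cK cu e0.
apply: (cK nat \oo (fun N x => forall y, ball x N.+1%:R^-1 y -> `|u x - u y| < e)) => x Kx.
have e20 : 0 < e / 2 by rewrite divr_gt0.
have /cvgrPdist_lt/(_ _ e20)/nbhs_ballP[r /= r0 ur] := cu x.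
have r20 : 0 < r / 2 by rewrite divr_gt0.
exists (ball x (r / 2), [set N | N.+1%:R^-1 < r / 2]).
  split => /=; first by apply/nbhs_ballP; exists (r / 2).
  exact: (near_infty_natSinv_lt (PosNum r20)).
move=> [x' N] /= [xx' Nr] y x'y.
have h1 : `|u x - u x'| < e / 2 by apply: ur; apply: le_ball xx'; lra.
have h2 : `|u x - u y| < e / 2.
  apply: ur; rewrite (splitr r); apply: ball_triangle xx' _.
  by apply: le_ball x'y; exact: ltW.
have -> : u x' - u y = (u x - u y) - (u x - u x') by ring.
by rewrite (splitr e); apply: le_lt_trans (ler_normB _ _) _; exact: ltrD.
Qed.

(* Functions are coded by the integer parts of their values on a fine grid;
   [phi_] picks one function for each code. *)
Lemma torus_dense_sequence (I : finType) (X : Type) (P : set X) (D : I -> X -> Z -> R) :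
  P !=set0 -> (forall i f, P f -> continuous (D i f)) ->
  exists phi_ : nat -> X, (forall n, P (phi_ n)) /\
    forall f (e : R), P f -> 0 < e -> exists n, forall i z, `|D i f z - D i (phi_ n) z| <= e.
Proof.
move=> [f0 Pf0] cD.
pose grid (N : nat) (q : {ffun 'I_d -> 'I_N.+1}) : Rd := \row_i ((q i)%:R / N.+1%:R).
(* A code (j, N, s) holds a precision 1/(j+1), a mesh 1/(N+1) on which every [D i f] varies by less
   than this precision, and the integer parts of (j+1) [D i f] at the grid points. The mesh
   condition belongs to the code so that the function picked for it satisfies it too; two functions
   with one code then differ by at most 3/(j+1). *)
pose code (c : nat * nat * seq int) (f : X) :=
  [/\ P f, forall i x, cbox 0 (const_mx 1) x -> forall y, ball x c.1.2.+1%:R^-1 y ->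
       `|D i f (pi x) - D i f (pi y)| < c.1.1.+1%:R^-1
   & [seq Num.floor (c.1.1.+1%:R * D p.1 f (pi (grid c.1.2 p.2))) | p <- enum {: I * {ffun 'I_d -> 'I_c.1.2.+1}}] = c.2].
pose pick (n : nat) : X := if (choice.unpickle n : option (nat * nat * seq int)) is Some c then
   (if pselect (exists f, code c f) is left h then projT1 (cid h) else f0) else f0.
exists pick; split.
  move=> n; rewrite /pick; case: choice.unpickle => // c; case: pselect => // h.
  by case: (projT2 (cid h)).
move=> f e Pf e0.
have [j je] : exists j : nat, 3 * j.+1%:R^-1 < e.
  have e3 : 0 < e / 3 by rewrite divr_gt0.
  have [j _ /(_ _ (leqnn j))/=] := near_infty_natSinv_lt (PosNum e3).
  by rewrite ltr_pdivlMr// mulrC => ?; exists j.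
have [N hN] : exists N : nat, forall i x, cbox 0 (const_mx 1) x -> forall y, ball x N.+1%:R^-1 y ->
       `|D i f (pi x) - D i f (pi y)| < j.+1%:R^-1.
  have : \forall N \near \oo, forall i x, cbox 0 (const_mx 1) x -> forall y, ball x N.+1%:R^-1 y ->
       `|D i f (pi x) - D i f (pi y)| < j.+1%:R^-1.
    apply: filter_forall => i.
    apply: (compact_unif_continuous (@compact_cbox R d _ _) (u := D i f \o pi)).
      exact/torus_continuousP/cD.
    by rewrite invr_gt0.
  by move=> [N _ /(_ _ (leqnn N))/= hN]; exists N.
pose c : nat * nat * seq int := (j, N,
  [seq Num.floor (j.+1%:R * D p.1 f (pi (grid N p.2))) | p <- enum {: I * {ffun 'I_d -> 'I_N.+1}}]).
have cf : code c f by split.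
exists (choice.pickle c); rewrite /pick choice.pickleK.
case: pselect => [h|]; last by case; exists f.
case: (cid h) => f' /= [Pf' hN' /eq_in_map E] i z.
have [x xc <-] := torus_cube z.
(* The lower corner of the grid cell of x; [inord] does not truncate, because x lies in the
   half-open cube. *)
pose q : {ffun 'I_d -> 'I_N.+1} := [ffun i => inord (Num.truncn (N.+1%:R * x 0 i))].
have xcb : cbox 0 (const_mx 1) x.
  by move=> k; rewrite !mxE; have /andP[-> /ltW] := xc k.
have N0 : 0 < N.+1%:R^-1 :> R by rewrite invr_gt0.
have xq : ball x N.+1%:R^-1 (grid N q).
  split => // a k; rewrite ord1 !mxE ffunE inordK; last first.
    have /andP[x0 x1] := xc k.
    rewrite truncn_lt_nat ?mulr_ge0//.
    by rewrite -[ltRHS]mulr1 ltr_pM2l.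
  have /andP[x0 x1] := xc k.
  have /andP[t1 t2] := truncn_itv (mulr_ge0 (ler0n R N.+1) x0).
  rewrite /ball/=; set t := (Num.truncn _) in t1 t2 *.
  have -> : x 0 k - t%:R / N.+1%:R = (N.+1%:R * x 0 k - t%:R) * N.+1%:R^-1.
    by rewrite mulrBl mulrAC mulfV ?mul1r ?pnatr_eq0.
  rewrite normrM (ger0_norm (ltW N0)) -[ltRHS]mul1r ltr_pM2r// ger0_norm ?subr_ge0//.
  by rewrite ltrBlDl natr1.
have h1 := hN i x xcb _ xq.
have h2 := hN' i x xcb _ xq.
have h3 : `|D i f (pi (grid N q)) - D i f' (pi (grid N q))| < j.+1%:R^-1.
  have := E (i, q); rewrite mem_enum inE => /(_ isT)/=.
  move: (D i f _) (D i f' _) => u v uv.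
  have /andP[u1 u2] := floor_itv (j.+1%:R * u).
  have /andP[v1 v2] := floor_itv (j.+1%:R * v).
  rewrite -uv in u1 u2.
  have j0 : 0 < j.+1%:R :> R by [].
  rewrite -(ltr_pM2l j0) mulfV ?gt_eqF// -[X in X * _](ger0_norm (ltW j0)) -normrM mulrBr.
  by rewrite ltr_norml; rewrite intrD in u2 v2; apply/andP; split; lra.
rewrite /= in h2.
rewrite ltr_norml in h1; rewrite ltr_norml in h2; rewrite ltr_norml in h3.
move/andP: h1 => [a1 b1]; move/andP: h2 => [a2 b2]; move/andP: h3 => [a3 b3].
move: je a1 b1 a2 b2 a3 b3; move: (j.+1%:R^-1) => w je a1 b1 a2 b2 a3 b3.
by rewrite ler_norml; apply/andP; split; lra.
Qed.

End torus_density.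

(** * Oscillating test functions and their derivatives *)

Section oscillating_test_functions.
Context (R : realType) (d : nat).
Local Notation Rd := 'rV[R]_d.
Local Notation Z := (torus R d).
Local Notation pi := (@torus_pi R d).
Context (Omega : set Rd).

Definition osc (e : R) (psi : Rd -> R) (phi : Z -> R) (x : Rd) : R :=
  psi x * phi (pi (e^-1 *: x)).

Definition osc_term := (nat * (Rd -> R) * (Z -> R))%type.

(** The successor in the exponent makes every such sum a remainder by construction. The terms do not
    mention e, so one list describes the remainder for all e at once. *)
Definition osc_sum (l : seq osc_term) (e : R) (x : Rd) : R :=
  \sum_(t <- l) e ^+ t.1.1.+1 * osc e t.1.2 t.2 x.

Definition osc_good (psi : Rd -> R) (phi : Z -> R) :=
  test_function Omega (psi : Rd -> R^o) /\ torus_smooth phi.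

Fixpoint osc_goods (l : seq osc_term) : Prop :=
  if l is t :: l' then osc_good t.1.2 t.2 /\ osc_goods l' else True.

Lemma smooth_osc e psi phi : smooth (psi : Rd -> R^o) -> torus_smooth phi ->
  smooth (osc e psi phi : Rd -> R^o).
Proof.
move=> spsi sphi; apply: smoothM => //.
exact: (smooth_scale e^-1 sphi).
Qed.

Lemma partial_osc (e : R) psi phi i : e != 0 -> smooth (psi : Rd -> R^o) -> torus_smooth phi ->
  forall x, e * partial i (osc e psi phi : Rd -> R^o) x =
    e * osc e (partial i (psi : Rd -> R^o)) phi x + osc e psi (torus_partials [:: i] phi) x.
Proof.
move=> e0 spsi sphi x; rewrite /osc.
rewrite (@partialM _ _ i psi (fun x => phi (pi (e^-1 *: x)))); last 2 first.
- exact: smooth_differentiable.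
- by move=> y; exact: (smooth_differentiable (smooth_scale e^-1 sphi)).
rewrite mulrDr; congr (_ + _).
have := @partial_scale _ _ i e^-1 (phi \o pi) (smooth_differentiable sphi).
move=> /(congr1 (fun f => f x)) /= ->.
have /(congr1 (fun f => f (e^-1 *: x))) /= -> := torus_partials_pi [:: i] phi.
move: (psi x) (partial i (phi \o pi : Rd -> R^o) (e^-1 *: x)) => u v.
by have := e0 => ?; change ((e * (u * (e^-1 * v)) : R) = u * v :> R); field.
Qed.

Lemma smooth_osc_sum l e : osc_goods l -> smooth (osc_sum l e : Rd -> R^o).
Proof.
elim: l => [_|t l IH /= [[[gt _] gt'] gl]].
  have -> : osc_sum [::] e = cst 0 by apply/funext => x; rewrite /osc_sum big_nil.
  exact: smooth_cst.
have -> : osc_sum (t :: l) e = fun x => e ^+ t.1.1.+1 * osc e t.1.2 t.2 x + osc_sum l e x.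
  by apply/funext => x; rewrite /osc_sum big_cons.
by apply: smoothD; [apply: smoothZ; exact: smooth_osc|exact: IH].
Qed.

(** The factor e clears the 1/e of the chain rule. The list l' is chosen before e and x, which later
    makes bounds and limits uniform. *)
Lemma partial_osc_sum l i : osc_goods l -> exists2 l', osc_goods l' &
  forall (e : R) x, e != 0 -> e * partial i (osc_sum l e : Rd -> R^o) x = osc_sum l' e x.
Proof.
elim: l => [_|[[n psi] phi] l IH /= [[tpsi sphi] gl]].
  exists [::] => // e x _; have -> : osc_sum [::] e = cst 0.
    by apply/funext => y; rewrite /osc_sum big_nil.
  by rewrite partial_cst mulr0.
have [l' gl' hl'] := IH gl.
(* A derivative on psi gains one power of e; a derivative on phi leaves the power unchanged. *)
exists [:: (n.+1, partial i (psi : Rd -> R^o) : Rd -> R, phi), (n, psi, torus_partials [:: i] phi) & l'].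
  split; first by split => //; exact: test_function_partial.
  by split => //; split => //; exact: torus_smooth_partials.
move=> e x e0; rewrite /osc_sum !big_cons -/(osc_sum l' e x) -hl'//=.
have -> : (fun x => \sum_(t <- (n, psi, phi) :: l) e ^+ t.1.1.+1 * osc e t.1.2 t.2 x : R^o) =
   fun x => e ^+ n.+1 * osc e psi phi x + osc_sum l e x : R^o.
  by apply/funext => y; rewrite big_cons.
have so := smooth_osc e tpsi.1 sphi.
rewrite (@partialD _ _ i (fun x => e ^+ n.+1 * osc e psi phi x)); last 2 first.
- exact: smooth_differentiable (smoothZ _ so).
- exact: smooth_differentiable (smooth_osc_sum _ _).
rewrite partialZ; last exact: smooth_differentiable.
rewrite mulrDr mulrCA partial_osc//; last exact: tpsi.1.
move: (osc e (partial i (psi : Rd -> R^o)) phi x : R) => a.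
move: (osc e psi (torus_partials [:: i] phi) x : R) => b.
move: (partial i (osc_sum l e : Rd -> R^o) x) => c.
change ((e ^+ n.+1 * (e * a + b) + e * c : R) = e ^+ n.+2 * a + (e ^+ n.+1 * b + e * c)).
by rewrite (exprSr e n.+1); move: (e ^+ n.+1) => w; ring.
Qed.

Lemma partials_osc psi phi s : osc_good psi phi -> exists2 l, osc_goods l &
  forall (e : R) x, e != 0 -> e ^+ size s * partials s (osc e psi phi : Rd -> R^o) x =
    osc e psi (torus_partials s phi) x + osc_sum l e x.
Proof.
move=> [tpsi sphi]; elim: s => [|i s [l gl hl]].
  exists [::] => // e x _; rewrite /osc_sum big_nil expr0 mul1r addr0/= /osc.
  by have /(congr1 (fun f => f (e^-1 *: x))) /= -> := torus_partials_pi [::] phi.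
have [l' gl' hl'] := partial_osc_sum i gl.
(* The derivative of the principal term that falls on psi opens a new remainder term, with power 1,
   stored as 0. *)
exists ((0%N, partial i (psi : Rd -> R^o) : Rd -> R, torus_partials s phi) :: l').
  split => //; split; first exact: test_function_partial.
  exact: torus_smooth_partials.
move=> e x e0; rewrite /osc_sum big_cons -/(osc_sum l' e x) -hl'//=.
have sp := smooth_partials s (smooth_osc e tpsi.1 sphi).
have E : (fun x => e ^+ size s * partials s (osc e psi phi : Rd -> R^o) x : R^o) =
   (fun x => osc e psi (torus_partials s phi) x + osc_sum l e x : R^o).
  by apply/funext => y; exact: hl.
have := congr1 (fun f => e * partial i f x) E.
rewrite partialZ; last exact: smooth_differentiable.
rewrite mulrA -exprS => ->.
have st := torus_smooth_partials s sphi.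
rewrite partialD; last 2 first.
- exact: smooth_differentiable (smooth_osc _ tpsi.1 st).
- exact: smooth_differentiable (smooth_osc_sum _ _).
rewrite mulrDr partial_osc//; last exact: tpsi.1.
rewrite addrA expr1; congr (_ + _); rewrite addrC; congr (_ + _).
rewrite /osc; congr (_ * _).
have /(congr1 (fun f => f (e^-1 *: x))) /= -> := torus_partials_pi [:: i] (torus_partials s phi).
have /(congr1 (fun f => f (e^-1 *: x))) /= -> := torus_partials_pi (i :: s) phi.
by rewrite torus_partials_pi.
Qed.

Lemma test_function_bounded (psi : Rd -> R) : test_function Omega (psi : Rd -> R^o) ->
  exists2 C : R, 0 <= C & forall x, `|psi x| <= C.
Proof.
move=> [spsi [K [cK KO psi0]]].
have [|C C0 hC] := @compact_bounded_fun R Rd K psi cK.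
  by apply: continuous_subspaceT; exact: (smooth_continuous spsi).
exists C => // x; have [/hC//|/psi0 ->] := pselect (K x).
by rewrite normr0.
Qed.

Lemma osc_bounded psi phi : osc_good psi phi ->
  exists2 C : R, 0 <= C & forall e x, `|osc e psi phi x| <= C.
Proof.
move=> [/test_function_bounded[C C0 hC] /torus_smooth_continuous/continuous_torus_bounded[D D0 hD]].
exists (C * D); first exact: mulr_ge0.
by move=> e x; rewrite /osc normrM; apply: ler_pM.
Qed.

Lemma osc_sum_bounded l E : osc_goods l ->
  exists2 C : R, 0 <= C & forall (e : R) x, 0 < e <= E -> `|osc_sum l e x| <= C.
Proof.
elim: l => [_|t l IH /= [/osc_bounded[C C0 hC] /IH[D D0 hD]]].
  by exists 0 => // e x _; rewrite /osc_sum big_nil normr0.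
exists (`|E| ^+ t.1.1.+1 * C + D).
  by rewrite addr_ge0// mulr_ge0// exprn_ge0.
move=> e x eE; rewrite /osc_sum big_cons; apply: le_trans (ler_normD _ _) _.
apply: lerD; last exact: hD.
rewrite normrM; apply: ler_pM => //; rewrite normrX; apply: lerXn2r; rewrite ?nnegrE//.
by move/andP: eE => [e0 eE]; rewrite (gtr0_norm e0) (le_trans eE)// ler_norm.
Qed.

Lemma measurable_osc e psi phi : osc_good psi phi -> measurable_fun setT (osc e psi phi).
Proof.
move=> [[spsi _] sphi]; apply: continuous_measurable_mx.
exact: (smooth_continuous (smooth_osc e spsi sphi)).
Qed.

Lemma size_mindex_seq k (a : mindex d k) :
  size (flatten [seq nseq (a i) i | i <- enum 'I_d]) = mdegree a.
Proof.
rewrite size_flatten /shape -map_comp sumnE big_map /mdegree big_enum/=.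
by apply: eq_bigr => i _; rewrite /= size_nseq.
Qed.

(** Split e^k into e^(k-|a|) and e^|a|: the second factor is absorbed by the derivatives and the
    first is bounded for e <= E. This uniform bound is what controls the Sobolev norm of the test
    functions. *)
Lemma mpartial_osc_bounded k (E : R) psi phi : osc_good psi phi ->
  exists2 B : R, 0 <= B & forall (a : mindex d k) (e : R) x, (mdegree a <= k)%N -> 0 < e <= E ->
    `|e ^+ k * mpartial a (osc e psi phi : Rd -> R^o) x| <= B.
Proof.
move=> g.
have /choice[B hB] (a : mindex d k) : exists B, 0 <= B /\ forall e x, (mdegree a <= k)%N -> 0 < e <= E ->
    `|e ^+ k * mpartial a (osc e psi phi : Rd -> R^o) x| <= B.
  rewrite /mpartial; set s := flatten _.
  have [l gl hl] := partials_osc s g.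
  have [C C0 hC] := osc_sum_bounded E gl.
  have gs : osc_good psi (torus_partials s phi).
    by split; [exact: g.1|exact: torus_smooth_partials g.2].
  have [D D0 hD] := osc_bounded gs.
  exists (`|E| ^+ (k - mdegree a) * (D + C)); split.
    by rewrite mulr_ge0 ?exprn_ge0// addr_ge0.
  move=> e x ak eE.
  have e0 : e != 0 by rewrite gt_eqF//; case/andP: eE.
  have -> : e ^+ k = e ^+ (k - mdegree a) * e ^+ size s.
    by rewrite size_mindex_seq -exprD subnK.
  rewrite -mulrA hl// normrM.
  apply: ler_pM => //.
    rewrite normrX; apply: lerXn2r; rewrite ?nnegrE//.
    by move/andP: eE => [e1 eE]; rewrite (gtr0_norm e1) (le_trans eE)// ler_norm.
  by apply: le_trans (ler_normD _ _) _; apply: lerD => //; exact: hC.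
exists (\sum_a B a); first by apply: sumr_ge0 => a _; exact: (hB a).1.
move=> a e x ak eE; apply: le_trans ((hB a).2 e x ak eE) _.
by rewrite (bigD1 a)//= lerDl; apply: sumr_ge0 => b _; exact: (hB b).1.
Qed.

End oscillating_test_functions.

(** * Volume of bounded sets and the Euclidean norm *)

Section volume.
Context (R : realType).

Lemma lebesgue_rV_cube d (M : R) :
  (lebesgue_rV R d [set x : 'rV[R]_d | forall i, (- M <= x 0 i <= M)%R] < +oo)%E /\
  measurable [set x : 'rV[R]_d | forall i, - M <= x 0 i <= M].
Proof.
elim: d => [|n [IH mIH]] /=.
  split; last first.
    by rewrite (_ : [set _ | _] = setT)//; apply/seteqP; split => // x _ [[]].
  rewrite diracE; case: (_ \in _); exact: ltry.
split; last first.
  rewrite (_ : [set _ | _] = \bigcap_(i in [set: 'I_n.+1]) ((fun x : 'rV[R]_n.+1 => x 0 i) @^-1` `[-M, M])).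
    apply: fin_bigcap_measurable => // i _; rewrite -[X in measurable X]setTI.
    by apply: continuous_measurable_mx => //; move=> x; exact: coord_continuous.
  apply/seteqP; split => x /= h i.
    by move=> _ /=; rewrite in_itv/=; exact: h.
  by have := h i Logic.I; rewrite /= in_itv.
rewrite /rV_lebesgue_step /pushforward.
rewrite (_ : _ @^-1` _ = `[-M, M]%classic `*` [set x : 'rV[R]_n | forall i, - M <= x 0 i <= M]).
  rewrite product_measure1E// lte_mul_pinfty//.
    rewrite [X in X \is a fin_num](lebesgue_measure_itv `[- M, M]).
    by rewrite /=; case: ifP.
apply/seteqP; split => p /=.
  move=> h; split; first by have := h (@lshift 1 n 0);
    rewrite /rV_cons (@row_mxEl _ 1 1 n) !mxE eqxx in_itv.
  by move=> i; have := h (@rshift 1 n i); rewrite /rV_cons (@row_mxEr _ 1 1 n).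
move=> [h1 h2] i; rewrite /rV_cons.
case: (@split_ordP 1 n i) => j ->.
  by rewrite !(@row_mxEl _ 1 1 n) !ord1 !mxE eqxx !mulr1n; rewrite in_itv in h1.
by rewrite !(@row_mxEr _ 1 1 n).
Qed.

Lemma coord_le_norm d (x : 'rV[R]_d) i : `|x 0 i| <= `|x|.
Proof.
rewrite -[leRHS]/(mx_norm x) mx_normrE.
exact: (le_bigmax _ (fun ij : 'I_1 * 'I_d => `|x ij.1 ij.2|) (0, i)).
Qed.

Lemma lebesgue_bounded d (Omega : set 'rV[R]_d) : measurable Omega -> bounded_set Omega ->
  (lebesgue_rV R d Omega < +oo)%E.
Proof.
move=> mO [M [_ hM]].
have [fM mM] := lebesgue_rV_cube d (`|M| + 1).
apply: le_lt_trans fM; apply: le_measure; [exact/mem_set|exact/mem_set|].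
move=> x Ox i; rewrite -ler_norml.
have /= := hM (`|M| + 1) _ x Ox; rewrite (le_lt_trans (ler_norm M)) ?ltrDl// => /(_ isT).
by apply: le_trans; exact: coord_le_norm.
Qed.

End volume.

Lemma continuous_sumr (R : realType) (T : topologicalType) (I : Type) (s : seq I)
    (f : I -> T -> R) : (forall i, continuous (f i)) ->
  continuous (fun x => \sum_(i <- s) f i x).
Proof.
move=> cf x; elim: s => [|i s IH].
  rewrite (_ : (fun x => _) = cst 0); first exact: cvg_cst.
  by apply/funext => y; rewrite big_nil.
rewrite (_ : (fun x => _) = fun x => f i x + \sum_(j <- s) f j x); last first.
  by apply/funext => y; rewrite big_cons.
by apply: cvgD; [exact: cf|exact: IH].
Qed.

Section euclidean_norm.
Context (R : realType) (m : nat).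
Implicit Types z : 'rV[R]_m.

Lemma enorm_coord z i : `|z 0 i| <= enorm z.
Proof.
rewrite -sqrtr_sqr /enorm ler_wsqrtr// (bigD1 i)//= lerDl.
by apply: sumr_ge0 => j _; exact: sqr_ge0.
Qed.

Lemma enorm_ge0 z : 0 <= enorm z.
Proof. exact: sqrtr_ge0. Qed.

Lemma enorm_continuous : continuous (@enorm R m).
Proof.
move=> z; apply: (@continuous_comp _ _ _ (fun z : 'rV[R]_m => \sum_i z 0 i ^+ 2) (@Num.sqrt R)).
  apply: continuous_sumr => i {}z.
  apply: (@continuous_comp _ _ _ (fun z : 'rV[R]_m => z 0 i) (fun y : R => y ^+ 2)).
    exact: coord_continuous.
  exact: exprn_continuous.
exact: sqrt_continuous.
Qed.

Lemma enormZ (c : R) z : enorm (c *: z) = `|c| * enorm z.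
Proof.
rewrite /enorm; under eq_bigr do rewrite mxE exprMn.
by rewrite -mulr_sumr sqrtrM ?sqr_ge0// sqrtr_sqr.
Qed.

Lemma enorm_delta (j : 'I_m) : enorm (delta_mx 0 j : 'rV[R]_m) = 1.
Proof.
rewrite /enorm (bigD1 j)//= big1 ?addr0 ?mxE ?eqxx ?expr1n ?sqrtr1//.
by move=> i ij; rewrite mxE (negbTE ij) andbF expr0n.
Qed.

Lemma measurable_coord t (T : measurableType t) (D : set T) (f : T -> 'rV[R]_m) i :
  measurable_fun D f -> measurable_fun D (fun x => f x 0 i).
Proof.
move=> mf; apply: (@measurableT_comp _ _ _ _ _ _ (fun z : 'rV[R]_m => z 0 i)) => //.
by apply: continuous_measurable_mx => x; exact: coord_continuous.
Qed.

End euclidean_norm.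

(** * Limits of pairings along a generating sequence *)

Section generation.
Context (R : realType) (d m : nat).
Local Notation Rd := 'rV[R]_d.
Local Notation Z := (torus R d).
Local Notation E := 'rV[R]_m.
Local Notation Leb := (lebesgue_rV R d).
Local Notation pi := (@torus_pi R d).

Lemma polar_integrable (mu : vmeasure R Rd m) g sigma h i :
  lebesgue_polar mu g sigma h ->
  Leb.-integrable setT (EFin \o (fun x => g x 0 i)) /\
  sigma.-integrable setT (EFin \o (fun x => h x 0 i)).
Proof.
move=> [[mg ig] [mh h1] _ _ _]; split.
  apply: le_integrable ig => //.
    exact/measurable_EFinP/measurable_coord.
  by move=> x _ /=; rewrite lee_fin (ger0_norm (enorm_ge0 _)) enorm_coord.
have mhi : measurable_fun setT (fun x => h x 0 i) by exact: measurable_coord.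
apply/integrableP; split; first exact/measurable_EFinP.
apply: (@le_lt_trans _ _ (\int[sigma]_x (cst 1 x))%E); last first.
  by rewrite integral_cst// mul1e -ge0_fin_numE// fin_num_measure.
apply: ae_ge0_le_integral => //.
- exact/measurableT_comp/measurable_EFinP.
- case: h1 => N [mN N0 hN]; exists N; split => // x /= h2; apply: hN => /= h3; apply: h2 => _.
  by rewrite lee_fin -h3 enorm_coord.
Qed.

Lemma polar_charge_integral (mu : vmeasure R Rd m) g sigma h i (F : Rd -> R) (C : R) :
  lebesgue_polar mu g sigma h -> measurable_fun setT F -> (forall x, `|F x| <= C) ->
  charge_integral (mu i) F =
  \int[Leb]_x (F x * g x 0 i) + \int[sigma]_x (F x * h x 0 i).
Proof.
move=> pol mF FC; have [i1 i2] := polar_integrable i pol.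
apply: (@charge_integralE _ _ _ _ _ _ (fun x => g x 0 i) (fun x => h x 0 i) F C) => // B mB.
have [_ _ _ /(_ B mB) + _] := pol => /(congr1 (fun v : E => v 0 i)).
by rewrite !mxE.
Qed.

Lemma polar_charge_integral_sum (mu : vmeasure R Rd m) g sigma h i
    (I : Type) (s : seq I) (c : I -> R) (F : I -> Rd -> R) :
  lebesgue_polar mu g sigma h ->
  (forall t, measurable_fun setT (F t)) -> (forall t, exists C, forall x, `|F t x| <= C) ->
  charge_integral (mu i) (fun x => \sum_(t <- s) c t * F t x) =
  \sum_(t <- s) c t * charge_integral (mu i) (F t).
Proof.
move=> pol mF bF; have [i1 i2] := polar_integrable i pol.
have /choice[C hC] := bF.
have mS : measurable_fun setT (fun x => \sum_(t <- s) c t * F t x).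
  by apply: measurable_sum => t; exact: measurable_funM.
have bS x : `|\sum_(t <- s) c t * F t x| <= \sum_(t <- s) `|c t| * C t.
  apply: le_trans (ler_norm_sum _ _ _) _; apply: ler_sum => t _.
  by rewrite normrM ler_wpM2l.
rewrite (polar_charge_integral i pol mS bS).
under [in RHS]eq_bigr do rewrite (polar_charge_integral i pol (mF _) (hC _)) mulrDr.
rewrite big_split/=.
have key (ms : {measure set Rd -> \bar R}) (u : Rd -> R) : ms.-integrable setT (EFin \o u) ->
   \int[ms]_x ((\sum_(t <- s) c t * F t x) * u x) = \sum_(t <- s) c t * \int[ms]_x (F t x * u x).
  move=> iu.
  have iFu t : ms.-integrable setT (EFin \o (fun x => F t x * u x)).
    exact: integrable_bounded_mul (mF t) (hC t) iu.
  transitivity (\int[ms]_x (\sum_(t <- s) c t * (F t x * u x))).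
    by apply: eq_Rintegral => x _; rewrite mulr_suml; apply: eq_bigr => t _; rewrite mulrA.
  rewrite Rintegral_sum; last first.
    move=> t; exact: (@integrable_bounded_mul _ _ _ _ (cst (c t)) _ `|c t|).
  by apply: eq_bigr => t _; rewrite RintegralZl.
by rewrite !key.
Qed.

(** Linearity in z makes this integrand equal to its own [Ttransform] on the open ball and to its
    own recession function over the closure of Omega, so both sides of the generation property
    become explicit. *)
Definition test_integrand (psi : Rd -> R) (phi : Z -> R) (i : 'I_m) (q : Rd * Z * E) : R :=
  psi q.1.1 * phi q.1.2 * q.2 0 i.

Lemma test_integrand_continuous (psi : Rd -> R) (phi : Z -> R) i : continuous psi -> continuous phi ->
  continuous (test_integrand psi phi i).
Proof.
move=> cpsi cphi [[x xi] z].
apply: cvgM; first apply: cvgM.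
- apply: (@continuous_comp _ _ _ (fun q : Rd * Z * E => q.1.1) psi); last exact: cpsi.
  apply: (@continuous_comp _ _ _ (@fst _ _) (@fst _ _)); exact: cvg_fst.
- apply: (@continuous_comp _ _ _ (fun q : Rd * Z * E => q.1.2) phi); last exact: cphi.
  apply: (@continuous_comp _ _ _ (@fst _ _) (@snd _ _)); [exact: cvg_fst|exact: cvg_snd].
- apply: (@continuous_comp _ _ _ (@snd _ _) (fun z : E => z 0 i)); first exact: cvg_snd.
  exact: coord_continuous.
Qed.

Lemma E2_test_integrand Omega (psi : Rd -> R) (phi : Z -> R) i : continuous psi -> continuous phi ->
  E2 Omega (test_integrand psi phi i).
Proof.
move=> cpsi cphi; have cf := @test_integrand_continuous psi phi i cpsi cphi.
split; first exact: continuous_subspaceT.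
exists (test_integrand psi phi i); first exact: continuous_subspaceT.
move=> [[x xi] z] /set_mem [_ /= z1]; rewrite /Ttransform /test_integrand /= mxE.
have n0 : 1 - enorm z != 0 by rewrite gt_eqF// subr_gt0.
by move: (psi x : R) (phi xi : R) (z 0 i) (1 - enorm z) n0 => a b c w w0; field.
Qed.

Lemma recession_test_integrand Omega (psi : Rd -> R) (phi : Z -> R) i x xi z : continuous psi -> continuous phi ->
  closure Omega x -> recession Omega (test_integrand psi phi i) x xi z = psi x * phi xi * z 0 i.
Proof.
move=> cpsi cphi Ox; rewrite /recession.
(* The point x lies in the closure of Omega, hence the filter is proper and [lim] is the limit
   computed below. *)
have PF : ProperFilter (within Omega (nbhs x)).
  by apply: within_nbhs_proper.
apply: (cvg_lim (@Rhausdorff R)).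
have E : {near filter_prod (filter_prod (within Omega (nbhs x)) (nbhs xi)) (pinfty_nbhs R),
  (fun q : Rd * Z * R => psi q.1.1 * phi q.1.2 * z 0 i) =1
  (fun q : Rd * Z * R => test_integrand psi phi i (q.1.1, q.1.2, q.2 *: z) / q.2)}.
  exists (setT, [set t | 0 < t]) => /=.
    split; first exact: filterT.
    by exists 0; split => //; exact: num_real.
  move=> [[x' xi'] t] /= [_ t0]; rewrite /test_integrand /= mxE.
  have {t0} : t != 0 by rewrite gt_eqF.
  by move: (psi x' : R) (phi xi' : R) (z 0 i) => a b c w0; field.
apply: cvg_trans (near_eq_cvg E) _.
apply: cvgMr_tmp; apply: cvgM.
- apply: cvg_comp; last exact: cpsi.
  move=> V nV; have {}nV : within Omega (nbhs x) V by apply: filterS nV => y Vy _.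
  by exists (V `*` setT, setT) => [|[[]] ? ? ? [[]]]//; split; [exists (V, setT); [by split; [|exact: filterT]|]|exact: filterT].
- apply: cvg_comp; last exact: cphi.
  move=> V nV.
  by exists (setT `*` V, setT) => [|[[]] ? ? ? [[]]]//; split; [exists (setT, V); [by split; [exact: filterT|]|]|exact: filterT].
Qed.

Definition two_scale_pairing (Omega : set Rd) (nu : young_data R d m)
    (i : 'I_m) (psi : Rd -> R) (phi : Z -> R) : R :=
  \int[Leb]_(x in Omega) (\int[torus_lebesgue R d]_xi
    (\int[y_nu nu x xi]_z (psi x * phi xi * z 0 i))) +
  \int[y_lambda nu]_(x in closure Omega) (\int[y_rho nu x]_xi
    (\int[y_nuinf nu x xi]_(z in @unit_sphere R m) (psi x * phi xi * z 0 i))).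

Lemma generates_pairing Omega eps (mu : nat -> vmeasure R Rd m) nu i psi phi :
  generates Omega eps mu nu -> osc_good Omega psi phi ->
  charge_integral (mu j i) (osc (eps j) psi phi) @[j --> \oo] -->
  two_scale_pairing Omega nu i psi phi.
Proof.
move=> [g [sigma [h [pol gen]]]] good.
have [[spsi [K [cK KO psi0]]] sphi] := good.
have cpsi := smooth_continuous spsi.
have cphi := torus_smooth_continuous sphi.
have := gen _ (@E2_test_integrand Omega psi phi i cpsi cphi).
rewrite /two_scale_pairing.
have -> : \int[y_lambda nu]_(x in closure Omega) (\int[y_rho nu x]_xi
    (\int[y_nuinf nu x xi]_(z in @unit_sphere R m)
      recession Omega (test_integrand psi phi i) x xi z)) =
  \int[y_lambda nu]_(x in closure Omega) (\int[y_rho nu x]_xi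
    (\int[y_nuinf nu x xi]_(z in @unit_sphere R m) (psi x * phi xi * z 0 i))).
  apply: eq_Rintegral => x /set_mem Ox; apply: eq_Rintegral => xi _.
  by apply: eq_Rintegral => z _; exact: recession_test_integrand.
apply: cvg_trans; apply: near_eq_cvg; near=> j.
have [C C0 hC] := osc_bounded good.
rewrite (polar_charge_integral i (pol j) (measurable_osc _ good) (hC _)).
(* Generation integrates over Omega and [charge_integral] over the whole space; the two agree
   because psi vanishes off Omega. *)
have mk (ms : {measure set Rd -> \bar R}) (u v : Rd -> R) :
    (forall x, Omega x -> u x = osc (eps j) psi phi x * v x) ->
    \int[ms]_(x in Omega) u x = \int[ms]_x (osc (eps j) psi phi x * v x).
  move=> uv; rewrite Rintegral_mkcond; apply: eq_Rintegral => x _; rewrite patchE.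
  case: ifPn => [/set_mem/uv//|/negP xO].
  rewrite /osc psi0 ?mul0r// => /KO Ox; by apply: xO; apply/mem_set.
congr (_ + _); apply: mk => x Ox //.
by rewrite recession_test_integrand//; exact: subset_closure.
Unshelve. all: by end_near. Qed.

End generation.

(** * The limit identity for an A-free Young measure *)

Section afree.
Context (R : realType) (d m n k : nat).
Local Notation Rd := 'rV[R]_d.
Local Notation Z := (torus R d).
Local Notation E := 'rV[R]_m.
Local Notation Leb := (lebesgue_rV R d).
Local Notation pi := (@torus_pi R d).

Lemma sobolev_norm_osc (Omega : set Rd) (q e0 : R) psi phi :
  open Omega -> bounded_set Omega -> 0 < q -> osc_good Omega psi phi ->
  exists2 c : R, 0 < c & forall (e : R) (j : 'I_n), 0 < e <= e0 ->
    sobolev_norm k q Omega (fun x => (c * e ^+ k * osc e psi phi x) *: delta_mx 0 j) <= 1.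
Proof.
move=> oO bO q0 good.
have mO : measurable Omega by exact: open_measurable_mx.
have [B B0 hB] := mpartial_osc_bounded k e0 good.
pose V := fine (Leb Omega).
have V0 : 0 <= V by exact/fine_ge0/measure_ge0.
have fO : (Leb Omega < +oo)%E by exact: lebesgue_bounded.
pose N : R := #|{: mindex d k}|%:R.
have N0 : 0 <= N by rewrite ler0n.
(* At most N derivatives contribute, each at most w V once its q-th power is below w on Omega, so w
   = 1/(N V + 1) brings the sum below 1. The constant c turns the bound B on the scaled derivatives
   into w^(1/q); adding 1 keeps the denominators positive. *)
pose w := (N * V + 1)^-1.
have NV : 0 < N * V + 1 by apply: ltr_wpDl => //; exact: mulr_ge0.
have w0 : 0 < w by rewrite invr_gt0.
pose c := w `^ q^-1 / (B + 1).
have B1 : 0 < B + 1 by apply: ltr_wpDl.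
have c0 : 0 < c by rewrite divr_gt0// powR_gt0.
exists c => // e j ee0.
have so : smooth (osc e psi phi : Rd -> R^o) by exact: smooth_osc good.1.1 good.2.
have sc : smooth (fun x => c * e ^+ k * osc e psi phi x : R^o) by exact: smoothZ.
have bnd (a : mindex d k) x : (mdegree a <= k)%N ->
    enorm (mpartial a (fun x => (c * e ^+ k * osc e psi phi x) *: (delta_mx 0 j : 'rV[R]_n)) x) `^ q <= w.
  move=> ak; rewrite /mpartial (@partials_vec _ _ _ _ (fun x => c * e ^+ k * osc e psi phi x : R^o))//.
  rewrite enormZ enorm_delta mulr1 partialsZ//.
  have -> : w = (w `^ q^-1) `^ q by rewrite -powRrM mulVf ?gt_eqF// powRr1// ltW.
  apply: ge0_ler_powR; [exact: ltW|by rewrite nnegrE|by rewrite nnegrE powR_ge0|].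
  rewrite -mulrA normrM (gtr0_norm c0).
  apply: le_trans (ler_wpM2l (ltW c0) (hB a e x ak ee0)) _.
  rewrite /c -mulrA -[leRHS]mulr1 ler_wpM2l ?powR_ge0// mulrC ler_pdivrMr// mul1r.
  by rewrite lerDl.
rewrite /sobolev_norm.
apply: (@le_trans _ _ (1 `^ q^-1)); last by rewrite powR1.
apply: ge0_ler_powR; rewrite ?nnegrE ?invr_ge0 ?(ltW q0)//.
  apply: sumr_ge0 => a _; apply: Rintegral_ge0 => x _; exact: powR_ge0.
apply: (@le_trans _ _ (\sum_(a : mindex d k) w * V)).
  rewrite [leLHS]big_mkcond/=; apply: ler_sum => a _; case: ifPn => ak; last first.
    by rewrite mulr_ge0// ltW.
  rewrite -Rintegral_cst//.
  have iw : Leb.-integrable Omega (EFin \o cst w).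
    apply/integrableP; split; first exact/measurable_EFinP/measurable_cst.
    rewrite (@eq_integral _ _ _ _ _ (cst w%:E)) => [|x _]; last by rewrite /= gtr0_norm.
    by rewrite integral_cst// lte_mul_pinfty// lee_fin ltW.
  apply: le_Rintegral => //; last by move=> x _; exact: bnd.
  apply: le_integrable iw => //.
    apply/measurable_EFinP.
    apply: (@measurableT_comp _ _ _ _ _ _ (fun r : R => r `^ q)); first exact: measurable_powR.
    apply: measurable_funTS; apply: continuous_measurable_mx.
    move=> x; apply: (@continuous_comp _ _ _ _ (@enorm R n)); last exact: enorm_continuous.
    by apply: smooth_continuous; apply: smooth_partials; exact: (smooth_vec _ sc).
  move=> x _ /=; rewrite lee_fin (ger0_norm (powR_ge0 _ _)) (gtr0_norm w0).
  exact: bnd.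
rewrite sumr_const -mulr_natl /w mulrA -/N mulrAC ler_pdivrMr// mul1r.
by rewrite lerDl.
Qed.

Lemma polar_charge_integralD (mu : vmeasure R Rd m) g sigma h i (b : R) (F G : Rd -> R) (C D : R) :
  lebesgue_polar mu g sigma h -> measurable_fun setT F -> measurable_fun setT G ->
  (forall x, `|F x| <= C) -> (forall x, `|G x| <= D) ->
  charge_integral (mu i) (fun x => b * F x + G x) =
  b * charge_integral (mu i) F + charge_integral (mu i) G.
Proof.
move=> pol mF mG bF bG.
have := @polar_charge_integral_sum _ _ _ mu g sigma h i bool [:: true; false]
  (fun t => if t then b else 1) (fun t => if t then F else G) pol.
rewrite !big_cons big_nil mul1r addr0 => <-; [|by case|by case; [exists C|exists D]].
by congr charge_integral; apply/funext => x; rewrite !big_cons big_nil mul1r addr0.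
Qed.

(** Each term is a positive power of eps, which tends to 0, times a pairing that converges by
    [generates_pairing]. *)
Lemma generates_osc_sum Omega eps (mu : nat -> vmeasure R Rd m) nu i l :
  generates Omega eps mu nu -> (forall j, 0 < eps j) -> eps @ \oo --> 0 -> osc_goods Omega l ->
  charge_integral (mu j i) (osc_sum l (eps j)) @[j --> \oo] --> 0.
Proof.
move=> gen eps0 epsc; have [g [sigma [h [pol _]]]] := gen.
elim: l => [_|[[N psi] phi] l IH [/= good gl]].
  rewrite (_ : (fun j => _) = cst 0); first exact: cvg_cst.
  apply/funext => j; have -> : @osc_sum R d [::] (eps j) = cst 0.
    by apply/funext => y; rewrite /osc_sum big_nil.
  rewrite (@polar_charge_integral _ _ _ _ _ _ _ i (cst 0) 0 (pol j))//; last by move=> x; rewrite normr0.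
  have E (ms : {measure set Rd -> \bar R}) u : \int[ms]_x (cst 0 x * u x) = 0.
    by under eq_Rintegral do rewrite mul0r; rewrite Rintegral_cst// mul0r.
  by rewrite !E addr0.
rewrite (_ : (fun j => _) = fun j => eps j ^+ N.+1 * charge_integral (mu j i) (osc (eps j) psi phi) +
    charge_integral (mu j i) (osc_sum l (eps j))); last first.
  apply/funext => j; have [C C0 hC] := osc_bounded good.
  have [D D0 hD] := osc_sum_bounded (eps j) gl.
  rewrite -(@polar_charge_integralD _ _ _ _ _ _ _ _ C D (pol j)).
  - by congr charge_integral; apply/funext => x; rewrite /osc_sum big_cons.
  - exact: measurable_osc good.
  - by apply: continuous_measurable_mx; exact: (smooth_continuous (smooth_osc_sum _ gl)).
  - by move=> x; exact: hC.
  - by move=> x; apply: hD; rewrite eps0 lexx.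
rewrite -[X in _ --> X]addr0; apply: cvgD; last exact: IH.
rewrite -[X in _ --> X](mul0r (two_scale_pairing Omega nu i psi phi)).
apply: cvgM; last exact: generates_pairing.
have -> : 0 = 0 ^+ N.+1 :> R by rewrite expr0n.
apply: (@cvg_comp _ _ _ eps (fun y : R => y ^+ N.+1) _ _ _ epsc).
exact: (@exprn_continuous R N.+1 0).
Qed.

(** The field c eps^k psi(x) phi(x/eps) e_j has Sobolev norm at most 1 with c > 0 independent of
    eps, so its pairing with A mu_eps is bounded by the dual norm and tends to 0. Up to sign, the
    same pairing tends to c times the sum, and c is divided out. *)
Lemma A_free_pairing (A : operator R d m n k) p (Omega : set Rd) (nu : young_data R d m) psi phi (j : 'I_n) :
  1 < p -> open Omega -> bounded_set Omega -> A_free A p Omega nu -> osc_good Omega psi phi ->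
  \sum_(a : mindex d k | mdegree a == k) \sum_(i < m)
    two_scale_pairing Omega nu i psi (torus_mpartial a phi) * A a i j = 0.
Proof.
move=> p1 oO bO [eps [mu [[eps0 epsd epsc] _ gen nrm]]] good.
have [[spsi [K [cK KO psi0]]] sphi] := good.
have q0 : 0 < p / (p - 1) by rewrite divr_gt0; lra.
have [c c0 hc] := sobolev_norm_osc (eps 0%N) oO bO q0 good.
have ee0 l : 0 < eps l <= eps 0%N by rewrite eps0/=; exact: epsd.
pose s l : Rd -> R^o := fun x => c * eps l ^+ k * osc (eps l) psi phi x.
have ss l : smooth (s l) by apply: smoothZ; exact: smooth_osc.
pose T l := operator_distribution A
           (fun a (phi : Rd -> R) => mpartial a (phi : Rd -> R^o))
           (distribution_of (mu l)).
pose v l : R := \sum_(a : mindex d k | mdegree a == k) \sum_(i < m)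
     charge_integral (mu l i) (mpartial a (s l)) * A a i j.
have [g [sigma [h [pol _]]]] := gen.
have Tv l : \sum_j' T l (fun x => (s l x *: (delta_mx 0 j : 'rV[R]_n)) 0 j') 0 j' = (-1) ^+ k * v l.
  rewrite (bigD1 j)//= big1 ?addr0.
    have -> : (fun x => (s l x *: (delta_mx 0 j : 'rV[R]_n)) 0 j) = s l.
      by apply/funext => x; rewrite !mxE !eqxx/= mulr1.
    rewrite /T /operator_distribution mxE summxE; congr (_ * _).
    apply: eq_bigr => a _; rewrite mxE; apply: eq_bigr => i _.
    by rewrite mxE.
  move=> j' jj'.
  have -> : (fun x => (s l x *: (delta_mx 0 j : 'rV[R]_n)) 0 j') = cst 0.
    by apply/funext => x; rewrite !mxE (negbTE jj') andbF mulr0.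
  rewrite /T /operator_distribution mxE summxE big1 ?mulr0// => a _.
  rewrite mxE big1// => i _; rewrite mxE.
  have -> : mpartial a (cst 0 : Rd -> R^o) = cst 0.
    rewrite /mpartial; elim: (flatten _) => //= i' s' ->; exact: partial_cst.
  have mc : measurable_fun setT (cst 0 : Rd -> R) by exact: measurable_cst.
  rewrite (@polar_charge_integral _ _ _ _ _ _ _ i (cst 0) 0 (pol l))//; last by move=> x; rewrite normr0.
  rewrite /=; under eq_Rintegral do rewrite mul0r.
  under [X in _ + X]eq_Rintegral do rewrite mul0r.
  by rewrite !Rintegral_cst// !mul0r addr0 mul0r.
have v0 : v l @[l --> \oo] --> 0.
  have vle l : ((`|v l|)%:E <= neg_sobolev_norm k p Omega (T l))%E.
    apply: ereal_sup_ubound => /=.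
    exists (fun x => s l x *: delta_mx 0 j); last by rewrite Tv normrM normrX normrN1 expr1n mul1r.
    split; last exact: hc.
    split; first exact: smooth_vec.
    exists K; split => // x Kx; rewrite /s /osc psi0//.
    by rewrite mul0r mulr0 scale0r.
  apply/norm_cvg0P.
  have : (`|v l|)%:E @[l --> \oo] --> 0%E.
    apply: (squeeze_cvge _ (@cvg_cst _ _ _ _ _) nrm).
    by apply: nearW => l; rewrite lee_fin normr_ge0 vle.
  by move=> /fine_cvg.
have vc : v l @[l --> \oo] --> c * \sum_(a : mindex d k | mdegree a == k) \sum_(i < m)
    two_scale_pairing Omega nu i psi (torus_mpartial a phi) * A a i j.
  rewrite mulr_sumr; under [X in _ --> X]eq_bigr do rewrite mulr_sumr.
  apply: cvg_big => // [x|a /eqP ak]; first exact: add_continuous.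
  apply: cvg_sumr => i.
  rewrite mulrA; apply: cvgMr_tmp.
  pose sq := flatten [seq nseq (a i) i | i <- enum 'I_d].
  have ssq : size sq = k by rewrite size_mindex_seq.
  have [l0 gl0 hl0] := partials_osc sq good.
  have gm : osc_good Omega psi (torus_partials sq phi).
    by split; [exact: good.1|exact: torus_smooth_partials].
  rewrite (_ : (fun l => _) = fun l => c * (1 * charge_integral (mu l i) (osc (eps l) psi (torus_partials sq phi)) +
      charge_integral (mu l i) (osc_sum l0 (eps l)))); last first.
    apply/funext => l; have [C C0 hC] := osc_bounded gm.
    have [D D0 hD] := osc_sum_bounded (eps l) gl0.
    have mG : measurable_fun setT (osc_sum l0 (eps l)).
      by apply: continuous_measurable_mx; exact: (smooth_continuous (smooth_osc_sum _ gl0)).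
    have mF := measurable_osc (eps l) gm.
    have bG x : `|osc_sum l0 (eps l) x| <= D by apply: hD; rewrite eps0 lexx.
    rewrite -(@polar_charge_integralD _ _ _ _ _ _ _ _ C D (pol l))//.
    (* The integral of 0 is added so that [polar_charge_integralD], which scales only its first
       summand, extracts the factor c. *)
    rewrite -[RHS]addr0 -[X in _ + X](_ : charge_integral (mu l i) (cst 0) = 0); last first.
      rewrite (@polar_charge_integral _ _ _ _ _ _ _ i (cst 0) 0 (pol l))//; last by move=> x; rewrite normr0.
      have E (ms : {measure set Rd -> \bar R}) u : \int[ms]_x (cst 0 x * u x) = 0.
        by under eq_Rintegral do rewrite mul0r; rewrite Rintegral_cst// mul0r.
      by rewrite !E addr0.
    rewrite -(@polar_charge_integralD _ _ _ _ _ _ _ _ (C + D) 0 (pol l))//.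
    - congr charge_integral; apply/funext => x /=; rewrite addr0 mul1r.
      rewrite /mpartial partialsZ; last exact: smooth_osc.
      rewrite -mulrA -[in X in _ ^+ X]ssq hl0//.
      by rewrite gt_eqF.
    - by apply: measurable_funD => //; exact: measurable_funM.
    - by move=> x; rewrite mul1r; apply: le_trans (ler_normD _ _) _; apply: lerD.
    - by move=> x; rewrite normr0.
  apply: cvgMl_tmp; rewrite -[X in _ --> X]addr0; apply: cvgD; last exact: (generates_osc_sum i gen eps0 epsc gl0).
  by under eq_fun do rewrite mul1r; exact: generates_pairing.
have h1 : lim (v l @[l --> \oo]) = 0 := cvg_lim (@Rhausdorff R) v0.
set S := (X in X = 0); rewrite -/S in vc.
have /eqP : c * S = 0.
  by rewrite -h1; apply/esym; exact: (cvg_lim (@Rhausdorff R) vc).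
by rewrite mulf_eq0 (gt_eqF c0)/= => /eqP.
Qed.

End afree.

(** * A Borel version of the kernel rho *)

Section depth.
Context (R : realType) (d : nat).
Local Notation Rd := 'rV[R]_d.

(* The distance to the complement of U, capped at 1. *)
Definition depth (U : set Rd) (x : Rd) : R := sup [set r | 0 <= r <= 1 /\ ball x r `<=` U].

Let depth_nonempty U (x : Rd) : [set r : R | 0 <= r <= 1 /\ ball x r `<=` U] 0.
Proof.
split; first by rewrite lexx ler01.
by move=> y; rewrite mx_norm_ball /ball_/= => /(le_lt_trans (normr_ge0 _)); rewrite ltxx.
Qed.

Let depth_has_sup U (x : Rd) : has_sup [set r : R | 0 <= r <= 1 /\ ball x r `<=` U].
Proof.
split; first by exists 0; exact: depth_nonempty.
by exists 1 => r [/andP[]].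
Qed.

Lemma depth_ge0 U x : 0 <= depth U x.
Proof. by apply: sup_ubound; [exact: (depth_has_sup U x).2|exact: depth_nonempty]. Qed.

Lemma depth_gt0 U x : open U -> (0 < depth U x) <-> U x.
Proof.
move=> oU; split.
  move=> d0; have [r [/andP[r0 r1] rU] dr] := sup_adherent d0 (depth_has_sup U x).
  rewrite subrr in dr; apply: rU; exact: ballxx.
move=> Ux; have /nbhs_ballP[e /= e0 eU] := open_nbhs_nbhs (conj oU Ux).
apply: (@lt_le_trans _ _ (Num.min e 1)); first by rewrite lt_min e0 ltr01.
apply: sup_ubound; first exact: (depth_has_sup U x).2.
split; first by rewrite le_min (ltW e0) ler01 ge_min lexx orbT.
by apply: subset_trans eU; apply: le_ball; rewrite ge_min lexx.
Qed.

Lemma depth_lipschitz U x y : depth U x <= depth U y + `|x - y|.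
Proof.
apply: ge_sup; first exact: (depth_has_sup U x).1.
move=> r [/andP[r0 r1] rU].
have [rxy|xyr] := leP r `|x - y|; first by apply: le_trans rxy _; rewrite lerDr depth_ge0.
rewrite -lerBlDr; apply: sup_ubound; first exact: (depth_has_sup U y).2.
split; first by rewrite subr_ge0 (ltW xyr)/= (le_trans _ r1)// gerBl.
move=> z; rewrite mx_norm_ball /ball_/= => yz; apply: rU; rewrite mx_norm_ball /ball_/=.
have -> : x - z = (x - y) + (y - z) by rewrite addrA subrK.
by apply: le_lt_trans (ler_normD _ _) _; rewrite -ltrBrDl.
Qed.

Lemma depth_continuous U : continuous (depth U).
Proof.
move=> x; have FF : Filter (nbhs (x : Rd)) by exact: nbhs_filter.
apply/(@cvgrPdist_lt R R^o _ _ FF) => e e0.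
apply/nbhs_ballP; exists e => //= y; rewrite mx_norm_ball /ball_/= => xy.
rewrite ltr_norml; have h1 := depth_lipschitz U x y; have h2 := depth_lipschitz U y x.
by rewrite distrC in h2; apply/andP; split; lra.
Qed.

End depth.

Section torus_open.
Context (R : realType) (d : nat).
Local Notation Rd := 'rV[R]_d.
Local Notation Z := (torus R d).
Local Notation pi := (@torus_pi R d).

(** The preimage of V is invariant under integer translations, so its depth descends to a continuous
    function on the quotient, in the role of the distance to the complement of V. *)
Lemma depth_periodic (V : set Z) : Zperiodic (depth (pi @^-1` V)).
Proof.
suff h x y : pi x = pi y -> depth (pi @^-1` V) x <= depth (pi @^-1` V) y.
  by move=> x y xy; apply/eqP; rewrite eq_le !h.
move=> xy; rewrite /depth; suff -> : [set r : R | 0 <= r <= 1 /\ ball x r `<=` pi @^-1` V] =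
  [set r : R | 0 <= r <= 1 /\ ball y r `<=` pi @^-1` V] by [].
have key u v r : pi u = pi v -> ball u r `<=` pi @^-1` V -> ball v r `<=` pi @^-1` V.
  move=> uv ur z; rewrite mx_norm_ball /ball_/= => vz.
  have -> : pi z = pi (z + (u - v)).
    apply/torus_piP => i; rewrite !mxE opprD addrA subrr sub0r rpredN.
    by move/torus_piP: uv; apply.
  apply: ur; rewrite mx_norm_ball /ball_/=.
  by rewrite opprD addrA addrAC opprB addrCA subrr addr0.
by apply/seteqP; split => r [r01 h]; split => //; apply: key h.
Qed.

Lemma torus_open_approx (V : set Z) : open V -> exists u : nat -> Z -> R,
  [/\ forall n, continuous (u n), forall n z, 0 <= u n z <= 1 &
      forall z, u ^~ z @ \oo --> (\1_V z : R)].
Proof.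
move=> oV; have oV' : open (pi @^-1` V) by exact: oV.
pose u n (z : Z) : R := Num.min 1 (n%:R * depth (pi @^-1` V) (torus_repr z)).
have uE n x : u n (pi x) = Num.min 1 (n%:R * depth (pi @^-1` V) x).
  by congr (Num.min _ (_ * _)); apply: depth_periodic; rewrite torus_reprK.
exists u; split.
- move=> n; apply/torus_continuousP.
  have -> : u n \o pi = fun x => Num.min 1 (n%:R * depth (pi @^-1` V) x).
    by apply/funext => x; exact: uE.
  move=> x; apply: (@continuous_min _ _ (cst 1) (fun x => n%:R * depth (pi @^-1` V) x)).
    exact: cst_continuous.
  by apply: (@continuousM _ _ (cst n%:R) (depth (pi @^-1` V))); [exact: cst_continuous|exact: depth_continuous].
- move=> n z; rewrite le_min ler01 mulr_ge0 ?depth_ge0//=.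
  by rewrite ge_min lexx.
- move=> z; rewrite -[z]torus_reprK; set x := torus_repr z.
  under eq_fun do rewrite uE.
  rewrite indicE; have [Vx|Vx] := pselect (V (pi x)).
    rewrite mem_set//; have d0 : 0 < depth (pi @^-1` V) x by apply/depth_gt0.
    apply: cvg_near_cst; near=> n; apply/min_idPl.
    rewrite -ler_pdivrMr// div1r; near: n; exact: nbhs_infty_ger.
  rewrite memNset//; apply: cvg_near_cst; apply: nearW => n.
  have -> : depth (pi @^-1` V) x = 0.
    apply/eqP; rewrite eq_le depth_ge0 andbT leNgt; apply/negP => /depth_gt0 h.
    by apply: Vx; apply: h.
  by rewrite mulr0; apply/min_idPr.
Unshelve. all: by end_near. Qed.

End torus_open.

Section kernel_version.
Context (R : realType) (d : nat).
Local Notation Rd := 'rV[R]_d.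
Local Notation Z := (torus R d).
Local Notation pi := (@torus_pi R d).

(** Indicators of open sets are pointwise limits of continuous functions with values in [0, 1], and
    open sets form a pi-system that generates the Borel sets. *)
Lemma measurable_kernel_of_continuous t (X : measurableType t) (P : X -> probability Z R) :
  (forall h : Z -> R, continuous h -> measurable_fun setT (fun x => \int[P x]_z h z)) ->
  forall U, measurable U -> measurable_fun setT (fun x => P x U).
Proof.
move=> hP.
pose H := [set U : set Z | measurable U /\ measurable_fun setT (fun x => P x U)].
suff : @measurable _ Z `<=` H by move=> h U /h[].
have dH : dynkin H.
  split.
  - split => //; rewrite (_ : (fun x => _) = cst 1%E); first exact: measurable_cst.
    by apply/funext => x; rewrite probability_setT.
  - move=> U [mU hU]; split; first exact: measurableC.
    rewrite (_ : (fun x => _) = fun x => (1 - P x U)%E).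
      by apply: emeasurable_funB => //; exact: measurable_cst.
    by apply/funext => x; rewrite probability_setC.
  - move=> F tF HF; split; first by apply: bigcupT_measurable => n; exact: (HF n).1.
    rewrite (_ : (fun x => _) = fun x => (\sum_(0 <= n <oo) P x (F n))%E).
      by apply: ge0_emeasurable_sum => // n _; exact: (HF n).2.
    apply/funext => x; rewrite measure_bigcup//=; first by apply: eq_eseriesl => n; exact/mem_set.
    by move=> n _; exact: (HF n).1.
apply: (@lambda_system_subset _ (@open Z) _ setT H).
- by move=> A B oA oB; exact: openI.
- exact/dynkin_lambda_system.
- move=> V oV; have mV : measurable V by exact: sub_sigma_algebra.
  split => //.
  have [u [cu u01 uV]] := torus_open_approx oV.
  have mu n : measurable_fun setT (u n) by exact: continuous_measurable_torus.
  have fV : measurable_fun setT (fun x => fine (P x V)).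
    apply: (@measurable_fun_cvg _ _ _ _ (fun n x => \int[P x]_z u n z)) => [n|x _].
      exact: hP.
    have -> : fine (P x V) = \int[P x]_z \1_V z.
      by rewrite /Rintegral integral_indic// setIT.
    apply: (@cvg_Rintegral_dominated _ _ _ _ _ _ (cst 1)) => //.
      exact: finite_measure_integrable_cst.
    by move=> n z; have /andP[u0 u1] := u01 n z; rewrite ger0_norm.
  rewrite (_ : (fun x => _) = EFin \o (fun x => fine (P x V))); first exact/measurable_EFinP.
  by apply/funext => x /=; rewrite fineK// fin_num_measure.
- by [].
Qed.

(** Weak-* measurability gives one exceptional set per test function; a dense sequence of continuous
    functions reduces them to a single null set N. On N and off D the kernel is replaced by the
    constant [torus_lebesgue], after which the integral of every continuous function is a uniform
    limit of Borel functions. *)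
Lemma kernel_version (lambda : {finite_measure set Rd -> \bar R}) (D : set Rd)
    (rho : Rd -> probability Z R) : measurable D ->
  weakstar_measurable lambda D setT (C0 [set: Z]) rho ->
  exists (rho' : Rd -> probability Z R) (N : set Rd),
    [/\ measurable N, lambda N = 0%E,
      forall U, measurable U -> measurable_fun setT (fun x => rho' x U) &
      forall x, D x -> ~ N x -> rho x = rho' x].
Proof.
move=> mD wm.
(* The density lemma with a single index and no derivative gives density in the uniform norm. *)
have [||h_ [ch_ dense]] := @torus_dense_sequence R d unit (Z -> R) (fun h => continuous h) (fun _ h => h).
- by exists (cst 0); exact: cst_continuous.
- by [].
have C0c (h : Z -> R) : continuous h -> C0 [set: Z] h.
  move=> c_h; split; first exact: continuous_subspaceT.
  by move=> e e0; exists setT; split => //; exact: torus_compact.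
have /choice[g hg] n : exists gN : (Rd -> R) * set Rd, [/\ measurable_fun D gN.1,
    measurable gN.2, lambda gN.2 = 0%E &
    forall x, D x -> ~ gN.2 x -> \int[rho x]_z h_ n z = gN.1 x].
  have [g mg [N [mN N0 hN]]] := wm _ (C0c _ (ch_ n)).
  exists (g, N); split => //= x Dx Nx; apply: contrapT => h; apply: Nx; apply: hN => /=.
  by move=> /(_ Dx).
pose N := \bigcup_n (g n).2.
have mN : measurable N by apply: bigcupT_measurable => n; have [] := hg n.
have N0 : lambda N = 0%E.
  have [B [mB B0 NB]] : lambda.-negligible N.
    apply: negligible_bigcup => n; have [_ mgn gn0 _] := hg n.
    by exists (g n).2; split.
  exact: subset_measure0 B0.
pose S := D `\` N.
have mS : measurable S by exact: measurableD.
pose rho' x : probability Z R := if x \in S then rho x else torus_lebesgue R d.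
exists rho', N; split => //; last first.
  by move=> x Dx Nx; rewrite /rho' mem_set.
apply: measurable_kernel_of_continuous => h c_h.
have mh n : measurable_fun setT (fun x => \int[rho' x]_z h_ n z).
  rewrite -(setUv S); apply/measurable_funU => //; first exact: measurableC.
  split.
    apply: (@eq_measurable_fun _ _ _ _ _ (g n).1).
      move=> x /set_mem Sx; rewrite /rho' mem_set//.
      have [_ _ _ ->//] := hg n; first exact: Sx.1.
      by move=> gx; apply: Sx.2; exists n.
    by have [mg _ _ _] := hg n; apply: measurable_funS mg => //; exact: subDsetl.
  apply: (@eq_measurable_fun _ _ _ _ _ (cst (\int[torus_lebesgue R d]_z h_ n z))).
    by move=> x /set_mem Sx; rewrite /rho' memNset.
  exact: measurable_cst.
have /choice[s hs] k : exists n, forall z, `|h z - h_ n z| <= k.+1%:R^-1.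
  by have [//|n hn] := dense h k.+1%:R^-1 c_h; exists n => z; exact: hn tt z.
apply: (@measurable_fun_cvg _ _ _ _ (fun k x => \int[rho' x]_z h_ (s k) z)) => // x _.
have ic (u : Z -> R) : continuous u -> (rho' x).-integrable setT (EFin \o u).
  move=> cu; have [C _ hC] := continuous_torus_bounded cu.
  exact: bounded_integrable (continuous_measurable_torus cu) hC.
apply/cvgrPdist_le => e e0; near=> k.
rewrite -RintegralB//; [|exact: ic|exact/ic/ch_].
have iB : (rho' x).-integrable setT (EFin \o (fun z => h z - h_ (s k) z)).
  by apply: ic => z; apply: (@continuousB _ _ _ h (h_ (s k))); [exact: c_h|exact: ch_].
apply: le_trans (le_normr_Rintegral measurableT iB) _.
apply: (@le_trans _ _ (\int[rho' x]_z (cst k.+1%:R^-1 z))).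
  apply: le_Rintegral => //; first exact: (integrable_abse iB).
  exact: finite_measure_integrable_cst.
rewrite Rintegral_cst// [X in fine X](probability_setT (rho' x)) mulr1.
apply: ltW; near: k; exact: (near_infty_natSinv_lt (PosNum e0)).
Unshelve. all: by end_near. Qed.

End kernel_version.

(** * Boxes determine a signed measure on an open set *)

Section boxes.
Context (R : realType) (d : nat) (d0 : (0 < d)%N).
Local Notation Rd := 'rV[R]_d.

Lemma measurable_box (a b : Rd) : measurable (box a b).
Proof.
rewrite (_ : box a b = \bigcap_(i in [set: 'I_d]) ((fun x : Rd => x 0 i) @^-1` `]a 0 i, b 0 i[)).
  apply: fin_bigcap_measurable => // i _; rewrite -[X in measurable X]setTI.
  by apply: continuous_measurable_mx => //; move=> x; exact: coord_continuous.
apply/seteqP; split => x /= h i.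
  by move=> _ /=; rewrite in_itv/=; exact: h.
by have := h i Logic.I; rewrite /= in_itv.
Qed.

Lemma boxI (a b a' b' : Rd) :
  box a b `&` box a' b' = box (\row_i Num.max (a 0 i) (a' 0 i)) (\row_i Num.min (b 0 i) (b' 0 i)).
Proof.
apply/seteqP; split => x /=.
  move=> [h h'] i; rewrite !mxE gt_max lt_min.
  by have /andP[-> ->] := h i; have /andP[-> ->] := h' i.
by move=> h; split => i; have := h i; rewrite !mxE gt_max lt_min => /andP[/andP[? ?] /andP[? ?]];
  apply/andP.
Qed.

Lemma cboxI_sub (a b a' b' : Rd) :
  cbox (\row_i Num.max (a 0 i) (a' 0 i)) (\row_i Num.min (b 0 i) (b' 0 i)) `<=` cbox a b.
Proof.
by move=> x h i; have := h i; rewrite !mxE ge_max le_min => /andP[/andP[? ?] /andP[? ?]];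
  apply/andP.
Qed.

Lemma open_bigcup_box (U : set Rd) : open U -> exists ab : nat -> Rd * Rd,
  (forall n, cbox (ab n).1 (ab n).2 `<=` U) /\ U = \bigcup_n box (ab n).1 (ab n).2.
Proof.
move=> oU.
pose r (k : nat) : R := k.+1%:R^-1.
have r0 k : 0 < r k by rewrite invr_gt0.
pose lo (c : 'rV[rat]_d * nat) : Rd := \row_i (ratr (c.1 0 i) - r c.2).
pose hi (c : 'rV[rat]_d * nat) : Rd := \row_i (ratr (c.1 0 i) + r c.2).
(* The default pair must have an empty closed box, to satisfy the inclusion in U. Here d > 0 enters:
   in dimension 0 every box is the whole space. *)
pose e : Rd * Rd := (const_mx 1, const_mx 0).
have ce : cbox e.1 e.2 = set0.
  apply/seteqP; split => // x /(_ (Ordinal d0)); rewrite !mxE => /andP[h1 h2].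
  by have := le_trans h1 h2; rewrite leNgt ltr01.
have be : box e.1 e.2 = set0.
  by rewrite -subset0 -ce => x h i; have /andP[/ltW-> /ltW->] := h i.
pose ab n : Rd * Rd := if (choice.unpickle n : option ('rV[rat]_d * nat)) is Some c then
  (if pselect (cbox (lo c) (hi c) `<=` U) then (lo c, hi c) else e) else e.
have abU n : cbox (ab n).1 (ab n).2 `<=` U.
  rewrite /ab; case: choice.unpickle => [c|]; last by rewrite ce.
  by case: pselect => //= _; rewrite ce.
exists ab; split => //; apply/seteqP; split; last first.
  move=> x [n _ xn]; apply: (abU n) => i.
  by have /andP[/ltW-> /ltW->] := xn i.
move=> x Ux; have /nbhs_ballP[s /= s0 sU] := open_nbhs_nbhs (conj oU Ux).
have [k ks] : exists k : nat, r k < s / 2.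
  have s20 : 0 < s / 2 by rewrite divr_gt0.
  by have [k _ /(_ _ (leqnn k))] := near_infty_natSinv_lt (PosNum s20); exists k.
have /choice[q hq] (i : 'I_d) : exists q : rat, x 0 i - r k < ratr q < x 0 i + r k.
  have [|q] := @rat_in_itvoo R (x 0 i - r k) (x 0 i + r k).
    by have := r0 k; lra.
  by rewrite in_itv/=; exists q.
pose c : 'rV[rat]_d * nat := (\row_i q i, k).
have cU : cbox (lo c) (hi c) `<=` U.
  move=> y yc; apply: sU; split => // i j; rewrite ord1.
  have := yc j; rewrite !mxE /= => /andP[y1 y2].
  have /andP[q1 q2] := hq j.
  by rewrite /ball/= ltr_norml; apply/andP; split; lra.
exists (choice.pickle c) => //; rewrite /ab choice.pickleK; case: pselect => //= _.
by move=> i; rewrite !mxE /=; have /andP[q1 q2] := hq i; apply/andP; split; lra.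
Qed.

(** A Dynkin argument needs a total set of charge 0, and the whole space is not known to be one. It
    is run inside each box whose closed box lies in Omega; then Omega is cut into countably many
    disjoint pieces of such boxes. *)
Lemma box_charge_eq0 (Omega : set Rd) (chi : {charge set Rd -> \bar R}) : open Omega ->
  (forall a b, cbox a b `<=` Omega -> chi (box a b) = 0%E) ->
  forall S, measurable S -> S `<=` Omega -> chi S = 0%E.
Proof.
move=> oO hchi.
have loc a b : cbox a b `<=` Omega -> forall S, measurable S -> chi (S `&` box a b) = 0%E.
  move=> abO.
  have mb := measurable_box a b.
  pose H := [set S : set Rd | measurable S /\ chi (S `&` box a b) = 0%E].
  suff : <<s [set S | exists a b, S = box a b] >> `<=` H.
    move=> sub S mS; suff /sub[] : <<s [set S | exists a b, S = box a b] >> S by [].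
    move: S mS; apply: smallest_sub; first exact: smallest_sigma_algebra.
    move=> U oU; have [ab [_ ->]] := open_bigcup_box oU.
    apply: sigma_algebra_bigcup => n; apply: sub_sigma_algebra.
    by exists (ab n).1, (ab n).2.
  have dH : dynkin H.
    split.
    - by split => //; rewrite setTI hchi.
    - move=> U [mU hU]; split; first exact: measurableC.
      have := @chargeU _ _ _ chi (~` U `&` box a b) (U `&` box a b).
      rewrite -setIUl setUC setUv setTI hU adde0 hchi// => h; apply/esym/h.
      + by apply: measurableI => //; exact: measurableC.
      + exact: measurableI.
      + by rewrite setIACA setICl set0I.
    - move=> F tF HF; split; first by apply: bigcupT_measurable => n; exact: (HF n).1.
      rewrite setI_bigcupl.
      have := @charge_semi_sigma_additive _ _ _ chi (fun n => F n `&` box a b).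
      have tFb : trivIset setT (fun n => F n `&` box a b).
        move=> i j _ _ [x [[Fi _] [Fj _]]]; apply: tF => //; by exists x.
      move=> /(_ (fun n => measurableI _ _ (HF n).1 mb) tFb).
      have mU : measurable (\bigcup_n F n) by apply: bigcupT_measurable => n; exact: (HF n).1.
      rewrite -setI_bigcupl => /(_ (measurableI _ _ mU mb)).
      rewrite (_ : (fun n => _) = cst 0%E); last first.
        by apply/funext => n; rewrite big1// => i _; exact: (HF i).2.
      by move=> /cvg_lim <- //; rewrite lim_cst.
  apply: lambda_system_subset => //.
  - move=> _ _ [a1 [b1 ->]] [a2 [b2 ->]]; rewrite boxI.
    by do 2 eexists.
  - exact/dynkin_lambda_system.
  - move=> _ [a1 [b1 ->]]; split; first exact: measurable_box.
    rewrite setIC boxI hchi//; apply: subset_trans abO; exact: cboxI_sub.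
move=> S mS SO; have [ab [abO OE]] := open_bigcup_box oO.
pose B n := box (ab n).1 (ab n).2.
have mB n : measurable (B n) by exact: measurable_box.
(* Disjoint pieces of S, each contained in one of the boxes that cover Omega. *)
pose F n := S `&` seqDU B n.
have mF n : measurable (F n).
  by apply: measurableI => //; apply: measurableD => //; exact: bigsetU_measurable.
have SE : S = \bigcup_n F n.
  by rewrite -setI_bigcupr -seqDU_bigcup_eq -OE setIidl.
have := @charge_semi_sigma_additive _ _ _ chi F mF.
rewrite -SE => /(_ _ mS) => h0; have {h0} := fun t => h0 t.
rewrite (_ : (fun n => _) = cst 0%E); last first.
  apply/funext => n; rewrite big1// => i _.
  rewrite (_ : F i = F i `&` box (ab i).1 (ab i).2); first exact: loc.
  by rewrite /F -setIA; congr (_ `&` _); rewrite setIidl//; exact: subDsetl.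
move=> h; have {}h := h _.
suff tF : trivIset setT F by move: (h tF) => /cvg_lim <- //; rewrite lim_cst.
by apply: trivIset_setIl; exact: trivIset_seqDU.
Qed.

Lemma box_fun_determine (Omega : set Rd) (mu1 mu2 : {measure set Rd -> \bar R}) (H1 H2 : Rd -> R) :
  open Omega -> mu1.-integrable setT (EFin \o H1) -> mu2.-integrable setT (EFin \o H2) ->
  (forall a b n, cbox a b `<=` Omega ->
    \int[mu1]_x (box_fun a b n x * H1 x) + \int[mu2]_x (box_fun a b n x * H2 x) = 0) ->
  forall S, measurable S -> S `<=` Omega -> \int[mu1]_(x in S) H1 x + \int[mu2]_(x in S) H2 x = 0.
Proof.
move=> oO i1 i2 hb.
pose chi : {charge set Rd -> \bar R} := cadd (induced_charge i1) (induced_charge i2).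
have chiE S : measurable S -> chi S = (\int[mu1]_(x in S) H1 x + \int[mu2]_(x in S) H2 x)%:E.
  move=> mS; have f1 : (\int[mu1]_(x in S) (H1 x)%:E)%E \is a fin_num.
    by apply: integrable_fin_num => //; apply: (integrableS _ _ _ i1).
  have f2 : (\int[mu2]_(x in S) (H2 x)%:E)%E \is a fin_num.
    by apply: integrable_fin_num => //; apply: (integrableS _ _ _ i2).
  by rewrite /chi /cadd /= /induced_charge /Rintegral EFinD !fineK.
suff h S : measurable S -> S `<=` Omega -> chi S = 0%E.
  by move=> S mS SO; have := h S mS SO; rewrite chiE// => -[].
apply: box_charge_eq0 => // a b abO; rewrite chiE; last exact: measurable_box.
congr EFin.
have ind (ms : {measure set Rd -> \bar R}) (H : Rd -> R) : ms.-integrable setT (EFin \o H) ->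
  \int[ms]_x (box_fun a b n x * H x) @[n --> \oo] --> \int[ms]_(x in box a b) H x.
  move=> iH; have mH : measurable_fun setT H by apply/measurable_EFinP; exact: measurable_int iH.
  have -> : \int[ms]_(x in box a b) H x = \int[ms]_x (\1_(box a b) x * H x).
    rewrite Rintegral_mkcond; apply: eq_Rintegral => x _; rewrite patchE indicE.
    by case: ifPn => xab; rewrite ?mul1r ?mul0r.
  apply: (@cvg_Rintegral_dominated _ _ _ _ _ _ (fun x => `|H x|)).
  - move=> n; apply: measurable_funM => //; apply: continuous_measurable_mx.
    exact: (smooth_continuous (smooth_box_fun a b n)).
  - by move=> x; apply: cvgMr_tmp; exact: box_fun_cvg.
  - exact: (integrable_abse iH).
  - move=> n x; have /andP[h1 h2] := box_fun_01 a b n x.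
    by rewrite normrM (ger0_norm h1) ler_piMl.
have := cvgD (ind mu1 H1 i1) (ind mu2 H2 i2).
rewrite (_ : (fun n => _) + (fun n => _) = cst 0).
  move=> h; have {}h := h ltac:(typeclasses eauto).
  by rewrite -(cvg_lim (@Rhausdorff R) h) lim_cst.
by apply/funext => n; exact: hb.
Qed.

Lemma ae_eq0_of_integrals t (T : measurableType t) (mu : {measure set T -> \bar R}) (E : set T) (F : T -> R) :
  measurable E -> mu.-integrable setT (EFin \o F) ->
  (forall S, measurable S -> S `<=` E -> \int[mu]_(x in S) F x = 0) ->
  {ae mu, forall x, E x -> F x = 0}.
Proof.
move=> mE iF hS.
have mF : measurable_fun setT F by apply/measurable_EFinP; exact: measurable_int iF.
have key (s : R) (P := E `&` [set x | 0 < s * F x]) : (s == 1) || (s == -1) -> measurable P /\ mu P = 0%E.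
  move=> s1; have mP : measurable P.
    apply: measurableI => //; rewrite -[X in measurable X]setTI.
    rewrite (_ : [set x | _] = (fun x => s * F x) @^-1` `]0, +oo[).
      by apply: (measurable_funM (measurable_cst s) mF).
    by apply/seteqP; split => x /=; rewrite in_itv/= andbT.
  split => //.
  have P0 : (\int[mu]_(x in P) `|(F x)%:E| = 0)%E.
    have iP : mu.-integrable P (EFin \o F) by exact: integrableS iF.
    transitivity (\int[mu]_(x in P) (s%:E * (F x)%:E))%E.
      apply: eq_integral => x /set_mem [_ /= sF]; rewrite /= -EFinM; congr EFin.
      rewrite -[RHS]gtr0_norm// normrM.
      by case/orP: s1 => /eqP ->; rewrite ?normrN1 ?normr1 mul1r.
    rewrite integralZl//.
    have := hS P mP (@subIsetl _ _ _); rewrite /Rintegral => h.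
    rewrite -[X in (_ * X)%E]fineK; last exact: integrable_fin_num.
    by rewrite h mule0.
  have [N [mN N0 PN]] : ae_eq mu P (EFin \o F) (cst 0%E).
    by apply/ae_eq_integral_abs => //; exact/measurable_EFinP/measurable_funTS.
  apply: subset_measure0 N0 => // x Px; apply: PN => /= /(_ Px)[F0].
  by move: Px => [_ /=]; rewrite F0 mulr0 ltxx.
have [|mp p0] := key 1; first by rewrite eqxx.
have [|mn n0] := key (-1); first by rewrite eqxx orbT.
exists ((E `&` [set x | 0 < 1 * F x]) `|` (E `&` [set x | 0 < -1 * F x])); split.
- exact: measurableU.
- by rewrite null_set_setU.
- move=> x /= /not_implyP[Ex /eqP Fx]; rewrite mul1r mulN1r oppr_gt0.
  by have [h|h|h] := ltgtP (F x) 0; [right|left|rewrite h eqxx in Fx].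
Qed.

End boxes.

(** * Borel first moments of nu *)

Section cutoff.
Context (R : realType) (m : nat).
Local Notation E := 'rV[R]_m.

Lemma norm_le_enorm (z : E) : `|z| <= enorm z.
Proof.
rewrite -[leLHS]/(mx_norm z) mx_normrE; apply: bigmax_le; first exact: enorm_ge0.
by move=> [i j] _ /=; rewrite ord1; exact: enorm_coord.
Qed.

Lemma compact_enorm_ball (r : R) : compact [set z : E | enorm z <= r].
Proof.
apply: bounded_closed_compact.
  exists r; split; first exact: num_real.
  by move=> s rs z /= zr; apply: le_trans (norm_le_enorm z) (le_trans zr (ltW rs)).
rewrite (_ : [set z : E | _] = @enorm R m @^-1` [set t | t <= r])//.
apply: closed_comp; last exact: closed_le.
by move=> z _; exact: enorm_continuous.
Qed.

Lemma compact_unit_sphere : compact (@unit_sphere R m).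
Proof.
apply: (subclosed_compact _ (@compact_enorm_ball 1)); last by move=> z /= ->.
rewrite (_ : @unit_sphere R m = @enorm R m @^-1` [set 1])//.
apply: closed_comp; last exact: closed_eq.
by move=> z _; exact: enorm_continuous.
Qed.

(** Only functions in C_0(E) may be tested, and the coordinates and the norm are unbounded.
    Multiplied by this function, which is 1 up to radius n and 0 from radius n + 1 on, they become
    admissible. *)
Definition cutoff (n : nat) (z : E) : R := Num.max 0 (Num.min 1 (n%:R + 1 - enorm z)).

Lemma cutoff_01 n z : 0 <= cutoff n z <= 1.
Proof. by rewrite /cutoff le_max lexx/= ge_max ler01 ge_min lexx. Qed.

Lemma cutoff_eq0 n z : n%:R + 1 < enorm z -> cutoff n z = 0.
Proof.
move=> h; rewrite /cutoff; apply/max_idPl; rewrite ge_min; apply/orP; right.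
by rewrite subr_le0 ltW.
Qed.

Lemma cutoff_cvg z : cutoff n z @[n --> \oo] --> (1 : R).
Proof.
apply: cvg_near_cst; near=> n; rewrite /cutoff (_ : Num.min _ _ = 1).
  by apply/max_idPr.
apply/min_idPl; rewrite lerBrDl [leRHS]addrC [leLHS]addrC lerD2l.
by near: n; exact: nbhs_infty_ger.
Unshelve. all: by end_near. Qed.

Lemma cutoff_nd z n p : (n <= p)%N -> cutoff n z <= cutoff p z.
Proof.
move=> np; rewrite /cutoff ge_max le_max lexx/= le_max; apply/orP; right.
by rewrite le_min ge_min lexx/= ge_min; apply/orP; right; rewrite lerD2r lerD2r ler_nat.
Qed.

Lemma cutoff_continuous n : continuous (cutoff n).
Proof.
move=> z; apply: (@continuous_max _ _ (cst 0) (fun z => Num.min 1 (n%:R + 1 - enorm z))).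
  exact: cst_continuous.
apply: (@continuous_min _ _ (cst 1) (fun z => n%:R + 1 - enorm z)).
  exact: cst_continuous.
have FF : Filter (nbhs (z : E)) by exact: nbhs_filter.
by apply: (@cvgB R R^o _ _ FF (cst (n%:R + 1)) (@enorm R m)); [exact: cst_continuous|exact: enorm_continuous].
Qed.

Lemma C0_cutoff n (f : E -> R) : continuous f -> C0 [set: E] (fun z => f z * cutoff n z).
Proof.
move=> cf; split.
  apply: continuous_subspaceT => z.
  by apply: (@continuousM _ _ f (cutoff n)); [exact: cf|exact: cutoff_continuous].
move=> e e0; exists [set z : E | enorm z <= n%:R + 1]; split => //.
  exact: compact_enorm_ball.
move=> z _ /= /negP; rewrite -ltNge => /cutoff_eq0 ->.
by rewrite mulr0 normr0.
Qed.

End cutoff.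

Section nu_version.
Context (R : realType) (d m : nat).
Local Notation Rd := 'rV[R]_d.
Local Notation Z := (torus R d).
Local Notation E := 'rV[R]_m.
Local Notation LZ := (lebesgue_rV R d \x torus_lebesgue R d)%E.

Lemma ae_measurable_seq t (T : measurableType t) (mu : {measure set T -> \bar R}) (D : set T)
    (I : countType) (f : I -> T -> R) :
  (forall i, ae_measurable mu D (f i)) ->
  exists (u : I -> T -> R) (N : set T), [/\ measurable N, mu N = 0%E,
    forall i, measurable_fun D (u i) & forall i x, D x -> ~ N x -> f i x = u i x].
Proof.
move=> hf.
have /choice[g hg] i : exists gN : (T -> R) * set T, [/\ measurable_fun D gN.1,
    measurable gN.2, mu gN.2 = 0%E &
    forall x, D x -> ~ gN.2 x -> f i x = gN.1 x].
  have [g mg [N [mN N0 hN]]] := hf i.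
  exists (g, N); split => //= x Dx Nx; apply: contrapT => h; apply: Nx; apply: hN => /=.
  by move=> /(_ Dx).
pose F n := if (choice.unpickle n : option I) is Some i then (g i).2 else set0.
have mF n : measurable (F n).
  by rewrite /F; case: choice.unpickle => // i; have [] := hg i.
have F0 n : mu (F n) = 0%E.
  by rewrite /F; case: choice.unpickle => [i|]; [have [] := hg i|rewrite measure0].
exists (fun i => (g i).1), (\bigcup_n F n); split.
- exact: bigcupT_measurable.
- have [B [mB B0 NB]] : mu.-negligible (\bigcup_n F n).
    by apply: negligible_bigcup => n; exists (F n); split.
  by apply: subset_measure0 B0 => //; exact: bigcupT_measurable.
- by move=> i; have [] := hg i.
- move=> i x Dx Nx; have [_ _ _ ->//] := hg i.
  by move=> gx; apply: Nx; exists (choice.pickle i) => //; rewrite /F choice.pickleK.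
Qed.

(** The truncated moments are Borel off a null set. Their monotone limit w, the moment of the norm,
    is Borel there and integrable, hence finite off a further null set; where it is finite,
    dominated convergence makes the coordinate moments Borel, with w as an integrable bound. *)
Lemma nu_version (D : set (Rd * Z)) (kap : Rd * Z -> probability E R) : measurable D ->
  weakstar_measurable LZ D setT (C0 [set: E]) kap ->
  (\int[LZ]_(q in D) \int[kap q]_z (enorm z)%:E < +oo)%E ->
  exists (g : 'I_m -> Rd * Z -> R) (N : set (Rd * Z)),
    [/\ measurable N /\ LZ N = 0%E,
       forall i, LZ.-integrable setT (EFin \o g i) &
       forall q, D q -> ~ N q -> (kap q).-integrable setT (EFin \o @enorm R m) /\
          forall i, \int[kap q]_z z 0 i = g i q].
Proof.
move=> mD wm fin.
(* [None] stands for the norm and [Some i] for a coordinate, so that one null set serves all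
   truncated moments. *)
pose F (o : option 'I_m) (z : E) : R := if o is Some i then z 0 i else enorm z.
have cF o : continuous (F o).
  by case: o => [i|] z /=; [exact: coord_continuous|exact: enorm_continuous].
have mFm o : measurable_fun setT (F o) by exact: continuous_measurable_mx.
have Fle o z : `|F o z| <= enorm z.
  by case: o => [i|] /=; [exact: enorm_coord|rewrite ger0_norm// enorm_ge0].
have mc n : measurable_fun setT (@cutoff R m n).
  by apply: continuous_measurable_mx; exact: cutoff_continuous.
have [u [N1 [mN1 N10 mu uE]]] := @ae_measurable_seq _ _ LZ D (option 'I_m * nat)%type
  (fun p q => \int[kap q]_z (F p.1 z * cutoff p.2 z)) (fun p => wm _ (C0_cutoff p.2 (cF p.1))).
pose w q := (\int[kap q]_z (enorm z)%:E)%E.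
pose S1 := D `\` N1.
have mS1 : measurable S1 by exact: measurableD.
have bnd n q : (kap q).-integrable setT (EFin \o (fun z => enorm z * cutoff n z)).
  apply: (@bounded_integrable _ _ _ _ _ (n%:R + 1)).
    by apply: measurable_funM => //; exact: (mFm None).
  move=> z; have /andP[c0 c1] := cutoff_01 n z; rewrite normrM (ger0_norm c0) (ger0_norm (enorm_ge0 _)).
  have [h|h] := leP (enorm z) (n%:R + 1); last by rewrite cutoff_eq0// mulr0 addr_ge0.
  by rewrite -[leRHS]mulr1; apply: ler_pM => //; exact: enorm_ge0.
have wcvg q : (\int[kap q]_z (enorm z * cutoff n z)%:E)%E @[n --> \oo] --> w q.
  have -> : w q = (\int[kap q]_z (limn (fun n => (enorm z * cutoff n z)%:E)))%E.
    apply: eq_integral => z _; apply/esym/cvg_lim => //.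
    apply/fine_cvgP; split; first exact: nearW.
    by rewrite -[X in _ --> X]mulr1; apply: cvgMl_tmp; exact: cutoff_cvg.
  apply: (@cvg_monotone_convergence _ _ _ (kap q) setT measurableT (fun n z => (enorm z * cutoff n z)%:E)).
  - by move=> n; apply/measurable_EFinP/measurable_funM => //; exact: (mFm None).
  - by move=> n z _; rewrite lee_fin mulr_ge0 ?enorm_ge0//; have /andP[] := cutoff_01 n z.
  - by move=> z _ n p np; rewrite lee_fin ler_wpM2l ?enorm_ge0// cutoff_nd.
have mw : measurable_fun S1 w.
  apply: (@emeasurable_fun_cvg _ _ _ _ (fun n q => (u (None, n) q)%:E)).
    move=> n; apply/measurable_EFinP; apply: measurable_funS (mu (None, n)) => //.
    exact: subDsetl.
  move=> q [Dq Nq]; have := wcvg q; apply: cvg_trans; apply: near_eq_cvg.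
  apply: nearW => n; rewrite -uE//= /Rintegral fineK//.
  exact: (integrable_fin_num measurableT (bnd n q)).
have w0 q : (0 <= w q)%E by apply: integral_ge0 => z _; rewrite lee_fin enorm_ge0.
have iw : LZ.-integrable S1 w.
  apply/integrableP; split => //; under eq_integral do rewrite gee0_abs//.
  (* The integrand of [fin] need not be measurable on D, but its integral equals the one over S1,
     since D and S1 differ by a null set. *)
  apply: le_lt_trans fin; rewrite le_eqVlt; apply/orP; left; apply/eqP.
  rewrite integral_mkcond [RHS]integral_mkcond; apply: ae_eq_integral_nonmeasurable.
  exists N1; split => // q /= /not_implyP[_]; apply: contra_notP => Nq.
  rewrite !patchE; congr (if _ then _ else _).
  by apply/idP/idP => /set_mem h; apply/mem_set; [exact: h.1|split].
have [N2 [mN2 N20 hN2]] := integrable_ae mS1 iw.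
pose N := N1 `|` N2.
have mN : measurable N by exact: measurableU.
pose S := D `\` N.
have mS : measurable S by exact: measurableD.
have SS1 : S `<=` S1 by move=> q [Dq Nq]; split => // Nq1; apply: Nq; left.
have Sw q : S q -> (kap q).-integrable setT (EFin \o @enorm R m).
  move=> Sq; apply/integrableP; split; first by apply/measurable_EFinP; exact: (mFm None).
  under eq_integral do rewrite /= ger0_norm ?enorm_ge0//.
  rewrite -ge0_fin_numE//; last exact: w0.
  apply: contrapT => h; apply: Sq.2; right; apply: hN2 => /= h'; apply: h.
  by apply: h'; exact: SS1.
pose b i q := \int[kap q]_z z 0 i.
have mb i : measurable_fun S (b i).
  apply: (@measurable_fun_cvg _ _ _ _ (fun n q => u (Some i, n) q)).
    by move=> n; apply: measurable_funS (mu (Some i, n)) => // q [].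
  move=> q Sq.
  have -> : (fun n => u (Some i, n) q) = (fun n => \int[kap q]_z (z 0 i * cutoff n z)).
    by apply/funext => n; rewrite -uE//; [exact: Sq.1|move=> h; apply: Sq.2; left].
  apply: (@cvg_Rintegral_dominated _ _ _ _ _ _ (@enorm R m)).
  - by move=> n; apply: measurable_funM => //; exact: (mFm (Some i)).
  - move=> z; rewrite -[X in _ --> X]mulr1; apply: cvgMl_tmp; exact: cutoff_cvg.
  - exact: Sw.
  - move=> n z; have /andP[c0 c1] := cutoff_01 n z; rewrite normrM (ger0_norm c0).
    by apply: le_trans (Fle (Some i) z); rewrite ler_piMr.
have bw i q : S q -> (`|(b i q)%:E| <= w q)%E.
  move=> Sq; have ie := Sw q Sq.
  have iz : (kap q).-integrable setT (EFin \o (fun z : E => z 0 i)).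
    apply: le_integrable ie => //; first by apply/measurable_EFinP; exact: (mFm (Some i)).
    by move=> z _; rewrite /= lee_fin (ger0_norm (enorm_ge0 _)) enorm_coord.
  rewrite /b -[leLHS]/((`| \int[kap q]_z z 0 i |)%:E) EFin_normr_Rintegral//.
  apply: le_trans (le_abse_integral _ _ _) _ => //; first by case/integrableP: iz.
  apply: ge0_le_integral => //.
  - by apply: measurableT_comp => //; apply/measurable_EFinP; exact: (mFm (Some i)).
  - by apply/measurable_EFinP; exact: (mFm None).
  - by move=> z _; rewrite lee_fin enorm_coord.
exists (fun i => b i \_ S), N; split.
- by split => //; rewrite null_set_setU.
- move=> i; have : LZ.-integrable S (EFin \o b i).
    apply: (@le_integrable _ _ _ _ _ mS _ w).
    + exact/measurable_EFinP.
    + by move=> q Sq; rewrite (gee0_abs (w0 q)); exact: bw.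
    + exact: integrableS iw.
  by rewrite (integrable_mkcond _ mS); apply: eq_integrable => // q _; rewrite restrict_EFin.
- move=> q Dq Nq; have Sq : S q by split.
  split; first exact: Sw.
  by move=> i; rewrite patchE mem_set.
Qed.

End nu_version.

(** * Integration against Borel kernels, and vector measures from densities *)

Section kernel_of.
Context t t' (X : measurableType t) (Y : measurableType t') (R : realType).
Context (P : X -> probability Y R)
  (mP : forall U, measurable U -> measurable_fun setT (fun x => P x U)).

(** P itself; the measurability proof is an argument so that the kernel structures can be attached
    to the term [kernel_of mP]. *)
Definition kernel_of (_ : forall U, measurable U -> measurable_fun setT (fun x => P x U)) :
  X -> {measure set Y -> \bar R} := P.

HB.instance Definition _ := @isKernel.Build _ _ X Y R (kernel_of mP) mP.

Let kernel_of_prob x : kernel_of mP x [set: Y] = 1%E.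
Proof. by rewrite /kernel_of/= probability_setT. Qed.

HB.instance Definition _ := @Kernel_isProbability.Build _ _ X Y R (kernel_of mP) kernel_of_prob.

Lemma measurable_kernel_xsection (A : set (X * Y)) : measurable A ->
  measurable_fun setT (fun x => P x (xsection A x)).
Proof.
move=> mA; apply: (measurable_fun_xsection_finite_kernel (kernel_of mP)).
exact/mem_set.
Qed.

Lemma measurable_kernel_Rintegral (k : X * Y -> R) (C : R) :
  measurable_fun setT k -> (forall q, `|k q| <= C) ->
  measurable_fun setT (fun x => \int[P x]_y k (x, y)).
Proof.
move=> mk kC.
have h := @measurable_fun_integral_finite_kernel _ _ X Y R (fun q => (k q + C)%:E) (kernel_of mP).
(* The shift by C makes the integrand nonnegative; as [P x] has mass 1, it is subtracted again after
   integration. *)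
rewrite (_ : (fun x => _) = fun x => fine (\int[P x]_y (k (x, y) + C)%:E)%E - C).
  apply: measurable_funB; last exact: measurable_cst.
  apply: (@measurableT_comp _ _ _ _ _ _ fine) => //; apply: h.
    by move=> q; rewrite lee_fin; have := kC q; rewrite ler_norml => /andP[]; lra.
  by apply/measurable_EFinP; apply: measurable_funD.
apply/funext => x.
have ik : (P x).-integrable setT (EFin \o (fun y => k (x, y))).
  apply: (@bounded_integrable _ _ _ _ _ C) => //.
  exact: measurableT_comp.
rewrite -[fine _]/(Rintegral _ _ _) RintegralD//; last exact: finite_measure_integrable_cst.
by rewrite Rintegral_cst// [X in fine X](probability_setT (P x)) mulr1 addrK.
Qed.

End kernel_of.

Lemma ae_null_of_integral t (T : measurableType t) (R : realType)
    (mu : {measure set T -> \bar R}) (f : T -> \bar R) :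
  measurable_fun setT f -> (forall x, 0 <= f x)%E -> (\int[mu]_x f x = 0)%E ->
  {ae mu, forall x, f x = 0%E}.
Proof.
move=> mf f0 f00; have : ae_eq mu setT f (cst 0%E).
  apply/ae_eq_integral_abs => //.
  by under eq_integral do rewrite gee0_abs//.
by apply: filterS => x /(_ Logic.I).
Qed.

(** The barycenter is only a set function with values in E; this realises it as a vector measure and
    makes its action on bounded functions explicit through the densities. *)
Lemma exists_vmeasure t (T : measurableType t) (R : realType) (m : nat)
    (mu1 mu2 : {measure set T -> \bar R}) (G H : 'I_m -> T -> R) :
  (forall i, mu1.-integrable setT (EFin \o G i)) ->
  (forall i, mu2.-integrable setT (EFin \o H i)) ->
  exists M : vmeasure R T m,
    (forall V i, measurable V -> vmeasure_val M V 0 i = \int[mu1]_(x in V) G i x + \int[mu2]_(x in V) H i x) /\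
    forall (f : T -> R) (C : R) i, measurable_fun setT f -> (forall x, `|f x| <= C) ->
      charge_integral (M i) f = \int[mu1]_x (f x * G i x) + \int[mu2]_x (f x * H i x).
Proof.
move=> iG iH.
exists (fun i => cadd (induced_charge (iG i)) (induced_charge (iH i))).
have E V i : measurable V -> fine (cadd (induced_charge (iG i)) (induced_charge (iH i)) V) =
    \int[mu1]_(x in V) G i x + \int[mu2]_(x in V) H i x.
  move=> mV; have f1 : (\int[mu1]_(x in V) (G i x)%:E)%E \is a fin_num.
    by apply: integrable_fin_num => //; apply: (integrableS _ _ _ (iG i)).
  have f2 : (\int[mu2]_(x in V) (H i x)%:E)%E \is a fin_num.
    by apply: integrable_fin_num => //; apply: (integrableS _ _ _ (iH i)).
  by rewrite /cadd /= /induced_charge /Rintegral -fineD.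
split => [V i mV|f C i mf fC]; first by rewrite mxE E.
by apply: (@charge_integralE _ _ _ _ _ _ _ _ _ C) => // B mB; exact: E.
Qed.

(** * Borel moments of nu^inf *)

Section nuinf_version.
Context (R : realType) (d m : nat).
Local Notation Rd := 'rV[R]_d.
Local Notation Z := (torus R d).
Local Notation E := 'rV[R]_m.

Lemma measurable_unit_sphere : measurable (@unit_sphere R m).
Proof.
rewrite (_ : @unit_sphere R m = @enorm R m @^-1` [set 1])//.
rewrite -[X in measurable X]setTI.
by apply: (continuous_measurable_mx (@enorm_continuous R m)).
Qed.

Lemma integrable_coord_sphere (P : probability E R) i :
  P.-integrable (@unit_sphere R m) (EFin \o (fun z : E => z 0 i)).
Proof.
have mS := measurable_unit_sphere.
apply: (@le_integrable _ _ _ _ _ mS _ (cst 1%E)).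
- apply/measurable_EFinP; apply: measurable_funTS; apply: continuous_measurable_mx => z.
  exact: coord_continuous.
- by move=> z z1; rewrite /= lee_fin normr1 -z1 enorm_coord.
- exact: finite_measure_integrable_cst.
Qed.

Lemma integrable_coord (P : {measure set E -> \bar R}) i :
  P.-integrable setT (EFin \o @enorm R m) -> P.-integrable setT (EFin \o (fun z : E => z 0 i)).
Proof.
move=> ie; apply: le_integrable ie => //.
  by apply/measurable_EFinP; apply: continuous_measurable_mx => z; exact: coord_continuous.
by move=> z _; rewrite /= lee_fin (ger0_norm (enorm_ge0 _)) enorm_coord.
Qed.

(** On the compact sphere the coordinates are themselves in C_0 and bounded by 1, so no truncation
    occurs. The null sets stay indexed by i: [rho] is not yet a Borel kernel, hence
    [semiproduct lambda rho] is not known to be subadditive and their union cannot be formed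
    here. *)
Lemma nuinf_version (lambda : {finite_measure set Rd -> \bar R}) (rho : Rd -> probability Z R)
    (D : set (Rd * Z)) (kap : Rd * Z -> probability E R) : measurable D ->
  (forall q, D q -> kap q (@unit_sphere R m) = 1%E) ->
  weakstar_measurable (semiproduct lambda rho) D (@unit_sphere R m) (C0 (@unit_sphere R m)) kap ->
  exists (g : 'I_m -> Rd * Z -> R) (N : 'I_m -> set (Rd * Z)),
    [/\ forall i, measurable (N i) /\ semiproduct lambda rho (N i) = 0%E,
       forall i, measurable_fun setT (g i), forall i q, `|g i q| <= 1 &
       forall i q, D q -> ~ N i q -> \int[kap q]_(z in @unit_sphere R m) z 0 i = g i q].
Proof.
move=> mD k1 wm.
have mS := measurable_unit_sphere.
have C0z (i : 'I_m) : C0 (@unit_sphere R m) (fun z : E => z 0 i).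
  split; first by apply: continuous_subspaceT => z; exact: coord_continuous.
  move=> e e0; exists (@unit_sphere R m); split => //.
  exact: compact_unit_sphere.
pose b i q := \int[kap q]_(z in @unit_sphere R m) z 0 i.
have /choice[uN huN] i : exists uN : (Rd * Z -> R) * set (Rd * Z), [/\ measurable_fun D uN.1,
    measurable uN.2, semiproduct lambda rho uN.2 = 0%E &
    forall q, D q -> ~ uN.2 q -> b i q = uN.1 q].
  have [g mg [N [mN N0 hN]]] := wm _ (C0z i).
  exists (g, N); split => //= q Dq Nq; apply: contrapT => h; apply: Nq; apply: hN => /=.
  by move=> /(_ Dq).
have mS' i : measurable (D `\` (uN i).2) by apply: measurableD => //; have [] := huN i.
exists (fun i => b i \_ (D `\` (uN i).2)), (fun i => (uN i).2); split.
- by move=> i; have [] := huN i.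
- move=> i; apply/(measurable_restrictT _ (mS' i)).
  apply: (@eq_measurable_fun _ _ _ _ _ (uN i).1).
    by move=> q /set_mem[Dq Nq]; have [_ _ _ ->] := huN i.
  by have [mu _ _ _] := huN i; apply: measurable_funS mu => //; exact: subDsetl.
- move=> i q; rewrite patchE; case: ifPn => [/set_mem[Dq _]|_]; last by rewrite normr0.
  have iz := integrable_coord_sphere (kap q) i.
  apply: le_trans (le_normr_Rintegral mS iz) _.
  apply: (@le_trans _ _ (\int[kap q]_(z in @unit_sphere R m) (cst 1 z))).
    apply: le_Rintegral => //; first exact: (integrable_abse iz).
      exact: finite_measure_integrable_cst.
    by move=> z z1; rewrite -z1 enorm_coord.
  by rewrite Rintegral_cst// [X in fine X](k1 q Dq) mulr1.
- by move=> i q Dq Nq; rewrite patchE mem_set.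
Qed.

End nuinf_version.

Lemma measurable_closure_rV (R : realType) d (U : set 'rV[R]_d) : measurable (closure U).
Proof.
rewrite -[X in measurable X]setCK; apply: measurableC; apply: open_measurable_mx.
exact/closed_openC/closed_closure.
Qed.

(** * The pairing in Borel terms, and its regular and singular parts *)

Section assembly.
Context (R : realType) (d m : nat).
Local Notation Rd := 'rV[R]_d.
Local Notation Z := (torus R d).
Local Notation E := 'rV[R]_m.
Local Notation Leb := (lebesgue_rV R d).
Local Notation tl := (torus_lebesgue R d).
Local Notation LZ := (lebesgue_rV R d \x torus_lebesgue R d)%E.

Lemma ae_xsection0 (N : set (Rd * Z)) : measurable N -> LZ N = 0%E ->
  {ae Leb, forall x, tl (xsection N x) = 0%E}.
Proof.
move=> mN N0; apply: ae_null_of_integral => //.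
exact: (@measurable_fun_xsection _ _ _ _ _ tl).
Qed.

Lemma Rintegral_section_integrable (f : Rd * Z -> R) : LZ.-integrable setT (EFin \o f) ->
  Leb.-integrable setT (EFin \o (fun x => \int[tl]_xi f (x, xi))).
Proof.
move=> iF; have iF' := integrable_fubini_F iF.
apply: le_integrable (iF') => //.
  apply/measurable_EFinP.
  apply: (@measurableT_comp _ _ _ _ _ _ fine) => //.
  exact: (measurable_int Leb iF').
move=> x _ /=; rewrite /Rintegral /fubini_F /=; case: (integral _ _ _) => //=.
by rewrite normr0 leey.
by rewrite normr0 leey.
Qed.

(** For almost every x the section of the exceptional set is null for the inner measure, so the
    inner integrals may use the Borel moments; psi and phi then leave the integrals by linearity. *)
Lemma pairing_formula Omega (nu : young_data R d m) (g ginf : 'I_m -> Rd * Z -> R)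
    (N : set (Rd * Z)) (Ninf : 'I_m -> set (Rd * Z)) (rho : Rd -> probability Z R)
    i (psi : Rd -> R) (phi : Z -> R) : measurable N -> (forall i, measurable (Ninf i)) ->
  {ae Leb, forall x, (forall i, tl.-integrable setT (EFin \o (fun xi => g i (x, xi)))) /\
     tl (xsection N x) = 0%E} ->
  {ae y_lambda nu, forall x, closure Omega x -> y_rho nu x = rho x /\
     forall i, rho x (xsection (Ninf i) x) = 0%E} ->
  (forall q, closure Omega q.1 -> ~ N q ->
     (y_nu nu q.1 q.2).-integrable setT (EFin \o @enorm R m) /\
     forall i, \int[y_nu nu q.1 q.2]_z z 0 i = g i q) ->
  (forall i, measurable_fun setT (ginf i)) -> (forall i q, `|ginf i q| <= 1) ->
  (forall i q, closure Omega q.1 -> ~ Ninf i q ->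
     \int[y_nuinf nu q.1 q.2]_(z in @unit_sphere R m) z 0 i = ginf i q) ->
  continuous phi ->
  two_scale_pairing Omega nu i psi phi =
  \int[Leb]_(x in Omega) (psi x * \int[tl]_xi (phi xi * g i (x, xi))) +
  \int[y_lambda nu]_(x in closure Omega) (psi x * \int[rho x]_xi (phi xi * ginf i (x, xi))).
Proof.
move=> mN mNinf good1 good2 hg mginf ginf1 hginf cphi.
have mphi := continuous_measurable_torus cphi.
have [C _ phiC] := continuous_torus_bounded cphi.
congr (_ + _); apply: ae_eq_Rintegral.
  apply: filterS good1 => x [ix Nx] Ox.
  rewrite -RintegralZl//; last exact: integrable_bounded_mul (ix i).
  apply: ae_eq_Rintegral; exists (xsection N x); split => //; first exact: measurable_xsection.
  move=> xi /= /not_implyP[_]; apply: contra_notP => Nxi.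
  have [|//|ie Eg] := hg (x, xi); first exact: subset_closure.
    by move=> h; apply: Nxi; rewrite /xsection/=; exact/mem_set.
  rewrite RintegralZl//; last exact: integrable_coord.
  by rewrite -Eg mulrA.
apply: filterS good2 => x h Ox; have [-> Nx] := h Ox.
have ig : (rho x).-integrable setT (EFin \o (fun xi => phi xi * ginf i (x, xi))).
  apply: (@integrable_bounded_mul _ _ _ _ _ _ C) => //.
  apply: (@bounded_integrable _ _ _ _ _ 1); first exact: measurableT_comp.
  by move=> xi; exact: ginf1.
rewrite -RintegralZl//.
apply: ae_eq_Rintegral; exists (xsection (Ninf i) x); split; [exact: measurable_xsection|exact: Nx|].
move=> xi /= /not_implyP[_]; apply: contra_notP => Nxi.
rewrite RintegralZl//; [|exact: measurable_unit_sphere|exact: integrable_coord_sphere].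
rewrite -(hginf i (x, xi))//= ?mulrA//.
by move=> h'; apply: Nxi; rewrite /xsection/=; exact/mem_set.
Qed.

(** Bumps on boxes give H1 Leb + H2 lambda = 0 as signed measures on Omega. Subsets of Reg are null
    for [lams] and subsets of Sing are null for Leb, so restriction to either set leaves one measure
    with one density. *)
Lemma ae_regular_singular (Omega : set Rd) (lambda : {finite_measure set Rd -> \bar R})
    (lac : Rd -> R) (lams : {finite_measure set Rd -> \bar R}) (Reg Sing : set Rd)
    (H1 H2 : Rd -> R) (C : R) : (0 < d)%N -> open Omega ->
  reg_sing_decomposition Omega lambda lac lams Reg Sing ->
  Leb.-integrable setT (EFin \o H1) -> measurable_fun setT H2 -> (forall x, `|H2 x| <= C) ->
  (forall psi, test_function Omega (psi : Rd -> R^o) ->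
    \int[Leb]_(x in Omega) (psi x * H1 x) + \int[lambda]_(x in closure Omega) (psi x * H2 x) = 0) ->
  {ae Leb, forall x, (Reg `&` Omega) x -> H1 x + lac x * H2 x = 0} /\
  {ae lams, forall x, (Sing `&` Omega) x -> H2 x = 0}.
Proof.
move=> d0 oO [[ilac _] lamE [mReg mSing] [RS _] [LSing lReg]] i1 mH2 H2C hpsi.
have mO : measurable Omega by exact: open_measurable_mx.
have mcO := @measurable_closure_rV R d Omega.
have Rmk (ms : {measure set Rd -> \bar R}) (D : set Rd) (u v : Rd -> R) :
    \int[ms]_(x in D) (u x * v x) = \int[ms]_x (u x * (v \_ D) x).
  rewrite Rintegral_mkcond; apply: eq_Rintegral => x _; rewrite !patchE.
  by case: ifPn => //; rewrite mulr0.
have i1' : Leb.-integrable setT (EFin \o (H1 \_ Omega)).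
  have := integrableS measurableT mO (@subsetT _ _) i1.
  rewrite (integrable_mkcond _ mO).
  by apply: eq_integrable => // x _; rewrite restrict_EFin.
have i2 : lambda.-integrable setT (EFin \o H2) by exact: bounded_integrable H2C.
have i2' : lambda.-integrable setT (EFin \o (H2 \_ (closure Omega))).
  have := integrableS measurableT mcO (@subsetT _ _) i2.
  rewrite (integrable_mkcond _ mcO).
  by apply: eq_integrable => // x _; rewrite restrict_EFin.
have idS S : measurable S -> S `<=` Omega -> \int[Leb]_(x in S) H1 x + \int[lambda]_(x in S) H2 x = 0.
  move=> mS SO; rewrite -[RHS](box_fun_determine d0 oO i1' i2' _ mS SO).
    congr (_ + _); apply: eq_Rintegral => x /set_mem Sx; rewrite patchE mem_set//.
      exact: SO.
    exact/subset_closure/SO.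
  move=> a b n abO; rewrite -!Rmk; apply: hpsi.
  exact: test_function_box_fun.
(* The decomposition of lambda is given on sets only; it extends to the bounded density H2 as a
   vanishing family of three measures. *)
have dec S : measurable S -> \int[lambda]_(x in S) H2 x =
    \int[Leb]_(x in S) (lac x * H2 x) + \int[lams]_(x in S) H2 x.
  move=> mS.
  pose mus (i : 'I_3) : {measure set Rd -> \bar R} := match val i with
    0 => lambda | 1 => Leb | _ => lams end.
  pose gs (i : 'I_3) : Rd -> R := match val i with
    0 => cst 1 | 1 => \- lac | _ => cst (-1) end.
  have igs i : (mus i).-integrable setT (EFin \o gs i).
    case: i => -[|[|[|//]]] i3; rewrite /mus /gs /=.
    - exact: finite_measure_integrable_cst.
    - exact: (integrableN ilac).
    - exact: finite_measure_integrable_cst.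
  have gB B : measurable B -> \sum_i \int[mus i]_(x in B) gs i x = 0.
    move=> mB; rewrite !big_ord_recl big_ord0 /mus /gs /= addr0 !Rintegral_cst//.
    have ilB : Leb.-integrable B (EFin \o lac) by exact: integrableS ilac.
    have -> : \int[Leb]_(x in B) - lac x = - \int[Leb]_(x in B) lac x.
      rewrite -mulN1r -RintegralZl//; by apply: eq_Rintegral => x _; rewrite mulN1r.
    have -> : fine (lambda B) = \int[Leb]_(x in B) lac x + fine (lams B).
      rewrite (lamE B mB) fineD//; last exact: fin_num_measure.
      exact: (integrable_fin_num mB ilB).
    by ring.
  have mf : measurable_fun setT (H2 \_ S).
    by apply/(measurable_restrictT _ mS); exact: measurable_funTS.
  have C0 : 0 <= C by exact: le_trans (normr_ge0 (H2 0)) (H2C 0).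
  have fC x : `|(H2 \_ S) x| <= C by rewrite patchE; case: ifPn => // _; rewrite normr0.
  have := sum_integral_bounded_eq0 igs gB mf fC.
  rewrite !big_ord_recl big_ord0 /mus /gs /= addr0.
  have -> : \int[lambda]_x ((H2 \_ S) x * 1) = \int[lambda]_(x in S) H2 x.
    by rewrite [RHS]Rintegral_mkcond; apply: eq_Rintegral => x _; rewrite mulr1.
  have ill : Leb.-integrable S (EFin \o (fun x => lac x * H2 x)).
    apply: (integrableS measurableT mS) => //.
    have := integrable_bounded_mul mH2 H2C ilac.
    by apply: eq_integrable => // x _ /=; rewrite mulrC.
  have -> : \int[Leb]_x ((H2 \_ S) x * - lac x) = - \int[Leb]_(x in S) (lac x * H2 x).
    rewrite -[RHS]mulN1r -RintegralZl// [RHS]Rintegral_mkcond; apply: eq_Rintegral => x _.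
    by rewrite !patchE; case: ifPn => _; [rewrite mulrN mulN1r mulrC|rewrite mul0r].
  have ils : lams.-integrable S (EFin \o H2).
    by apply: (integrableS measurableT mS) => //; exact: bounded_integrable H2C.
  have -> : \int[lams]_x ((H2 \_ S) x * -1) = - \int[lams]_(x in S) H2 x.
    rewrite -[RHS]mulN1r -RintegralZl// [RHS]Rintegral_mkcond; apply: eq_Rintegral => x _.
    by rewrite !patchE; case: ifPn => _; [rewrite mulrN1 mulN1r|rewrite mul0r].
  by move=> h; apply/eqP; rewrite -subr_eq0 opprD h.
have null0 (ms : {measure set Rd -> \bar R}) S (u : Rd -> R) : measurable S -> ms S = 0%E -> \int[ms]_(x in S) u x = 0.
  move=> mS S0; rewrite (@ae_eq_Rintegral _ _ _ ms S u (cst 0)).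
    by rewrite Rintegral_cst// mul0r.
  by exists S; split => // x /= /not_implyP[].
split.
  have ilH : Leb.-integrable setT (EFin \o (fun x => lac x * H2 x)).
    have := integrable_bounded_mul mH2 H2C ilac.
    by apply: eq_integrable => // x _ /=; rewrite mulrC.
  have iF : Leb.-integrable setT (EFin \o (fun x => H1 x + lac x * H2 x)).
    have := integrableD measurableT i1 ilH.
    by apply: eq_integrable => // x _ /=; rewrite EFinD.
  apply: ae_eq0_of_integrals => //; first exact: measurableI.
  move=> S mS SRO.
  have lS : lams S = 0%E by apply: subset_measure0 lReg => // x /SRO[].
  have := idS S mS (fun x h => (SRO x h).2); rewrite dec// (null0 _ _ _ mS lS) addr0.
  rewrite RintegralD//; first exact: (integrableS measurableT mS).
  exact: (integrableS measurableT mS).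
apply: ae_eq0_of_integrals => //; first exact: measurableI.
  exact: bounded_integrable H2C.
move=> S mS SRO.
have LS : Leb S = 0%E by apply: subset_measure0 LSing => // x /SRO[].
have := idS S mS (fun x h => (SRO x h).2).
by rewrite dec// !(null0 _ _ _ mS LS) !add0r.
Qed.

End assembly.

Section sums.
Context t (T : measurableType t) (R : realType).

Lemma integrable_sumZ (mu : {measure set T -> \bar R}) (D : set T) (I : Type) (s : seq I)
    (c : I -> R) (F : I -> T -> R) : measurable D ->
  (forall p, mu.-integrable D (EFin \o F p)) ->
  mu.-integrable D (EFin \o (fun x => \sum_(p <- s) c p * F p x)).
Proof.
move=> mD iF; elim: s => [|p s IH].
  by apply: (eq_integrable mD) (integrable0 mu D) => x _; rewrite /= big_nil.
have := integrableD mD (integrableZl mD (c p) (iF p)) IH.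
by apply: eq_integrable => // x _; rewrite /= big_cons EFinD EFinM.
Qed.

Lemma Rintegral_sumZ (mu : {measure set T -> \bar R}) (D : set T) (I : Type) (s : seq I)
    (c : I -> R) (F : I -> T -> R) : measurable D ->
  (forall p, mu.-integrable D (EFin \o F p)) ->
  \int[mu]_(x in D) (\sum_(p <- s) c p * F p x) = \sum_(p <- s) c p * \int[mu]_(x in D) F p x.
Proof.
move=> mD iF; elim: s => [|p s IH].
  by rewrite big_nil; under eq_Rintegral do rewrite big_nil; rewrite Rintegral_cst// mul0r.
rewrite big_cons -IH -RintegralZl// -RintegralD//.
- by apply: eq_Rintegral => x _; rewrite big_cons.
- have := integrableZl mD (c p) (iF p).
  by apply: eq_integrable => // x _; rewrite /= EFinM.
- exact: integrable_sumZ.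
Qed.

End sums.

(** * The operator on the torus at a fixed point *)

Section torus_operator.
Context (R : realType) (d m n k : nat).
Local Notation Z := (torus R d).
Local Notation tl := (torus_lebesgue R d).
Context (A : operator R d m n k).

(** The multiple 0 or 1 absorbs the degree condition, so the action of A becomes one finite linear
    combination over pairs. *)
Definition operator_coef (j : 'I_n) (p : mindex d k * 'I_m) : R :=
  A p.1 p.2 j *+ (mdegree p.1 == k).

Lemma operator_coefE j (F : mindex d k -> 'I_m -> R) :
  \sum_(a : mindex d k | mdegree a == k) \sum_(i < m) F a i * A a i j =
  \sum_p operator_coef j p * F p.1 p.2.
Proof.
rewrite big_mkcond/=.
transitivity (\sum_(a : mindex d k) \sum_(i < m) operator_coef j (a, i) * F a i).
  apply: eq_bigr => a _; rewrite /operator_coef/=; case: ifPn => ak.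
    by apply: eq_bigr => i _; rewrite mulr1n mulrC.
  by rewrite big1// => i _; rewrite mulr0n mul0r.
by rewrite pair_bigA; apply: eq_bigr => -[a i].
Qed.

Lemma torus_mpartial_continuous (a : mindex d k) (phi : Z -> R) :
  torus_smooth phi -> continuous (torus_mpartial a phi).
Proof. by move=> sphi; apply: torus_smooth_continuous; exact: torus_smooth_partials. Qed.

(** Pairing with a measure of finite total variation is continuous for uniform convergence of the
    derivatives of order at most k, so the dense sequence decides all test functions. *)
Lemma exists_operator_free (rho : probability Z R) (G H : 'I_m -> Z -> R) (phi_ : nat -> Z -> R) :
  (forall i, tl.-integrable setT (EFin \o G i)) ->
  (forall i, rho.-integrable setT (EFin \o H i)) ->
  (forall l, torus_smooth (phi_ l)) ->
  (forall f (e : R), torus_smooth f -> 0 < e -> exists l, forall (a : mindex d k) z,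
     `|torus_mpartial a f z - torus_mpartial a (phi_ l) z| <= e) ->
  (forall l j, \sum_p operator_coef j p *
     (\int[tl]_z (torus_mpartial p.1 (phi_ l) z * G p.2 z) +
      \int[rho]_z (torus_mpartial p.1 (phi_ l) z * H p.2 z)) = 0) ->
  exists M : vmeasure R Z m,
    (forall V i, measurable V -> vmeasure_val M V 0 i = \int[tl]_(x in V) G i x + \int[rho]_(x in V) H i x) /\
    forall phi, torus_smooth phi ->
      operator_distribution A (@torus_mpartial R d k) (distribution_of M) phi = 0.
Proof.
move=> iG iH sphi_ dense h0.
have [M [MV Mf]] := exists_vmeasure iG iH.
exists M; split => // phi sphi.
have ME (a : mindex d k) f i : torus_smooth f -> charge_integral (M i) (torus_mpartial a f) =
   \int[tl]_z (torus_mpartial a f z * G i z) + \int[rho]_z (torus_mpartial a f z * H i z).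
  move=> sf; have cf := torus_mpartial_continuous (a := a) sf.
  have [C _ hC] := continuous_torus_bounded cf.
  exact: Mf (continuous_measurable_torus cf) hC.
apply/rowP => j; rewrite /operator_distribution mxE summxE [RHS]mxE.
rewrite (_ : \sum_(a | _) _ = \sum_p operator_coef j p * charge_integral (M p.2) (torus_mpartial p.1 phi)); last first.
  rewrite -(operator_coefE j (fun a i => charge_integral (M i) (torus_mpartial a phi))).
  apply: eq_bigr => a _; rewrite mxE; apply: eq_bigr => i _.
  by rewrite mxE.
set S := (X in _ * X); suff -> : S = 0 by rewrite mulr0.
(* Total masses of the densities: replacing phi by a function whose derivatives are within e of its
   own changes S by at most e Q. *)
pose W (p : mindex d k * 'I_m) := \int[tl]_z `|G p.2 z| + \int[rho]_z `|H p.2 z|.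
have W0 p : 0 <= W p by rewrite addr_ge0//; apply: Rintegral_ge0.
pose Q := \sum_p `|operator_coef j p| * W p.
have Q0 : 0 <= Q by apply: sumr_ge0 => p _; exact: mulr_ge0.
have bnd (ms : {measure set Z -> \bar R}) (u v w : Z -> R) (e : R) : ms.-integrable setT (EFin \o w) ->
    continuous u -> continuous v -> (forall z, `|u z - v z| <= e) ->
    `|\int[ms]_z (u z * w z) - \int[ms]_z (v z * w z)| <= e * \int[ms]_z `|w z|.
  move=> iw cu cv uv.
  have ic (f : Z -> R) : continuous f -> ms.-integrable setT (EFin \o (fun z => f z * w z)).
    move=> cf; have [C _ hC] := continuous_torus_bounded cf.
    exact: integrable_bounded_mul (continuous_measurable_torus cf) hC iw.
  rewrite -RintegralB//; [|exact: ic..].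
  have iB : ms.-integrable setT (EFin \o (fun z => u z * w z - v z * w z)).
    have := integrableB measurableT (ic _ cu) (ic _ cv).
    by apply: eq_integrable => // x _; rewrite /= EFinB.
  apply: le_trans (le_normr_Rintegral measurableT iB) _.
  rewrite -RintegralZl//; last exact: (integrable_abse iw).
  apply: le_Rintegral => //; first exact: (integrable_abse iB).
    have := integrableZl measurableT e (integrable_abse iw).
    by apply: eq_integrable.
  by move=> z _; rewrite -mulrBl normrM ler_wpM2r.
have SQ e : 0 < e -> `|S| <= e * Q.
  move=> e0; have [l hl] := dense phi e sphi e0.
  rewrite -[S]subr0 -(h0 l j) /S -sumrB.
  apply: le_trans (ler_norm_sum _ _ _) _; rewrite /Q mulr_sumr; apply: ler_sum => p _.
  rewrite -mulrBr normrM [leRHS]mulrCA ler_wpM2l// ME//.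
  rewrite /W mulrDr opprD addrACA; apply: le_trans (ler_normD _ _) _.
  apply: lerD; apply: bnd => //; exact: torus_mpartial_continuous.
apply/eqP; rewrite -normr_le0; apply/ler_addgt0Pr => e e0; rewrite add0r.
have Q1 : 0 < Q + 1 by lra.
apply: le_trans (SQ (e / (Q + 1)) (divr_gt0 e0 Q1)) _.
by rewrite mulrAC ler_pdivrMr// ler_pM2l// lerDl.
Qed.

End torus_operator.

(** * Transfer of null sets between lambda, Lebesgue measure and the singular part *)

Section ae_transfer.
Context t (T : measurableType t) (R : realType).

(** A null set of lambda is null for [lams], and null for [mu] only after the zeros of the density
    are removed; hence the alternative [l x = 0]. *)
Lemma ae_density_singular (mu : {measure set T -> \bar R})
    (lambda lams : {finite_measure set T -> \bar R}) (l : T -> R) (P : T -> Prop) :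
  mu.-integrable setT (EFin \o l) -> {ae mu, forall x, 0 <= l x} ->
  (forall B, measurable B -> lambda B = (\int[mu]_(x in B) (l x)%:E + lams B)%E) ->
  {ae lambda, forall x, P x} ->
  {ae mu, forall x, l x = 0 \/ P x} /\ {ae lams, forall x, P x}.
Proof.
move=> il l0 lamE [N [mN N0 PN]].
have := lamE N mN; rewrite [X in X = _]N0.
have -> : (\int[mu]_(x in N) (l x)%:E = \int[mu]_(x in N) `|(l x)%:E|)%E.
  apply: ae_eq_integral_nonmeasurable; apply: filterS l0 => x lx _.
  by rewrite abse_EFin ger0_norm.
move/esym/eqP; rewrite padde_eq0 ?integral_ge0// => /andP[/eqP/ae_eq_integral_abs lN /eqP lamsN].
split; last by exists N; split.
have {lN}[|N' [mN' N'0 lN']] := lN mN.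
  by apply: measurable_funTS; exact: (measurable_int _ il).
exists N'; split => // x /= /not_orP[lx Px]; apply: lN' => /= h.
by apply: lx; have [] := h (PN _ Px).
Qed.

(** Nothing is known of [mu2] on N1, but [mu2] vanishes on A1: cutting N1 down to A1, and N2 to A2,
    makes both null for the sum. *)
Lemma ae_measure_add (mu1 mu2 : {measure set T -> \bar R}) (A1 A2 : set T) (P : T -> Prop) :
  measurable A1 -> measurable A2 -> mu1 A2 = 0%E -> mu2 A1 = 0%E ->
  {ae mu1, forall x, A1 x -> P x} -> {ae mu2, forall x, A2 x -> P x} ->
  {ae measure_add mu1 mu2, forall x, (A1 `|` A2) x -> P x}.
Proof.
move=> mA1 mA2 A20 A10 [N1 [mN1 N10 h1]] [N2 [mN2 N20 h2]].
have m1 : measurable (N1 `&` A1) by exact: measurableI.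
have m2 : measurable (N2 `&` A2) by exact: measurableI.
exists (N1 `&` A1 `|` N2 `&` A2); split; first exact: measurableU.
  have null (mu : {measure set T -> \bar R}) X Y : measurable X -> measurable Y ->
      mu X = 0%E -> mu Y = 0%E -> mu (X `|` Y) = 0%E.
    by move=> mX mY X0 Y0; rewrite measureU0.
  rewrite measure_addE; apply/eqP; rewrite padde_eq0 ?measure_ge0//.
  apply/andP; split; apply/eqP; apply: null => //.
  - by apply: subset_measure0 N10 => //; exact: subIsetl.
  - by apply: subset_measure0 A20 => //; exact: subIsetr.
  - by apply: subset_measure0 A10 => //; exact: subIsetr.
  - by apply: subset_measure0 N20 => //; exact: subIsetl.
move=> x /= /not_implyP[[A1x|A2x] Px]; [left|right]; split => //.
  by apply: h1 => /= h; exact: Px (h A1x).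
by apply: h2 => /= h; exact: Px (h A2x).
Qed.

End ae_transfer.

(** * The pointwise identity for one test function phi *)

Section localisation.
Context (R : realType) (d m n k : nat).
Local Notation Rd := 'rV[R]_d.
Local Notation Z := (torus R d).
Local Notation E := 'rV[R]_m.
Local Notation Leb := (lebesgue_rV R d).
Local Notation tl := (torus_lebesgue R d).
Local Notation LZ := (lebesgue_rV R d \x torus_lebesgue R d)%E.
Context (A : operator R d m n k).

(** For the Borel version the mass of a section is a measurable function of x, so a zero integral
    forces it to vanish almost everywhere; the integral itself does not change when rho is modified
    on a null set. *)
Lemma ae_semiproduct0 (lambda : {finite_measure set Rd -> \bar R}) (rho rho' : Rd -> probability Z R)
    (N : set (Rd * Z)) : measurable N ->
  (forall U, measurable U -> measurable_fun setT (fun x => rho' x U)) ->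
  {ae lambda, forall x, rho x = rho' x} -> semiproduct lambda rho N = 0%E ->
  {ae lambda, forall x, rho' x (xsection N x) = 0%E}.
Proof.
move=> mN mrho rr' N0; apply: ae_null_of_integral.
- exact: measurable_kernel_xsection.
- by move=> x; exact: measure_ge0.
rewrite -[RHS]N0; apply: ae_eq_integral_nonmeasurable.
by apply: filterS rr' => x -> _.
Qed.

(** H1 and H2 are what A produces from the oscillation and concentration parts. The exceptional sets
    obtained here still depend on phi and j. *)
Lemma ae_pairing_identity p (Omega : set Rd) (nu : young_data R d m) lac lams Reg Sing
    (g ginf : 'I_m -> Rd * Z -> R) (N : set (Rd * Z)) (Ninf : 'I_m -> set (Rd * Z))
    (rho : Rd -> probability Z R) (phi : Z -> R) (j : 'I_n) :
  (0 < d)%N -> 1 < p -> open Omega -> bounded_set Omega -> A_free A p Omega nu ->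
  reg_sing_decomposition Omega (y_lambda nu) lac lams Reg Sing ->
  measurable N -> (forall i, measurable (Ninf i)) ->
  (forall i, LZ.-integrable setT (EFin \o g i)) ->
  {ae Leb, forall x, (forall i, tl.-integrable setT (EFin \o (fun xi => g i (x, xi)))) /\
     tl (xsection N x) = 0%E} ->
  {ae y_lambda nu, forall x, closure Omega x -> y_rho nu x = rho x /\
     forall i, rho x (xsection (Ninf i) x) = 0%E} ->
  (forall U, measurable U -> measurable_fun setT (fun x => rho x U)) ->
  (forall q, closure Omega q.1 -> ~ N q ->
     (y_nu nu q.1 q.2).-integrable setT (EFin \o @enorm R m) /\
     forall i, \int[y_nu nu q.1 q.2]_z z 0 i = g i q) ->
  (forall i, measurable_fun setT (ginf i)) -> (forall i q, `|ginf i q| <= 1) ->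
  (forall i q, closure Omega q.1 -> ~ Ninf i q ->
     \int[y_nuinf nu q.1 q.2]_(z in @unit_sphere R m) z 0 i = ginf i q) ->
  torus_smooth phi ->
  let H1 x := \sum_p operator_coef A j p *
    \int[tl]_xi (torus_mpartial p.1 phi xi * g p.2 (x, xi)) in
  let H2 x := \sum_p operator_coef A j p *
    \int[rho x]_xi (torus_mpartial p.1 phi xi * ginf p.2 (x, xi)) in
  {ae Leb, forall x, (Reg `&` Omega) x -> H1 x + lac x * H2 x = 0} /\
  {ae lams, forall x, (Sing `&` Omega) x -> H2 x = 0}.
Proof.
move=> d0 p1 oO bO Afree rs mN mNinf ig good1 good2 mrho hg mginf ginf1 hginf sphi H1 H2.
have cphi (a : mindex d k) : continuous (torus_mpartial a phi) by exact: torus_mpartial_continuous.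
have mphi (a : mindex d k) := continuous_measurable_torus (cphi a).
have /choice[C phiC] : forall a : mindex d k, exists C : R, forall z, `|torus_mpartial a phi z| <= C.
  by move=> a; have [C _ h] := continuous_torus_bounded (cphi a); exists C.
have mphi2 (a : mindex d k) : measurable_fun setT (fun q : Rd * Z => torus_mpartial a phi q.2).
  exact: (measurableT_comp (mphi a) measurable_snd).
have iF (q : mindex d k * 'I_m) : Leb.-integrable setT (EFin \o (fun x =>
    \int[tl]_xi (torus_mpartial q.1 phi xi * g q.2 (x, xi)))).
  apply: (@Rintegral_section_integrable R d (fun y => torus_mpartial q.1 phi y.2 * g q.2 y)).
  by apply: (@integrable_bounded_mul _ _ _ _ _ _ (C q.1)) => // y; exact: phiC.
have kC (q : mindex d k * 'I_m) (y : Rd * Z) : `|torus_mpartial q.1 phi y.2 * ginf q.2 y| <= C q.1.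
  by rewrite normrM; apply: le_trans (phiC q.1 y.2); rewrite ler_piMr.
have mG (q : mindex d k * 'I_m) : measurable_fun setT (fun x =>
    \int[rho x]_xi (torus_mpartial q.1 phi xi * ginf q.2 (x, xi))).
  apply: (measurable_kernel_Rintegral mrho (k := fun y => torus_mpartial q.1 phi y.2 * ginf q.2 y) (C := C q.1)).
    exact: measurable_funM.
  exact: kC.
have GC (q : mindex d k * 'I_m) x :
    `|\int[rho x]_xi (torus_mpartial q.1 phi xi * ginf q.2 (x, xi))| <= C q.1.
  have iq : (rho x).-integrable setT (EFin \o (fun xi => torus_mpartial q.1 phi xi * ginf q.2 (x, xi))).
    apply: (@bounded_integrable _ _ _ _ _ (C q.1)).
      by apply: measurable_funM => //; exact: measurableT_comp.
    by move=> xi; exact: (kC q (x, xi)).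
  apply: le_trans (le_normr_Rintegral measurableT iq) _.
  have -> : C q.1 = \int[rho x]_xi cst (C q.1) xi.
    by rewrite Rintegral_cst// [X in fine X](probability_setT (rho x)) mulr1.
  apply: le_Rintegral => //; first exact: (integrable_abse iq).
    exact: finite_measure_integrable_cst.
  by move=> xi _; exact: (kC q (x, xi)).
have i1 : Leb.-integrable setT (EFin \o H1) by exact: integrable_sumZ.
have mH2 : measurable_fun setT H2.
  by apply: measurable_sum => q; apply: measurable_funM => //; exact: measurable_cst.
pose B := \sum_q `|operator_coef A j q| * C q.1.
have H2B x : `|H2 x| <= B.
  apply: le_trans (ler_norm_sum _ _ _) _; apply: ler_sum => q _.
  by rewrite normrM ler_wpM2l.
apply: (ae_regular_singular d0 oO rs i1 mH2 H2B) => psi tpsi.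
have mO : measurable Omega by exact: open_measurable_mx.
have mcO := @measurable_closure_rV R d Omega.
have [M _ psiM] := test_function_bounded tpsi.
have mpsi : measurable_fun setT psi.
  by apply: continuous_measurable_mx; exact: smooth_continuous tpsi.1.
have := A_free_pairing j p1 oO bO Afree (conj tpsi sphi).
rewrite (operator_coefE A j (fun a i => two_scale_pairing Omega nu i psi (torus_mpartial a phi))).
under eq_bigr => q _ do rewrite
  (pairing_formula _ _ mN mNinf good1 good2 hg mginf ginf1 hginf (cphi q.1)) mulrDr.
rewrite big_split/= => <-; congr (_ + _).
  rewrite -Rintegral_sumZ//.
    apply: eq_Rintegral => x _; rewrite /H1 mulr_sumr; apply: eq_bigr => q _.
    by rewrite mulrCA.
  move=> q; apply: (integrableS measurableT mO) => //.
  exact: integrable_bounded_mul mpsi psiM (iF q).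
rewrite -Rintegral_sumZ//.
  apply: eq_Rintegral => x _; rewrite /H2 mulr_sumr; apply: eq_bigr => q _.
  by rewrite mulrCA.
move=> q; apply: (integrableS measurableT mcO) => //.
apply: (integrable_bounded_mul mpsi psiM).
exact: bounded_integrable (mG q) (GC q).
Qed.

End localisation.

(** * A common exceptional set, and the conclusion on Reg and on Sing *)

Lemma ae_forall_fin t (T : measurableType t) (R : realType) (mu : {measure set T -> \bar R})
    (I : finType) (P : I -> T -> Prop) :
  (forall i, {ae mu, forall x, P i x}) -> {ae mu, forall x, forall i, P i x}.
Proof. by move=> h; apply: (@filter_forall _ _ P (almost_everywhere mu)). Qed.

Theorem proposition5p2 (R : realType) (d m n k : nat)
    (A : operator R d m n k) (p : R) (Omega : set 'rV[R]_d)
    (nu : young_data R d m)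
    (lac : 'rV[R]_d -> R) (lams : {finite_measure set 'rV[R]_d -> \bar R})
    (Reg Sing : set 'rV[R]_d) :
  (0 < d)%N ->
  1 < p -> p * (d%:R - 1) < d%:R ->
  open Omega -> bounded_set Omega ->
  lebesgue_rV R d (closure Omega `\` interior Omega) = 0%E ->
  two_scale_young Omega nu ->
  A_free A p Omega nu ->
  reg_sing_decomposition Omega (y_lambda nu) lac lams Reg Sing ->
  {ae measure_add (lebesgue_rV R d) lams, forall x0, Omega x0 ->
    exists M : vmeasure R (torus R d) m,
      (forall V, measurable V ->
        vmeasure_val M V = barycenter nu lac Reg x0 V) /\
      forall phi, torus_smooth phi ->
        operator_distribution A (@torus_mpartial R d k) (distribution_of M) phi
        = 0}.
Proof.
move=> d0 p1 _ oO bO _ [[wnu nu1] lam0 wrho nuinf1 wnuinf] Afree rs.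
pose LZ := (lebesgue_rV R d \x torus_lebesgue R d)%E.
pose tl := torus_lebesgue R d.
have mcO := @measurable_closure_rV R d Omega.
have mD : measurable (closure Omega `*` [set: torus R d]) by exact: measurableX.
have [g [N [[mN N0] ig hg]]] := nu_version mD wnu nu1.
have [rho [Nr [mNr Nr0 mrho rhoE]]] := kernel_version mcO wrho.
have nuinf1' q : (closure Omega `*` [set: torus R d]) q ->
    y_nuinf nu q.1 q.2 (@unit_sphere R m) = 1%E by case=> h _; exact: nuinf1.
have [ginf [Ninf [mNinf mginf ginf1 hginf]]] := nuinf_version mD nuinf1' wnuinf.
have good1 : {ae lebesgue_rV R d, forall x,
    (forall i, tl.-integrable setT (EFin \o (fun xi => g i (x, xi)))) /\
    tl (xsection N x) = 0%E}.
  apply: filterI; last exact: ae_xsection0.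
  by apply: ae_forall_fin => i; exact: (ae_integrable1 (ig i)).
(* As lambda does not charge the complement of the closure, the Borel version agrees with rho almost
   everywhere on the whole space, as [ae_semiproduct0] requires. *)
have aerho : {ae y_lambda nu, forall x, closure Omega x /\ y_rho nu x = rho x}.
  exists (~` closure Omega `|` Nr); split.
  - by apply: measurableU => //; exact: measurableC.
  - by rewrite measureU0//; exact: measurableC.
  - move=> x /=; apply: contra_notP => /not_orP[/contrapT cx Nx]; split => //.
    exact: rhoE.
have good2 : {ae y_lambda nu, forall x, closure Omega x -> y_rho nu x = rho x /\
    forall i, rho x (xsection (Ninf i) x) = 0%E}.
  have h : {ae y_lambda nu, forall x, forall i, rho x (xsection (Ninf i) x) = 0%E}.
    apply: ae_forall_fin => i; have [mNi Ni0] := mNinf i.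
    by apply: ae_semiproduct0 Ni0 => //; apply: filterS aerho => x [].
  by apply: filterS2 aerho h => x [_ ?] ? _.
have hg' q : closure Omega q.1 -> ~ N q ->
    (y_nu nu q.1 q.2).-integrable setT (EFin \o @enorm R m) /\
    forall i, \int[y_nu nu q.1 q.2]_z z 0 i = g i q by move=> cq; exact: hg.
have hginf' i q : closure Omega q.1 -> ~ Ninf i q ->
    \int[y_nuinf nu q.1 q.2]_(z in @unit_sphere R m) z 0 i = ginf i q.
  by move=> cq; exact: hginf.
have [phi_ [sphi_ dense]] := @torus_dense_sequence R d (mindex d k) _ (@torus_smooth R d)
  (@torus_mpartial R d k) (ex_intro _ _ (torus_smooth_cst 0)) (fun a f => @torus_mpartial_continuous R d k a f).
have key l j := ae_pairing_identity j d0 p1 oO bO Afree rs mN (fun i => (mNinf i).1) ig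
  good1 good2 mrho hg' mginf ginf1 hginf' (sphi_ l).
(* Countably many phi_l and finitely many components j: the exceptional sets are merged before a
   test function is fixed. *)
have keyL := ae_foralln (fun l => ae_forall_fin (fun j => (key l j).1)).
have keys := ae_foralln (fun l => ae_forall_fin (fun j => (key l j).2)).
have [[ilac lac0] lamE [mReg mSing] [RS RS0] [LSing lReg]] := rs.
have [good2L good2s] := ae_density_singular ilac lac0 lamE good2.
have concE x V : measurable V -> closure Omega x -> y_rho nu x = rho x ->
    (forall i, rho x (xsection (Ninf i) x) = 0%E) ->
    forall i, vintegral (y_rho nu x) V
      (fun xi => vintegral (y_nuinf nu x xi) (@unit_sphere R m) id) 0 i =
    \int[rho x]_(xi in V) ginf i (x, xi).
  move=> mV cx -> Nx i; rewrite mxE; apply: ae_eq_Rintegral.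
  exists (xsection (Ninf i) x); split; [exact: (measurable_xsection _ (mNinf i).1)|exact: Nx|].
  move=> xi /= /not_implyP[_]; apply: contra_notP => Nxi; rewrite mxE.
  apply: (hginf' i (x, xi)) => // h; apply: Nxi; rewrite /xsection/=; exact/mem_set.
have oscE x V : measurable V -> closure Omega x -> tl (xsection N x) = 0%E ->
    forall i, vintegral tl V (fun xi => vintegral (y_nu nu x xi) setT id) 0 i =
    \int[tl]_(xi in V) g i (x, xi).
  move=> mV cx Nx i; rewrite mxE; apply: ae_eq_Rintegral.
  exists (xsection N x); split; [exact: measurable_xsection|exact: Nx|].
  move=> xi /= /not_implyP[_]; apply: contra_notP => Nxi; rewrite mxE.
  by apply: (hg' (x, xi) _ _).2 => // h; apply: Nxi; rewrite /xsection/=; exact/mem_set.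
have iginf x i : (rho x).-integrable setT (EFin \o (fun xi => ginf i (x, xi))).
  apply: (@bounded_integrable _ _ _ _ _ 1); first exact: measurableT_comp.
  by move=> xi; exact: ginf1.
(* Reg carries no [lams] mass and Sing no Lebesgue mass, so each measure is checked on its own part
   of the closure. *)
have ae_cover (P : 'rV[R]_d -> Prop) :
    {ae lebesgue_rV R d, forall x, Reg x -> P x} -> {ae lams, forall x, Sing x -> P x} ->
    {ae measure_add (lebesgue_rV R d) lams, forall x, closure Omega x -> P x}.
  by rewrite -RS; exact: ae_measure_add.
suff : {ae measure_add (lebesgue_rV R d) lams, forall x0, closure Omega x0 -> Omega x0 ->
    exists M : vmeasure R (torus R d) m,
      (forall V, measurable V ->
        vmeasure_val M V = barycenter nu lac Reg x0 V) /\
      forall phi, torus_smooth phi ->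
        operator_distribution A (@torus_mpartial R d k) (distribution_of M) phi
        = 0}.
  by apply: filterS => x h Ox; apply: h => //; exact: subset_closure.
apply: ae_cover.
  (* On Reg the measure M has density g against Lebesgue measure and lac x times ginf against the
     Borel version of rho. *)
  apply: filterS3 good1 good2L keyL => x [igx Nx] lacx idx Rx Ox.
  have cx := subset_closure Ox.
  have [|||M [MV MA]] := @exists_operator_free R d m n k A (rho x) (fun i xi => g i (x, xi))
    (fun i xi => lac x * ginf i (x, xi)) phi_ _ _ sphi_ dense.
  - exact: igx.
  - move=> i; have := integrableZl measurableT (lac x) (iginf x i).
    by apply: eq_integrable => // xi _; rewrite /= EFinM.
  - move=> l j; rewrite -[RHS](idx l j (conj Rx Ox)) mulr_sumr -big_split/=.
    apply: eq_bigr => q _; rewrite mulrDr [X in _ = _ + X]mulrCA; congr (_ + _ * _).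
    have cq := torus_mpartial_continuous (a := q.1) (sphi_ l).
    have [C _ hC] := continuous_torus_bounded cq.
    rewrite -RintegralZl//; last first.
      exact: integrable_bounded_mul (continuous_measurable_torus cq) hC (iginf x q.2).
    by apply: eq_Rintegral => xi _; rewrite mulrCA.
  exists M; split => // V mV; apply/rowP => i; rewrite MV// /barycenter mem_set// mxE oscE//.
  congr (_ + _); rewrite mxE RintegralZl//; last exact: integrableS (iginf x i).
  (* Where lac x = 0 the Borel version may differ from rho at x, but both concentration terms are
     multiplied by 0. *)
  case: lacx => [->|h]; first by rewrite !mul0r.
  by have [? ?] := h cx; rewrite concE.
(* On Sing the barycenter is pure concentration, so the Lebesgue density is taken to be 0. *)
apply: filterS2 good2s keys => x h idx Sx Ox.
have cx := subset_closure Ox; have [rx Nx] := h cx.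
have [|||M [MV MA]] := @exists_operator_free R d m n k A (rho x) (fun _ _ => 0)
    (fun i xi => ginf i (x, xi)) phi_ _ _ sphi_ dense.
- by move=> i; exact: integrable0.
- exact: iginf.
- move=> l j; rewrite -[RHS](idx l j (conj Sx Ox)); apply: eq_bigr => q _.
  by under eq_Rintegral do rewrite mulr0; rewrite Rintegral_cst// mul0r add0r.
exists M; split => // V mV; apply/rowP => i; rewrite MV// /barycenter.
rewrite memNset; last by move=> Rx; have : (Reg `&` Sing) x by []; rewrite RS0.
by rewrite concE// Rintegral_cst// mul0r add0r.
Qed.
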